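(* Let $f$ be a semiregular function on a symmetric slice domain $\Omega\subseteq\mathbb{H}$. Choose $p=x+yI\in\Omega$ (with $x,y\in\mathbb{R}$, $I\in\mathbb{S}$) and set $m=\mathrm{ord}_f(p)$, $n=\mathrm{ord}_f(\bar p)$: without loss of generality $m\le n$. There exist a neighborhood $U$ of $p$ in $\Omega$ that is a symmetric slice domain and a (unique) regular function $g:U\to\mathbb{H}$ such that $$f(q)=\left[(q-p)^{*m}*(q-\bar p)^{*n}\right]^{-*}*g(q)=\left[(q-x)^2+y^2\right]^{-n}(q-p)^{*(n-m)}*g(q)$$ in $U\setminus(x+y\mathbb{S})$. Moreover, if $n>0$ then $g(p)\neq0$ and $g(\bar p)\neq0$.
   Context: $\mathbb{H}$ denotes the quaternions, $\mathbb{S}=\{q\in\mathbb{H}:q^2=-1\}$, and $x+y\mathbb{S}=\{x+Jy:J\in\mathbb{S}\}$ for $x,y\in\mathbb{R}$. For $\Omega\subseteq\mathbb{H}$ and $I\in\mathbb{S}$ put $\Omega_I=\Omega\cap(\mathbb{R}+I\mathbb{R})$ and $f_I=f|_{\Omega_I}$. A function $f_I$ is holomorphic if it has continuous partial derivatives and $\frac12\left(\frac{\partial}{\partial x}+I\frac{\partial}{\partial y}\right)f_I(x+Iy)\equiv0$; a function $f:\Omega\to\mathbb{H}$ is regular if $f_I$ is holomorphic for all $I\in\mathbb{S}$. A set is symmetric if together with each $x+Iy$ it contains $x+y\mathbb{S}$. A domain (connected open set) $\Omega$ is a slice domain if it meets the real axis and every $\Omega_I$ is a domain in $\mathbb{R}+I\mathbb{R}$.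 On a symmetric slice domain $\Omega$, every holomorphic $\phi:\Omega_I\to\mathbb{H}$ has a unique regular extension $\mathrm{ext}(\phi)$ to $\Omega$. For $f,g$ regular on $\Omega$ and $I\perp J$ in $\mathbb{S}$, write $f_I=F+GJ$, $g_I=H+KJ$ with $F,G,H,K:\Omega_I\to\mathbb{R}+I\mathbb{R}$ holomorphic; then (independently of $I,J$) $$f*g=\mathrm{ext}\left(\left[F(z)H(z)-G(z)\overline{K(\bar z)}\right]+\left[F(z)K(z)+G(z)\overline{H(\bar z)}\right]J\right),\qquad f^c=\mathrm{ext}\left(\overline{F(\bar z)}-G(z)J\right),$$ and $f^s=f*f^c$. If $f\not\equiv0$, the regular reciprocal of $f$ is $f^{-*}=\frac1{f^s}f^c$, defined off the zero set of $f^s$. Also $(q-p)^{*n}$ denotes the $n$-th $*$-power of $q\mapsto q-p$, and $(q-p)^{*(-m)}=(q-p)^{-*m}$ is the regular reciprocal of $(q-p)^{*m}$; if $p\in\mathbb{R}+I\mathbb{R}$, the restriction of $(q-p)^{*n}$ to $\mathbb{R}+I\mathbb{R}$ is $(z-p)^n$ for all $n\in\mathbb{Z}$. Singularities. Put $\sigma(q,p)=\tau(q,p)=|q-p|$ if $p,q$ lie on a common complex line $\mathbb{R}+I\mathbb{R}$, and otherwise $\sigma(q,p)=\sqrt{(\mathrm{Re}\,q-\mathrm{Re}\,p)^2+(|\mathrm{Im}\,q|+|\mathrm{Im}\,p|)^2}$, $\tau(q,p)=\sqrt{(\mathrm{Re}\,q-\mathrm{Re}\,p)^2+(|\mathrm{Im}\,q|-|\mathrm{Im}\,p|)^2}$.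 Let $\Sigma(p,0,R)=\{q:\tau(q,p)>0,\ \sigma(q,p)<R\}$. If $f$ is regular on a symmetric slice domain $\Omega'$, a point $p\in\mathbb{H}$ is a singularity for $f$ if $\Sigma(p,0,R)\subseteq\Omega'$ for some $R>0$; then $f$ has an expansion $f(q)=\sum_{n\in\mathbb{Z}}(q-p)^{*n}a_n$ in $\Sigma(p,0,R)$, whose restriction to the complex line $\mathbb{R}+I\mathbb{R}$ through $p$ is the Laurent expansion $f_I(z)=\sum_{n\in\mathbb{Z}}(z-p)^na_n$ in $0<|z-p|<R$. The point $p$ is a pole if there is $m\ge0$ with $a_{-k}=0$ for all $k>m$; the least such $m$ is the order $\mathrm{ord}_f(p)$ (so $\mathrm{ord}_f(p)=0$ if $f$ is regular near $p$). It is removable if $f$ extends to a neighborhood of $p$ as a regular function. A function $f$ is semiregular in a symmetric slice domain $\Omega$ if it is regular in a symmetric slice domain $\Omega'\subseteq\Omega$ such that every point of $\Omega\setminus\Omega'$ is a pole or a removable singularity for $f$.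
   Formalization: The last sentence is false if p is real (f(q)=1/q, p=0 gives g(q)=q) or if m=0 (f_I(z)=(z-p)/(z-p̄)^n gives g(p)=0). What is proved instead: if n>0 and p is not real, then g(p̄)≠0, and if moreover m>0, then g(p)≠0. *)

(* Defs.v *)
From Stdlib Require Import Reals ZArith ClassicalEpsilon.
From Coquelicot Require Import Coquelicot.

Open Scope R_scope.

(** ** Quaternions: [(a, b, c, d)] is [a + b i + c j + d k] *)

(* As an iterated product of copies of [R], [quat] inherits Coquelicot's
   uniform (hence topological) and normed [R]-module structures; the sup norm
   used there defines the Euclidean topology. *)
Definition quat : Type := (R * R * R * R)%type.

Canonical quat_UniformSpace :=
  UniformSpace.Pack quat
    (UniformSpace.class
       (prod_UniformSpace
          (prod_UniformSpace (prod_UniformSpace R_UniformSpace R_UniformSpace)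
             R_UniformSpace) R_UniformSpace)) quat.

Canonical quat_NormedModule :=
  NormedModule.Pack R_AbsRing quat
    (NormedModule.class R_AbsRing
       (prod_NormedModule R_AbsRing
          (prod_NormedModule R_AbsRing
             (prod_NormedModule R_AbsRing R_NormedModule R_NormedModule)
             R_NormedModule) R_NormedModule)) quat.

Declare Scope quat_scope.
Delimit Scope quat_scope with quat.
Bind Scope quat_scope with quat.

Definition qre (q : quat) : R := let '(a, _, _, _) := q in a.

Definition qreal (t : R) : quat := (t, 0, 0, 0).

Definition qadd (p q : quat) : quat :=
  let '(a, b, c, d) := p in let '(a', b', c', d') := q in
  (a + a', b + b', c + c', d + d').

Definition qopp (p : quat) : quat :=
  let '(a, b, c, d) := p in (- a, - b, - c, - d).

Definition qsub (p q : quat) : quat := qadd p (qopp q).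

Definition qmul (p q : quat) : quat :=
  let '(a, b, c, d) := p in let '(a', b', c', d') := q in
  (a * a' - b * b' - c * c' - d * d',
   a * b' + b * a' + c * d' - d * c',
   a * c' - b * d' + c * a' + d * b',
   a * d' + b * c' - c * b' + d * a').

(* Euclidean inner product and norm (not the sup norm of the module). *)
Definition qdot (p q : quat) : R :=
  let '(a, b, c, d) := p in let '(a', b', c', d') := q in
  a * a' + b * b' + c * c' + d * d'.

Definition qabs (q : quat) : R := sqrt (qdot q q).

Definition qim (q : quat) : quat :=
  let '(_, b, c, d) := q in (0, b, c, d).

(* conjugate over squared norm; meaningful for nonzero arguments only *)
Definition qinv (q : quat) : quat :=
  let '(a, b, c, d) := q in
  qmul (qreal (/ qdot q q)) (a, - b, - c, - d).

Fixpoint qpow (q : quat) (n : nat) : quat :=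
  match n with
  | O => qreal 1
  | S n => qmul q (qpow q n)
  end.

Notation "p + q" := (qadd p q) : quat_scope.
Notation "- p" := (qopp p) : quat_scope.
Notation "p - q" := (qsub p q) : quat_scope.
Notation "p * q" := (qmul p q) : quat_scope.
Notation "p ^ n" := (qpow p n) : quat_scope.

(** ** Slices *)

Definition imag_unit (I : quat) : Prop := (I * I)%quat = qreal (-1).

(* The complex line [R + I R] is identified with Coquelicot's [C] through
   [x + y i |-> x + y I], a ring isomorphism which also carries conjugation
   to conjugation.  Subsets of the line, and functions on or into it, are
   transported to [C] by means of it. *)
Definition emb (I : quat) (z : C) : quat :=
  (qreal (Re z) + qreal (Im z) * I)%quat.

Definition slice (Om : quat -> Prop) (I : quat) : C -> Prop :=
  fun z => Om (emb I z).

(* [x + y S] *)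
Definition sphere (x y : R) (q : quat) : Prop :=
  exists J, imag_unit J /\ q = emb J (x, y).

Definition connected_set {T : UniformSpace} (A : T -> Prop) : Prop :=
  forall V W : T -> Prop,
    open V -> open W ->
    (forall t, A t -> V t \/ W t) ->
    (exists t, A t /\ V t) -> (exists t, A t /\ W t) ->
    exists t, A t /\ V t /\ W t.

Definition domain {T : UniformSpace} (A : T -> Prop) : Prop :=
  open A /\ connected_set A.

Definition slice_domain (Om : quat -> Prop) : Prop :=
  domain Om /\
  (exists t : R, Om (qreal t)) /\
  (forall I, imag_unit I -> domain (slice Om I)).

Definition symmetric (Om : quat -> Prop) : Prop :=
  forall (x y : R) (I : quat), imag_unit I -> Om (emb I (x, y)) ->
  forall q, sphere x y q -> Om q.

Definition symmetric_slice_domain (Om : quat -> Prop) : Prop :=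
  slice_domain Om /\ symmetric Om.

(** ** Regular functions *)

(* Functions are total on [quat] (or on [C]); only their values on the
   relevant set are meaningful.  Here [E] is meant to be open in [C]. *)
Definition holomorphic_on (E : C -> Prop) (I : quat) (phi : C -> quat) : Prop :=
  exists dx dy : C -> quat,
  forall z : C, E z ->
    is_derive (fun t : R => phi (t, Im z)) (Re z) (dx z) /\
    is_derive (fun t : R => phi (Re z, t)) (Im z) (dy z) /\
    continuous dx z /\ continuous dy z /\
    (qreal (1 / 2) * (dx z + I * dy z))%quat = qreal 0.

Definition regular (Om : quat -> Prop) (f : quat -> quat) : Prop :=
  forall I, imag_unit I -> holomorphic_on (slice Om I) I (fun z => f (emb I z)).

(* On a symmetric slice domain there is, for every holomorphic [phi], exactly
   one such function up to its values outside [Om]. *)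
Definition ext (Om : quat -> Prop) (I : quat) (phi : C -> quat) : quat -> quat :=
  epsilon (inhabits (fun _ : quat => qreal 0))
    (fun h => regular Om h /\ forall z, slice Om I z -> h (emb I z) = phi z).

(* [f_I = F + G J] with [F], [G] holomorphic from [Om_I] to [R + I R] *)
Definition splits (Om : quat -> Prop) (I J : quat) (f : quat -> quat)
    (F G : C -> C) : Prop :=
  holomorphic_on (slice Om I) I (fun z => emb I (F z)) /\
  holomorphic_on (slice Om I) I (fun z => emb I (G z)) /\
  forall z, slice Om I z -> f (emb I z) = (emb I (F z) + emb I (G z) * J)%quat.

(* Both operations are independent of the orthogonal pair [I], [J] used in
   the splitting, so any admissible pair may be selected. *)
Definition star (Om : quat -> Prop) (f g : quat -> quat) : quat -> quat :=
  epsilon (inhabits (fun _ : quat => qreal 0))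
    (fun h => exists (I J : quat) (F G H K : C -> C),
       imag_unit I /\ imag_unit J /\ qdot I J = 0 /\
       splits Om I J f F G /\ splits Om I J g H K /\
       h = ext Om I (fun z =>
             (emb I (Cminus (Cmult (F z) (H z))
                            (Cmult (G z) (Cconj (K (Cconj z)))))
              + emb I (Cplus (Cmult (F z) (K z))
                             (Cmult (G z) (Cconj (H (Cconj z))))) * J)%quat)).

Definition reg_conj (Om : quat -> Prop) (f : quat -> quat) : quat -> quat :=
  epsilon (inhabits (fun _ : quat => qreal 0))
    (fun h => exists (I J : quat) (F G : C -> C),
       imag_unit I /\ imag_unit J /\ qdot I J = 0 /\
       splits Om I J f F G /\
       h = ext Om I (fun z =>
             (emb I (Cconj (F (Cconj z))) - emb I (G z) * J)%quat)).

Definition symmetrization (Om : quat -> Prop) (f : quat -> quat) : quat -> quat :=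
  star Om f (reg_conj Om f).

(* meaningful off the zero set of the symmetrization *)
Definition reg_recip (Om : quat -> Prop) (f : quat -> quat) : quat -> quat :=
  fun q => (qinv (symmetrization Om f q) * reg_conj Om f q)%quat.

Fixpoint star_pow (Om : quat -> Prop) (f : quat -> quat) (n : nat) : quat -> quat :=
  match n with
  | O => fun _ => qreal 1
  | S n => star Om f (star_pow Om f n)
  end.

Definition whole : quat -> Prop := fun _ => True.

(* [q |-> (q - p)^{*n}] *)
Definition lin_pow (p : quat) (n : nat) : quat -> quat :=
  star_pow whole (fun q => (q - p)%quat) n.

Definition lin_powZ (p : quat) (n : Z) : quat -> quat :=
  if (0 <=? n)%Z then lin_pow p (Z.to_nat n)
  else reg_recip whole (lin_pow p (Z.to_nat (- n))).

(** ** Singularities *)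

Definition same_line (q p : quat) : Prop :=
  exists (I : quat) (z w : C), imag_unit I /\ q = emb I z /\ p = emb I w.

Definition sigma_dist (q p : quat) : R :=
  if excluded_middle_informative (same_line q p) then qabs (q - p)
  else sqrt ((qre q - qre p) ^ 2 + (qabs (qim q) + qabs (qim p)) ^ 2).

Definition tau_dist (q p : quat) : R :=
  if excluded_middle_informative (same_line q p) then qabs (q - p)
  else sqrt ((qre q - qre p) ^ 2 + (qabs (qim q) - qabs (qim p)) ^ 2).

(* [Sigma (p, 0, r)] *)
Definition Sigma_set (p : quat) (r : R) (q : quat) : Prop :=
  0 < tau_dist q p /\ sigma_dist q p < r.

Definition singularity (Om : quat -> Prop) (p : quat) : Prop :=
  exists r : R, 0 < r /\ (forall q, Sigma_set p r q -> Om q).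

(* [f q] is the sum over all integers [n] of [(q - p)^{*n} a_n], the series
   of nonnegative and of negative powers both converging. *)
Definition laurent_expansion (f : quat -> quat) (p : quat) (r : R)
    (a : Z -> quat) : Prop :=
  forall q, Sigma_set p r q ->
  exists s1 s2 : quat,
    is_series (fun k : nat =>
      (lin_powZ p (Z.of_nat k) q * a (Z.of_nat k))%quat) s1 /\
    is_series (fun k : nat =>
      (lin_powZ p (- Z.of_nat (S k)) q * a (- Z.of_nat (S k))%Z)%quat) s2 /\
    f q = (s1 + s2)%quat.

Definition pole_bound (Om : quat -> Prop) (f : quat -> quat) (p : quat)
    (m : nat) : Prop :=
  exists (r : R) (a : Z -> quat),
    0 < r /\ (forall q, Sigma_set p r q -> Om q) /\
    laurent_expansion f p r a /\
    forall k : nat, (m < k)%nat -> a (- Z.of_nat k)%Z = qreal 0.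

Definition pole (Om : quat -> Prop) (f : quat -> quat) (p : quat) : Prop :=
  exists m : nat, pole_bound Om f p m.

(* [ord_f (p) = m] *)
Definition is_order (Om : quat -> Prop) (f : quat -> quat) (p : quat)
    (m : nat) : Prop :=
  pole_bound Om f p m /\
  forall m' : nat, pole_bound Om f p m' -> (m <= m')%nat.

Definition removable (Om : quat -> Prop) (f : quat -> quat) (p : quat) : Prop :=
  singularity Om p /\
  exists (V : quat -> Prop) (h : quat -> quat),
    open V /\ V p /\ regular V h /\ forall q, V q -> Om q -> h q = f q.

(* [Om'] is the domain on which [f] is actually defined and regular. *)
Definition semiregular (Om Om' : quat -> Prop) (f : quat -> quat) : Prop :=
  symmetric_slice_domain Om' /\
  (forall q, Om' q -> Om q) /\
  regular Om' f /\
  forall q, Om q -> ~ Om' q -> pole Om' f q \/ removable Om' f q.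

(** ** The factorization at [p = x + y I] *)

Definition off_sphere (U : quat -> Prop) (x y : R) : quat -> Prop :=
  fun q => U q /\ ~ sphere x y q.

(* In both formulas the product with [g] is the [*]-product over
   [U \ (x + y S)]. *)
Definition factorization (U : quat -> Prop) (f : quat -> quat) (x y : R)
    (I : quat) (m n : nat) (g : quat -> quat) : Prop :=
  let p := emb I (x, y) in
  let pbar := emb I (x, - y) in
  let D := off_sphere U x y in
  forall q, D q ->
    f q = star D (reg_recip whole (star whole (lin_pow p m) (lin_pow pbar n))) g q /\
    f q = star D (fun s =>
            (qinv (((s - qreal x) ^ 2 + qreal (y ^ 2)%R) ^ n)
             * lin_pow p (n - m) s)%quat) g q.

(* Main.v *)
(** On the slice of [I] put [G(z) = (z - p)^m (z - conj p)^n f(z)].  By the two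
    Laurent expansions [G] extends holomorphically across [p] and [conj p], with
    values [(p - conj p)^n a_(-m)] and [(conj p - p)^m b_(-n)] if [p] is not real;
    when the orders are positive, the leading coefficients do not vanish, by
    minimality.  The
    regular extension [g] of [G] lives on [U = Om' \/ (x + y S)].  A [*]-product
    whose left factor takes values in [R + I R] on the slice of [I] is there the
    pointwise product, so both formulas reduce to [f = G / ((z - p)^m (z - conj p)^n)]
    on one slice of [U \ (x + y S)], and the identity principle carries them to
    the other slices.

    The identity principle is obtained without power series expansions: a Cauchy
    homotopy integral shows that vanishing propagates over discs, and vanishing
    on a real segment reduces to vanishing on a half disc by cutting the function
    off along the real axis. *)

From Stdlib Require Import Reals ZArith ClassicalEpsilon Lra Lia Psatz Ncring Ncring_tac.
From Coquelicot Require Import Coquelicot.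
Require Import Defs.

Open Scope R_scope.

(** * Quaternion algebra *)

(** [ext], [star] and [reg_conj] are choices by [epsilon]: nothing is known about their values until
    some regular function with the prescribed restriction is exhibited, and the orthogonal pair they
    split with may lie on a slice other than that of [I]. Stem functions meet both difficulties. On
    a slice write phi(z) = alpha + I beta and phi(conj z) = alpha - I beta. Then alpha + J beta is
    an explicit regular candidate, and the representation formula says that a regular function has
    the same alpha and beta on every slice. So a formula stated with an unknown pair is compared
    with one stated on the slice of [I] by comparing stems. That the choice has no other outcome
    rests on the identity principle along the real axis, which all slices share.

    A second obstacle is that holomorphic means having continuous partial derivatives at every
    point, while a Laurent expansion is given only as pointwise convergence. Filling in p therefore
    needs a derivative at p and its continuity there; both are drawn from coefficient bounds, which
    boundedness of the terms at a single point provides. *)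

Lemma quat_eq (a b c d a' b' c' d' : R) :
  a = a' -> b = b' -> c = c' -> d = d' ->
  (a, b, c, d) = (a', b', c', d') :> quat.
Proof. now intros -> -> -> ->. Qed.

Ltac qcrush :=
  intros; repeat match goal with q : quat |- _ => destruct q as [[[? ?] ?] ?] end;
  repeat match goal with z : C |- _ => destruct z as [? ?] end;
  unfold emb, qsub, qreal, Cminus, Cconj, Cmult, Cplus, Copp, RtoC, Ci, Re, Im in *;
  cbn [qadd qopp qmul qre qim qdot fst snd] in *;
  apply quat_eq; try ring; try field.

(** Makes [non_commutative_ring] available. It does not know that real scalars are central, so
    scalars are moved by hand with [qreal_comm]. *)
#[global] Instance quat_ops :
  Ring_ops (T := quat) (ring0 := qreal 0) (ring1 := qreal 1) (add := qadd)
    (mul := qmul) (sub := qsub) (opp := qopp) (ring_eq := @eq quat) := {}.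

#[global] Instance quat_ring : Ncring.Ring (Ro := quat_ops).
Proof.
  constructor; try typeclasses eauto; try (now intros x y -> z t ->);
  try (now intros x y ->); cbv [equality addition multiplication subtraction
   opposite zero_notation one_notation zero one add_notation mul_notation
   sub_notation opp_notation eq_notation]; qcrush.
Qed.

Lemma qmulA (a b c : quat) : (a * (b * c) = a * b * c)%quat.
Proof. non_commutative_ring. Qed.

Lemma qmul_1_l (a : quat) : (qreal 1 * a = a)%quat.
Proof. non_commutative_ring. Qed.

Lemma qmul_0_r (a : quat) : (a * qreal 0 = qreal 0)%quat.
Proof. non_commutative_ring. Qed.

Lemma qreal_comm (t : R) (a : quat) : (a * qreal t = qreal t * a)%quat.
Proof. qcrush. Qed.

Lemma qsub_eq_0 (a b : quat) : (a - b)%quat = qreal 0 -> a = b.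
Proof.
  intros H. transitivity (a - b + b)%quat; [non_commutative_ring|].
  rewrite H; non_commutative_ring.
Qed.

Lemma qdot_pos (q : quat) : q <> qreal 0 -> 0 < qdot q q.
Proof.
  intros H. destruct (Rle_lt_dec (qdot q q) 0) as [h|h]; [exfalso|exact h].
  apply H. destruct q as [[[a b] c] d]. cbn in h.
  apply quat_eq; nra.
Qed.

Lemma qinv_l (q : quat) : q <> qreal 0 -> (qinv q * q)%quat = qreal 1.
Proof.
  intros H; generalize (qdot_pos q H). destruct q as [[[a b] c] d]. cbn.
  intros h. apply quat_eq; field; lra.
Qed.

Lemma qmul_integral (a b : quat) :
  a <> qreal 0 -> (a * b)%quat = qreal 0 -> b = qreal 0.
Proof.
  intros Ha H. rewrite <- (qmul_1_l b), <- (qinv_l a Ha), <- qmulA, H.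
  apply qmul_0_r.
Qed.

Lemma imag_unit_coord (I : quat) : imag_unit I ->
  exists b c d, I = (0, b, c, d) /\ b * b + c * c + d * d = 1.
Proof.
  destruct I as [[[a b] c] d]. unfold imag_unit, qreal. cbn. intros H.
  injection H; intros H4 H3 H2 H1.
  assert (a = 0).
  { destruct (Req_dec a 0) as [h|h]; [exact h|exfalso].
    assert (b = 0) by nra. assert (c = 0) by nra. assert (d = 0) by nra.
    subst. nra. }
  subst. exists b, c, d. split; [reflexivity|lra].
Qed.

Lemma imag_unit_i : imag_unit (0, 1, 0, 0).
Proof. unfold imag_unit, qreal; cbn; apply quat_eq; ring. Qed.

Lemma imag_unit_opp (I : quat) : imag_unit I -> imag_unit (- I)%quat.
Proof.
  unfold imag_unit. intros H. rewrite <- H. non_commutative_ring.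
Qed.

Lemma imag_unit_mul (I q : quat) : imag_unit I -> (I * (I * q) = - q)%quat.
Proof.
  intros H. rewrite qmulA, H. qcrush.
Qed.

Lemma emb_mult (I : quat) (z w : C) : imag_unit I ->
  emb I (Cmult z w) = (emb I z * emb I w)%quat.
Proof.
  intros H; destruct (imag_unit_coord I H) as (b & c & d & -> & h).
  destruct z as [z1 z2], w as [w1 w2]. unfold emb, qreal, Cmult, Re, Im; cbn.
  apply quat_eq; try ring.
  replace (z1 * w1 - z2 * w2) with (z1 * w1 - z2 * w2 * (b * b + c * c + d * d))
    by (rewrite h; ring). ring.
Qed.

Lemma emb_plus (I : quat) (z w : C) : emb I (Cplus z w) = (emb I z + emb I w)%quat.
Proof. qcrush. Qed.

Lemma emb_minus (I : quat) (z w : C) : emb I (Cminus z w) = (emb I z - emb I w)%quat.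
Proof. qcrush. Qed.

Lemma emb_RtoC (I : quat) (t : R) : emb I (RtoC t) = qreal t.
Proof. qcrush. Qed.

Lemma emb_inj (I : quat) (z w : C) : imag_unit I -> emb I z = emb I w -> z = w.
Proof.
  intros H; destruct (imag_unit_coord I H) as (b & c & d & -> & h).
  destruct z as [z1 z2], w as [w1 w2]. unfold emb, qreal, Re, Im; cbn.
  intros E; injection E; intros E4 E3 E2 E1.
  f_equal; [lra|].
  assert (f2 : z2 * b = w2 * b) by lra. assert (f3 : z2 * c = w2 * c) by lra.
  assert (f4 : z2 * d = w2 * d) by lra.
  transitivity (z2 * b * b + z2 * c * c + z2 * d * d).
  - transitivity (z2 * (b * b + c * c + d * d)); [rewrite h|]; ring.
  - rewrite f2, f3, f4. transitivity (w2 * (b * b + c * c + d * d)); [|rewrite h]; ring.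
Qed.

Lemma emb_comm (I : quat) (z : C) : (I * emb I z = emb I z * I)%quat.
Proof. qcrush. Qed.

Lemma emb_opp_conj (I : quat) (z : C) : emb (- I)%quat z = emb I (Cconj z).
Proof. qcrush. Qed.

Lemma emb_inv (I : quat) (z : C) : imag_unit I -> z <> RtoC 0 ->
  qinv (emb I z) = emb I (Cinv z).
Proof.
  intros H hz; destruct (imag_unit_coord I H) as (b & c & d & -> & h).
  assert (hp : 0 < fst z ^ 2 + snd z ^ 2).
  { destruct z as [z1 z2]; cbn. destruct (Req_dec z1 0) as [->|h1]; [|nra].
    destruct (Req_dec z2 0) as [->|h2]; [exfalso; now apply hz|nra]. }
  destruct z as [z1 z2]. unfold emb, qreal, Cinv, Re, Im; cbn in *.
  set (N := (_ + _ + _ + _)%R).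
  assert (N = z1 * (z1 * 1) + z2 * (z2 * 1)) as ->.
  { unfold N. transitivity (z1 * z1 + z2 * z2 * (b * b + c * c + d * d)); [ring|rewrite h; ring]. }
  apply quat_eq; field; lra.
Qed.

(** The commutator of two quaternions is twice the cross product of their imaginary parts. If it
    vanishes, the imaginary part of [q] is parallel to the unit vector [I]. Hence [I * q = q * I]
    serves throughout as the way to say that a value lies in the line of [I]. *)
Lemma commute_emb (I q : quat) : imag_unit I -> (I * q = q * I)%quat ->
  q = emb I (qre q, qdot q I).
Proof.
  intros H; destruct (imag_unit_coord I H) as (b & c & d & -> & h).
  destruct q as [[[q0 q1] q2] q3]. unfold emb, qreal, Re, Im; cbn.
  intros E; injection E; intros E3 E2 E1 _.
  assert (e1 : c * q3 = d * q2) by lra.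
  assert (e2 : d * q1 = b * q3) by lra.
  assert (e3 : b * q2 = c * q1) by lra.
  apply quat_eq; [ring| | |].
  - transitivity (q1 * (b * b + c * c + d * d)); [rewrite h; ring|].
    transitivity (q1 * b * b + c * (c * q1) + d * (d * q1)); [ring|].
    rewrite <- e3, e2. ring.
  - transitivity (q2 * (b * b + c * c + d * d)); [rewrite h; ring|].
    transitivity (q2 * c * c + b * (b * q2) + d * (d * q2)); [ring|].
    rewrite e3, <- e1. ring.
  - transitivity (q3 * (b * b + c * c + d * d)); [rewrite h; ring|].
    transitivity (q3 * d * d + b * (b * q3) + c * (c * q3)); [ring|].
    rewrite <- e2, e1. ring.
Qed.

Lemma orthogonal_anticommute (I J : quat) : imag_unit I -> imag_unit J ->
  qdot I J = 0 -> (J * I = - (I * J))%quat.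
Proof.
  intros HI HJ; destruct (imag_unit_coord I HI) as (b & c & d & -> & h),
   (imag_unit_coord J HJ) as (b' & c' & d' & -> & h').
  cbn. intros e. apply quat_eq; lra.
Qed.

Lemma orthogonal_exists (I : quat) : imag_unit I ->
  exists J, imag_unit J /\ qdot I J = 0.
Proof.
  intros HI; destruct (imag_unit_coord I HI) as (b & c & d & -> & h).
  destruct (Req_dec (b * b + c * c) 0) as [e|e].
  - exists (0, 1, 0, 0). split; [apply imag_unit_i|]. cbn. nra.
  (* A quarter turn of the first two imaginary coordinates, normalized; the case where they vanish
     is the one treated before. *)
  - set (s := sqrt (b * b + c * c)).
    assert (hs : s * s = b * b + c * c) by (apply sqrt_sqrt; nra).
    assert (s <> 0) by nra.
    exists (0, - c / s, b / s, 0). split.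
    + unfold imag_unit, qreal; cbn.
      assert (hq : - c / s * (- c / s) + b / s * (b / s) = 1).
      { transitivity ((b * b + c * c) / (s * s)); [now field|].
        rewrite hs; field; exact e. }
      apply quat_eq; try ring; lra.
    + cbn. field; assumption.
Qed.

Lemma anticommute_emb (I J : quat) (z : C) : (J * I = - (I * J))%quat ->
  (J * emb I z = emb I (Cconj z) * J)%quat.
Proof.
  intros H. transitivity (qreal (Re z) * J + qreal (Im z) * (J * I))%quat.
  { unfold emb. rewrite <- (qreal_comm (Re z)), qmulA.
    rewrite <- (qreal_comm (Im z) J). non_commutative_ring. }
  rewrite H. destruct z as [z1 z2]. unfold emb, Cconj, Re, Im; cbn [fst snd].
  replace (qreal (- z2)) with (- qreal z2)%quat by qcrush. non_commutative_ring.
Qed.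

Definition qconj (q : quat) : quat :=
  let '(a, b, c, d) := q in (a, - b, - c, - d)%R.

Lemma qconj_add (a b : quat) : qconj (a + b)%quat = (qconj a + qconj b)%quat.
Proof. destruct a as [[[? ?] ?] ?], b as [[[? ?] ?] ?]. apply quat_eq; ring. Qed.

Lemma qconj_mul (a b : quat) : qconj (a * b)%quat = (qconj b * qconj a)%quat.
Proof. destruct a as [[[? ?] ?] ?], b as [[[? ?] ?] ?]. apply quat_eq; ring. Qed.

Lemma qconj_emb (I : quat) (z : C) : imag_unit I -> qconj (emb I z) = emb I (Cconj z).
Proof.
  intros H; destruct (imag_unit_coord I H) as (b & c & d & -> & h).
  qcrush. all: cbn; ring.
Qed.

Lemma qconj_unit (I : quat) : imag_unit I -> qconj I = (- I)%quat.
Proof.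
  intros H; destruct (imag_unit_coord I H) as (b & c & d & -> & h).
  apply quat_eq; ring.
Qed.

(** * Polar coordinates on the sphere of imaginary units *)

(** Kept as a named atom, since [non_commutative_ring] does not compute with fractions: [half_comm]
    moves it and [half_half] removes it. *)
Definition half : quat := qreal (1 / 2).

Lemma half_comm (a : quat) : (a * half = half * a)%quat.
Proof. apply qreal_comm. Qed.

Lemma half_half (a : quat) : (half * (a + a) = a)%quat.
Proof. unfold half; qcrush. Qed.

(** With [stem_im], the solution (alpha, beta) of phi(z) = alpha + I beta and phi(conj z) = alpha -
    I beta. Thus alpha is even and beta odd under conjugation. *)
Definition stem_re (phi : C -> quat) (z : C) : quat :=
  (half * (phi z + phi (Cconj z)))%quat.

Definition stem_im (I : quat) (phi : C -> quat) (z : C) : quat :=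
  (half * (I * (phi (Cconj z) - phi z)))%quat.

(* On the real axis any direction will do, since [stem_im] vanishes there. *)
Definition unit_dir (I q : quat) : quat :=
  if Req_EM_T (qabs (qim q)) 0 then I else (qreal (/ qabs (qim q)) * qim q)%quat.

(* The representation formula [alpha + J beta] taken as a definition. *)
Definition slice_ext (I : quat) (phi : C -> quat) (q : quat) : quat :=
  (stem_re phi (qre q, qabs (qim q))
   + unit_dir I q * stem_im I phi (qre q, qabs (qim q)))%quat.

Lemma Cconj_conj (z : C) : Cconj (Cconj z) = z.
Proof. destruct z; unfold Cconj; cbn; now rewrite Ropp_involutive. Qed.

Lemma stem_re_conj (phi : C -> quat) (z : C) : stem_re phi (Cconj z) = stem_re phi z.
Proof. unfold stem_re. rewrite Cconj_conj. non_commutative_ring. Qed.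

Lemma stem_im_conj (I : quat) (phi : C -> quat) (z : C) :
  stem_im I phi (Cconj z) = (- stem_im I phi z)%quat.
Proof. unfold stem_im. rewrite Cconj_conj. non_commutative_ring. Qed.

Lemma stem_unit (I : quat) (phi : C -> quat) (z : C) : imag_unit I ->
  phi z = (stem_re phi z + I * stem_im I phi z)%quat.
Proof.
  intros H. unfold stem_re, stem_im.
  rewrite (qmulA I half), half_comm, <- (qmulA half), (imag_unit_mul I) by exact H.
  rewrite <- (half_half (phi z)) at 1. non_commutative_ring.
Qed.

Lemma stem_unit_conj (I : quat) (phi : C -> quat) (z : C) : imag_unit I ->
  phi (Cconj z) = (stem_re phi z - I * stem_im I phi z)%quat.
Proof.
  intros H. rewrite (stem_unit I phi (Cconj z) H), stem_re_conj, stem_im_conj.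
  non_commutative_ring.
Qed.

Lemma emb_qre (J : quat) (z : C) : imag_unit J -> qre (emb J z) = Re z.
Proof.
  intros H; destruct (imag_unit_coord J H) as (b & c & d & -> & h).
  destruct z as [z1 z2]; cbn. ring.
Qed.

Lemma emb_qim (J : quat) (z : C) : imag_unit J -> qim (emb J z) = (qreal (Im z) * J)%quat.
Proof.
  intros H; destruct (imag_unit_coord J H) as (b & c & d & -> & h).
  destruct z as [z1 z2]; cbn. apply quat_eq; ring.
Qed.

Lemma emb_qabs_qim (J : quat) (z : C) : imag_unit J -> qabs (qim (emb J z)) = Rabs (Im z).
Proof.
  intros H. rewrite emb_qim by exact H.
  destruct (imag_unit_coord J H) as (b & c & d & -> & h). unfold qabs.
  rewrite <- sqrt_Rsqr_abs. f_equal. unfold Rsqr. cbn.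
  transitivity (Im z * Im z * (b * b + c * c + d * d)); [ring|rewrite h; ring].
Qed.

Lemma slice_ext_emb (I J : quat) (phi : C -> quat) (z : C) :
  imag_unit J ->
  slice_ext I phi (emb J z) = (stem_re phi z + J * stem_im I phi z)%quat.
Proof.
  intros HJ. unfold slice_ext, unit_dir.
  rewrite emb_qre, emb_qabs_qim, emb_qim by exact HJ.
  destruct z as [a b]; unfold Re, Im; cbn [fst snd].
  destruct (Req_EM_T (Rabs b) 0) as [e|e].
  - assert (b = 0) as ->.
    { destruct (Req_dec b 0) as [h|h]; [exact h|now apply Rabs_no_R0 in h]. }
    rewrite Rabs_R0.
    replace (stem_im I phi (a, 0)) with (qreal 0); [now rewrite !qmul_0_r|].
    unfold stem_im, Cconj; cbn [fst snd]. rewrite Ropp_0. non_commutative_ring.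
  - destruct (Rle_lt_dec 0 b) as [h|h].
    + rewrite (Rabs_pos_eq b h) in *.
      replace (qreal (/ b) * (qreal b * J))%quat with J; [reflexivity|].
      rewrite qmulA. replace (qreal (/ b) * qreal b)%quat with (qreal 1) by (qcrush; exact e).
      now rewrite qmul_1_l.
    (* Below the real axis the polar direction is [- J] and the polar point is the conjugate; the
       oddness of beta cancels the sign. *)
    + rewrite (Rabs_left b h) in *.
      change (a, - b) with (Cconj (a, b)).
      rewrite stem_re_conj, stem_im_conj.
      replace (qreal (/ - b) * (qreal b * J))%quat with (- J)%quat; [non_commutative_ring|].
      rewrite qmulA.
      replace (qreal (/ - b) * qreal b)%quat with (- qreal 1)%quat
        by (qcrush; lra).
      non_commutative_ring.
Qed.

Lemma slice_ext_same (I : quat) (phi : C -> quat) (z : C) : imag_unit I ->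
  slice_ext I phi (emb I z) = phi z.
Proof.
  intros H. rewrite slice_ext_emb by exact H. now rewrite <- stem_unit.
Qed.

Lemma emb_polar (q : quat) :
  exists J z, imag_unit J /\ q = emb J z /\ z = (qre q, qabs (qim q)).
Proof.
  destruct (Req_dec (qabs (qim q)) 0) as [e|e].
  - exists (0, 1, 0, 0), (qre q, qabs (qim q)). split; [apply imag_unit_i|].
    split; [|reflexivity]. rewrite e.
    destruct q as [[[a b] c] d]. unfold qabs in e. cbn in e.
    apply sqrt_eq_0 in e; [|nra]. unfold emb; cbn. apply quat_eq; nra.
  - exists (qreal (/ qabs (qim q)) * qim q)%quat, (qre q, qabs (qim q)).
    assert (h : qabs (qim q) * qabs (qim q) = qdot (qim q) (qim q)).
    { apply sqrt_sqrt. destruct q as [[[a b] c] d]; cbn. nra. }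
    set (s := qabs (qim q)) in *. clearbody s.
    destruct q as [[[a b] c] d]. cbn in h.
    split; [|split; [|reflexivity]].
    + unfold imag_unit, qreal; cbn. apply quat_eq; field_simplify; try lra.
      replace (- b ^ 2 - c ^ 2 - d ^ 2) with (- (s * s)) by lra. field; exact e.
    + unfold emb, Re, Im; cbn. apply quat_eq; field; exact e.
Qed.

(** * Holomorphic functions on a slice *)

Lemma is_derive_pair {U V : NormedModule R_AbsRing} (f : R -> U) (g : R -> V)
    (t : R) (df : U) (dg : V) :
  is_derive f t df -> is_derive g t dg ->
  is_derive (fun s => (f s, g s)) t (df, dg).
Proof.
  intros Hf Hg. unfold is_derive.
  apply (filterdiff_ext_lin _ (fun y : R => (scal y df, scal y dg))).
  - apply (filterdiff_comp'_2 f g (fun u v => (u, v)) t _ _ (fun u v => (u, v)) Hf Hg).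
    apply (filterdiff_ext_lin _ (fun u => u)).
    + apply (filterdiff_ext (fun u => u)); [now intros []|].
      apply filterdiff_id.
    + now intros [].
  - reflexivity.
Qed.

Lemma is_derive_fst {U V : NormedModule R_AbsRing} (f : R -> U * V) (t : R) (d : U * V) :
  is_derive f t d -> is_derive (fun s => fst (f s)) t (fst d).
Proof.
  intros H. exact (filterdiff_comp' f fst t _ fst H (filterdiff_linear fst is_linear_fst)).
Qed.

Lemma is_derive_snd {U V : NormedModule R_AbsRing} (f : R -> U * V) (t : R) (d : U * V) :
  is_derive f t d -> is_derive (fun s => snd (f s)) t (snd d).
Proof.
  intros H. exact (filterdiff_comp' f snd t _ snd H (filterdiff_linear snd is_linear_snd)).
Qed.

Lemma continuous_pair {T U V : UniformSpace} (f : T -> U) (g : T -> V) (t : T) :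
  continuous f t -> continuous g t -> continuous (fun s => (f s, g s)) t.
Proof.
  intros Hf Hg. apply (continuous_comp_2 f g (fun u v => (u, v)) t Hf Hg).
  apply (continuous_ext (fun u => u)); [now intros []|]. apply continuous_id.
Qed.

(** * Calculus of quaternion-valued functions, coordinate by coordinate *)

Definition q0 (q : quat) : R := fst (fst (fst q)).
Definition q1 (q : quat) : R := snd (fst (fst q)).
Definition q2 (q : quat) : R := snd (fst q).
Definition q3 (q : quat) : R := snd q.

Lemma is_derive_quat (f : R -> quat) (t : R) (d : quat) :
  is_derive f t d <->
  is_derive (fun s => q0 (f s)) t (q0 d) /\ is_derive (fun s => q1 (f s)) t (q1 d) /\
  is_derive (fun s => q2 (f s)) t (q2 d) /\ is_derive (fun s => q3 (f s)) t (q3 d).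
Proof.
  split.
  - intros H. unfold q0, q1, q2, q3.
    assert (H' : is_derive (fun s => fst (f s)) t (fst d)) by exact (is_derive_fst _ _ _ H).
    assert (H2 : is_derive (fun s => fst (fst (f s))) t (fst (fst d)))
      by exact (is_derive_fst _ _ _ H').
    refine (conj _ (conj _ (conj _ _))).
    + exact (is_derive_fst _ _ _ H2).
    + exact (is_derive_snd _ _ _ H2).
    + exact (is_derive_snd _ _ _ H').
    + exact (is_derive_snd _ _ _ H).
  - intros (h0 & h1 & h2 & h3).
    apply (is_derive_ext (fun s => (q0 (f s), q1 (f s), q2 (f s), q3 (f s)))).
    { intros s. unfold q0, q1, q2, q3. now destruct (f s) as [[[? ?] ?] ?]. }
    replace d with (q0 d, q1 d, q2 d, q3 d) by now destruct d as [[[? ?] ?] ?].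
    exact (is_derive_pair _ _ _ _ _ (is_derive_pair _ _ _ _ _ (is_derive_pair _ _ _ _ _ h0 h1) h2) h3).
Qed.

Lemma continuous_quat {T : UniformSpace} (f : T -> quat) (t : T) :
  continuous f t <->
  continuous (fun s => q0 (f s)) t /\ continuous (fun s => q1 (f s)) t /\
  continuous (fun s => q2 (f s)) t /\ continuous (fun s => q3 (f s)) t.
Proof.
  split.
  - intros H. unfold q0, q1, q2, q3.
    assert (H' : continuous (fun s => fst (f s)) t).
    { apply (continuous_comp f fst t H). apply continuous_fst. }
    assert (H2 : continuous (fun s => fst (fst (f s))) t).
    { apply (continuous_comp (fun s => fst (f s)) fst t H'). apply continuous_fst. }
    refine (conj _ (conj _ (conj _ _))).
    + apply (continuous_comp _ fst t H2). apply continuous_fst.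
    + apply (continuous_comp _ snd t H2). apply continuous_snd.
    + apply (continuous_comp _ snd t H'). apply continuous_snd.
    + apply (continuous_comp _ snd t H). apply continuous_snd.
  - intros (h0 & h1 & h2 & h3).
    apply (continuous_ext (fun s => (q0 (f s), q1 (f s), q2 (f s), q3 (f s)))).
    { intros s. unfold q0, q1, q2, q3. now destruct (f s) as [[[? ?] ?] ?]. }
    repeat apply continuous_pair; assumption.
Qed.

Ltac qproj := unfold q0, q1, q2, q3;
  repeat match goal with q : quat |- _ => destruct q as [[[? ?] ?] ?] end; cbn; ring.

Lemma q0_mul (a b : quat) : q0 (a * b)%quat = q0 a * q0 b - q1 a * q1 b - q2 a * q2 b - q3 a * q3 b.
Proof. qproj. Qed.
Lemma q1_mul (a b : quat) : q1 (a * b)%quat = q0 a * q1 b + q1 a * q0 b + q2 a * q3 b - q3 a * q2 b.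
Proof. qproj. Qed.
Lemma q2_mul (a b : quat) : q2 (a * b)%quat = q0 a * q2 b - q1 a * q3 b + q2 a * q0 b + q3 a * q1 b.
Proof. qproj. Qed.
Lemma q3_mul (a b : quat) : q3 (a * b)%quat = q0 a * q3 b + q1 a * q2 b - q2 a * q1 b + q3 a * q0 b.
Proof. qproj. Qed.

Lemma q0_add (a b : quat) : q0 (a + b)%quat = q0 a + q0 b.
Proof. qproj. Qed.
Lemma q1_add (a b : quat) : q1 (a + b)%quat = q1 a + q1 b.
Proof. qproj. Qed.
Lemma q2_add (a b : quat) : q2 (a + b)%quat = q2 a + q2 b.
Proof. qproj. Qed.
Lemma q3_add (a b : quat) : q3 (a + b)%quat = q3 a + q3 b.
Proof. qproj. Qed.

Lemma qadd_plus (a b : quat) : (a + b)%quat = plus a b.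
Proof. destruct a as [[[? ?] ?] ?], b as [[[? ?] ?] ?]. reflexivity. Qed.

Lemma qopp_opp (a : quat) : (- a)%quat = opp a.
Proof. destruct a as [[[? ?] ?] ?]. reflexivity. Qed.

Lemma qscal_scal (t : R) (a : quat) : (qreal t * a)%quat = scal t a.
Proof.
  destruct a as [[[? ?] ?] ?]. cbn. unfold scal; cbn. unfold prod_scal; cbn.
  unfold scal; cbn. unfold prod_scal; cbn. unfold scal; cbn.
  unfold prod_scal, scal; cbn. unfold mult; cbn. apply quat_eq; ring.
Qed.

Lemma is_derive_qadd (f g : R -> quat) (t : R) (df dg : quat) :
  is_derive f t df -> is_derive g t dg ->
  is_derive (fun s => (f s + g s)%quat) t (df + dg)%quat.
Proof.
  intros Hf Hg. rewrite qadd_plus.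
  apply (is_derive_ext (fun s => plus (f s) (g s))); [intros; now rewrite qadd_plus|].
  now apply @is_derive_plus.
Qed.

Lemma is_derive_qopp (f : R -> quat) (t : R) (df : quat) :
  is_derive f t df -> is_derive (fun s => (- f s)%quat) t (- df)%quat.
Proof.
  intros Hf. rewrite qopp_opp.
  apply (is_derive_ext (fun s => opp (f s))); [intros; now rewrite qopp_opp|].
  now apply @is_derive_opp.
Qed.

Lemma is_derive_qconst (c : quat) (t : R) : is_derive (fun _ : R => c) t (qreal 0).
Proof. apply @is_derive_const. Qed.

Lemma is_derive_Rmult (f g : R -> R) (t df dg : R) :
  is_derive f t df -> is_derive g t dg ->
  is_derive (fun s => f s * g s) t (df * g t + f t * dg).
Proof. intros Hf Hg. apply (is_derive_mult f g t df dg Hf Hg). exact Rmult_comm. Qed.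

Lemma is_derive_Rplus (f g : R -> R) (t df dg : R) :
  is_derive f t df -> is_derive g t dg ->
  is_derive (fun s => f s + g s) t (df + dg).
Proof. intros Hf Hg. now apply @is_derive_plus. Qed.

Lemma is_derive_Rminus (f g : R -> R) (t df dg : R) :
  is_derive f t df -> is_derive g t dg ->
  is_derive (fun s => f s - g s) t (df - dg).
Proof. intros Hf Hg. now apply @is_derive_minus. Qed.

Lemma is_derive_eq {V : NormedModule R_AbsRing} (f : R -> V) (t : R) (d d' : V) :
  is_derive f t d -> d = d' -> is_derive f t d'.
Proof. now intros H <-. Qed.

Lemma is_derive_qmul (f g : R -> quat) (t : R) (df dg : quat) :
  is_derive f t df -> is_derive g t dg ->
  is_derive (fun s => (f s * g s)%quat) t (df * g t + f t * dg)%quat.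
Proof.
  intros (f0 & f1 & f2 & f3)%is_derive_quat (g0 & g1 & g2 & g3)%is_derive_quat.
  apply is_derive_quat; refine (conj _ (conj _ (conj _ _))); eapply is_derive_eq;
  lazymatch goal with
  | |- is_derive _ _ _ =>
     eapply is_derive_ext;
      [intros s; symmetry; first [apply q0_mul|apply q1_mul|apply q2_mul|apply q3_mul]
      |repeat lazymatch goal with
        | |- is_derive (fun s => _ + _) _ _ => apply is_derive_Rplus
        | |- is_derive (fun s => _ - _) _ _ => apply is_derive_Rminus
        | |- is_derive (fun s => _ * _) _ _ => apply is_derive_Rmult
        end; eassumption]
  | |- _ => 
    rewrite ?q0_add, ?q1_add, ?q2_add, ?q3_add, ?q0_mul, ?q1_mul, ?q2_mul, ?q3_mul;
    cbv beta; match goal with |- @eq _ ?a ?b => change (@eq R a b) end; ring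
  end.
Qed.

Lemma continuous_Rplus {T : UniformSpace} (f g : T -> R) (t : T) :
  continuous f t -> continuous g t -> continuous (fun s => f s + g s) t.
Proof. intros Hf Hg. exact (continuous_plus f g t Hf Hg). Qed.

Lemma continuous_Rminus {T : UniformSpace} (f g : T -> R) (t : T) :
  continuous f t -> continuous g t -> continuous (fun s => f s - g s) t.
Proof. intros Hf Hg. exact (continuous_minus f g t Hf Hg). Qed.

Lemma continuous_Rmult {T : UniformSpace} (f g : T -> R) (t : T) :
  continuous f t -> continuous g t -> continuous (fun s => f s * g s) t.
Proof. intros Hf Hg. exact (continuous_mult f g t Hf Hg). Qed.

Ltac cont_poly := repeat lazymatch goal with
  | |- continuous (fun s => _ + _) _ => apply continuous_Rplus
  | |- continuous (fun s => _ - _) _ => apply continuous_Rminus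
  | |- continuous (fun s => _ * _) _ => apply continuous_Rmult
  | |- continuous (fun s => ?c) _ => apply continuous_const
  end.

Lemma continuous_qadd {T : UniformSpace} (f g : T -> quat) (t : T) :
  continuous f t -> continuous g t -> continuous (fun s => (f s + g s)%quat) t.
Proof.
  intros (f0 & f1 & f2 & f3)%continuous_quat (g0 & g1 & g2 & g3)%continuous_quat.
  apply continuous_quat; refine (conj _ (conj _ (conj _ _)));
  (eapply continuous_ext;
      [intros s; symmetry; first [apply q0_add|apply q1_add|apply q2_add|apply q3_add]
      |apply continuous_Rplus; assumption]).
Qed.

Lemma continuous_qmul {T : UniformSpace} (f g : T -> quat) (t : T) :
  continuous f t -> continuous g t -> continuous (fun s => (f s * g s)%quat) t.
Proof.
  intros (f0 & f1 & f2 & f3)%continuous_quat (g0 & g1 & g2 & g3)%continuous_quat.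
  apply continuous_quat; refine (conj _ (conj _ (conj _ _)));
  (eapply continuous_ext;
      [intros s; symmetry; first [apply q0_mul|apply q1_mul|apply q2_mul|apply q3_mul]
      |cont_poly; assumption]).
Qed.

(** The Cauchy-Riemann equation solved for the second partial derivative: dx + I dy = 0 means dy = I
    dx. A single derivative function then carries all the data. *)
Definition c_derive (I : quat) (phi : C -> quat) (z : C) (d : quat) : Prop :=
  is_derive (fun t : R => phi (t, Im z)) (Re z) d /\
  is_derive (fun t : R => phi (Re z, t)) (Im z) (I * d)%quat.

Lemma holomorphic_c_derive (E : C -> Prop) (I : quat) (phi : C -> quat) :
  imag_unit I ->
  holomorphic_on E I phi <->
  exists d : C -> quat, forall z, E z -> c_derive I phi z (d z) /\ continuous d z.
Proof.
  intros HI. split.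
  - intros (dx & dy & H). exists dx. intros z Hz.
    destruct (H z Hz) as (h1 & h2 & h3 & h4 & h5).
    split; [split; [exact h1|]|exact h3].
    apply (is_derive_eq _ _ _ _ h2).
    assert (e : (dx z + I * dy z)%quat = qreal 0).
    { replace (dx z + I * dy z)%quat with (qreal 2 * (qreal (1 / 2) * (dx z + I * dy z)))%quat.
      - rewrite h5. apply qmul_0_r.
      - rewrite qmulA. replace (qreal 2 * qreal (1 / 2))%quat with (qreal 1) by qcrush.
        apply qmul_1_l. }
    transitivity (I * (dx z + I * dy z) - I * (I * dy z))%quat; [|non_commutative_ring].
    rewrite imag_unit_mul by exact HI. rewrite e. non_commutative_ring.
  - intros (d & H). exists d, (fun z => (I * d z)%quat). intros z Hz.
    destruct (H z Hz) as ((h1 & h2) & h3).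
    split; [exact h1|split; [exact h2|split; [exact h3|split]]].
    + apply continuous_qmul; [apply continuous_const|exact h3].
    + rewrite imag_unit_mul by exact HI.
      rewrite <- (qmul_0_r (qreal (1 / 2))). f_equal. non_commutative_ring.
Qed.

Lemma locally_line_x (P : C -> Prop) (z : C) :
  locally z P -> locally (Re z) (fun t => P (t, Im z)).
Proof.
  intros [e H]. exists e. intros t ht. apply H. split; [exact ht|apply ball_center].
Qed.

Lemma locally_line_y (P : C -> Prop) (z : C) :
  locally z P -> locally (Im z) (fun t => P (Re z, t)).
Proof.
  intros [e H]. exists e. intros t ht. apply H. split; [apply ball_center|exact ht].
Qed.

Lemma c_derive_ext_loc (I : quat) (phi psi : C -> quat) (z : C) (d : quat) :
  locally z (fun w => phi w = psi w) -> c_derive I phi z d -> c_derive I psi z d.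
Proof.
  intros H [h1 h2]. split.
  - apply (is_derive_ext_loc (fun t => phi (t, Im z))); [|exact h1].
    exact (locally_line_x (fun w => phi w = psi w) z H).
  - apply (is_derive_ext_loc (fun t => phi (Re z, t))); [|exact h2].
    exact (locally_line_y (fun w => phi w = psi w) z H).
Qed.

Lemma c_derive_const (I c : quat) (z : C) : c_derive I (fun _ => c) z (qreal 0).
Proof. split; [|rewrite qmul_0_r]; apply is_derive_qconst. Qed.

Lemma c_derive_add (I : quat) (phi psi : C -> quat) (z : C) (d d' : quat) :
  c_derive I phi z d -> c_derive I psi z d' ->
  c_derive I (fun w => (phi w + psi w)%quat) z (d + d')%quat.
Proof.
  intros [h1 h2] [k1 k2]. split.
  - now apply is_derive_qadd.
  - replace (I * (d + d'))%quat with (I * d + I * d')%quat by non_commutative_ring.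
    now apply is_derive_qadd.
Qed.

(** In the second partial derivative the unit has to pass from the left of [d'] to the left of
    [phi z]; this is where the left factor must commute with [I]. *)
Lemma c_derive_mul (I : quat) (phi psi : C -> quat) (z : C) (d d' : quat) :
  (I * phi z = phi z * I)%quat ->
  c_derive I phi z d -> c_derive I psi z d' ->
  c_derive I (fun w => (phi w * psi w)%quat) z (d * psi z + phi z * d')%quat.
Proof.
  intros Hc [h1 h2] [k1 k2]. split.
  - eapply is_derive_eq.
    + apply (is_derive_qmul _ _ _ _ _ h1 k1).
    + now destruct z.
  - eapply is_derive_eq.
    + apply (is_derive_qmul _ _ _ _ _ h2 k2).
    + change (Re z, Im z) with (fst z, snd z). rewrite <- (surjective_pairing z).
      transitivity (I * d * psi z + (phi z * I) * d')%quat; [non_commutative_ring|].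
      rewrite <- Hc. non_commutative_ring.
Qed.

Lemma holomorphic_ext (E : C -> Prop) (I : quat) (phi psi : C -> quat) :
  imag_unit I -> open E -> (forall z, E z -> phi z = psi z) ->
  holomorphic_on E I phi -> holomorphic_on E I psi.
Proof.
  intros HI HE He (d & H)%(holomorphic_c_derive _ _ _ HI).
  apply (holomorphic_c_derive _ _ _ HI). exists d. intros z Hz.
  destruct (H z Hz) as [h1 h2]. split; [|exact h2].
  apply (c_derive_ext_loc _ phi); [|exact h1].
  apply (filter_imp E); [exact He|]. exact (HE z Hz).
Qed.

Lemma holomorphic_subset (E E' : C -> Prop) (I : quat) (phi : C -> quat) :
  (forall z, E' z -> E z) -> holomorphic_on E I phi -> holomorphic_on E' I phi.
Proof. intros He (dx & dy & H). exists dx, dy. auto. Qed.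

(** * Testing with the real functionals [qdot e], to which real analysis applies *)

Lemma qdot_q (e q : quat) : qdot e q = q0 e * q0 q + q1 e * q1 q + q2 e * q2 q + q3 e * q3 q.
Proof. qproj. Qed.

Lemma is_derive_qdot (e : quat) (f : R -> quat) (t : R) (d : quat) :
  is_derive f t d -> is_derive (fun s => qdot e (f s)) t (qdot e d).
Proof.
  intros (h0 & h1 & h2 & h3)%is_derive_quat. rewrite qdot_q.
  apply (is_derive_ext (fun s => q0 e * q0 (f s) + q1 e * q1 (f s) + q2 e * q2 (f s) + q3 e * q3 (f s)));
    [intros; now rewrite qdot_q|].
  apply is_derive_Rplus; [apply is_derive_Rplus; [apply is_derive_Rplus|]|];
  now apply is_derive_scal.
Qed.

Lemma continuous_qdot {T : UniformSpace} (e : quat) (f : T -> quat) (t : T) :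
  continuous f t -> continuous (fun s => qdot e (f s)) t.
Proof.
  intros (h0 & h1 & h2 & h3)%continuous_quat.
  apply (continuous_ext (fun s => q0 e * q0 (f s) + q1 e * q1 (f s) + q2 e * q2 (f s) + q3 e * q3 (f s)));
    [intros; now rewrite qdot_q|].
  cont_poly; assumption.
Qed.

Lemma qdot_ext (p q : quat) : (forall e, qdot e p = qdot e q) -> p = q.
Proof.
  intros H. generalize (H (1, 0, 0, 0)), (H (0, 1, 0, 0)), (H (0, 0, 1, 0)), (H (0, 0, 0, 1)).
  rewrite !qdot_q. destruct p as [[[? ?] ?] ?], q as [[[? ?] ?] ?].
  unfold q0, q1, q2, q3; cbn. intros; apply quat_eq; lra.
Qed.

Lemma continuous_qdot_iff {T : UniformSpace} (f : T -> quat) (t : T) :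
  (forall e, continuous (fun s => qdot e (f s)) t) -> continuous f t.
Proof.
  intros H. generalize (H (1, 0, 0, 0)), (H (0, 1, 0, 0)), (H (0, 0, 1, 0)), (H (0, 0, 0, 1)).
  intros h0 h1 h2 h3. apply continuous_quat; refine (conj _ (conj _ (conj _ _)));
  [refine (continuous_ext _ _ _ _ h0)|refine (continuous_ext _ _ _ _ h1)
  |refine (continuous_ext _ _ _ _ h2)|refine (continuous_ext _ _ _ _ h3)];
  intros s; rewrite qdot_q; unfold q0, q1, q2, q3; cbn; ring.
Qed.

Lemma is_derive_qdot_iff (f : R -> quat) (t : R) (d : quat) :
  (forall e, is_derive (fun s => qdot e (f s)) t (qdot e d)) -> is_derive f t d.
Proof.
  intros H. generalize (H (1, 0, 0, 0)), (H (0, 1, 0, 0)), (H (0, 0, 1, 0)), (H (0, 0, 0, 1)).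
  intros h0 h1 h2 h3. rewrite qdot_q in h0, h1, h2, h3.
  apply is_derive_quat; refine (conj _ (conj _ (conj _ _)));
  [refine (is_derive_eq _ _ _ _ (is_derive_ext _ _ _ _ _ h0) _)
  |refine (is_derive_eq _ _ _ _ (is_derive_ext _ _ _ _ _ h1) _)
  |refine (is_derive_eq _ _ _ _ (is_derive_ext _ _ _ _ _ h2) _)
  |refine (is_derive_eq _ _ _ _ (is_derive_ext _ _ _ _ _ h3) _)];
  try (intros s; rewrite qdot_q); unfold q0, q1, q2, q3; cbn;
  match goal with |- @eq _ ?a ?b => change (@eq R a b) end; ring.
Qed.

(* Continuity of one partial derivative turns the partial derivatives into
   a total differential. *)
Lemma c_derive_filterdiff (e I : quat) (E : C -> Prop) (phi d : C -> quat) (z : C) :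
  open E -> E z -> (forall w, E w -> c_derive I phi w (d w) /\ continuous d w) ->
  filterdiff (fun u : R * R => (fun s t => qdot e (phi (s, t))) (fst u) (snd u))
    (locally (Re z, Im z)) (fun u : R * R => plus (scal (fst u) (qdot e (d z)))
        (scal (snd u) (qdot e (I * d z)%quat))).
Proof.
  intros HE Hz H. destruct z as [a b]. cbn [Re Im fst snd].
  apply (is_derive_filterdiff (fun s t => qdot e (phi (s, t))) a b (fun s t => qdot e (d (s, t)))).
  - apply (filter_imp E); [|exact (HE _ Hz)].
    intros [s t] Hst. destruct (H _ Hst) as [[h _] _]. apply (is_derive_qdot e _ _ _ h).
  - destruct (H _ Hz) as [[_ h] _]. apply (is_derive_qdot e _ _ _ h).
  - apply (continuous_ext (fun u : C => qdot e (d u))); [now intros []|].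
    apply continuous_qdot. apply (H _ Hz).
Qed.

Lemma c_derive_continuous (I : quat) (E : C -> Prop) (phi d : C -> quat) (z : C) :
  open E -> E z -> (forall w, E w -> c_derive I phi w (d w) /\ continuous d w) ->
  continuous phi z.
Proof.
  intros HE Hz H. apply continuous_qdot_iff. intros e.
  assert (D := filterdiff_continuous _ _ (ex_intro _ _ (c_derive_filterdiff e I E phi d z HE Hz H))).
  destruct z as [a b]. cbn [Re Im fst snd] in D.
  apply (continuous_ext (fun u : R * R => qdot e (phi (fst u, snd u)))); [now intros []|].
  exact D.
Qed.

(** Chain rule along a plane curve. The homotopy argument uses it in both variables: along the ray
    parameter [s] and along the closed curve. *)
Lemma c_derive_comp (I : quat) (E : C -> Prop) (phi d : C -> quat) (X Y : R -> R) (s dX dY : R) :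
  open E -> E (X s, Y s) -> (forall w, E w -> c_derive I phi w (d w) /\ continuous d w) ->
  is_derive X s dX -> is_derive Y s dY ->
  is_derive (fun t => phi (X t, Y t)) s (emb I (dX, dY) * d (X s, Y s))%quat.
Proof.
  intros HE Hz H HX HY. apply is_derive_qdot_iff. intros e.
  assert (D := c_derive_filterdiff e I E phi d (X s, Y s) HE Hz H). cbn [Re Im fst snd] in D.
  assert (K := filterdiff_comp'_2 X Y (fun a b => qdot e (phi (a, b))) s _ _
    (fun a b => plus (scal a (qdot e (d (X s, Y s)))) (scal b (qdot e (I * d (X s, Y s))%quat)))
    HX HY D).
  refine (filterdiff_ext_lin _ _ _ K _).
  intros y. generalize (d (X s, Y s)). intros D'.
  change (y * dX * qdot e D' + y * dY * qdot e (I * D')%quat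
    = y * qdot e (emb I (dX, dY) * D')%quat).
  destruct e as [[[? ?] ?] ?], I as [[[? ?] ?] ?], D' as [[[? ?] ?] ?].
  unfold emb, qreal; cbn. ring.
Qed.

Lemma holomorphic_continuous (I : quat) (E : C -> Prop) (phi : C -> quat) (z : C) :
  imag_unit I -> open E -> holomorphic_on E I phi -> E z -> continuous phi z.
Proof.
  intros HI HE (d & H)%(holomorphic_c_derive _ _ _ HI) Hz.
  exact (c_derive_continuous I E phi d z HE Hz H).
Qed.

Lemma holomorphic_const (E : C -> Prop) (I c : quat) :
  imag_unit I -> holomorphic_on E I (fun _ => c).
Proof.
  intros HI. apply (holomorphic_c_derive _ _ _ HI). exists (fun _ => qreal 0).
  intros z _. split; [apply c_derive_const|apply continuous_const].
Qed.

Lemma holomorphic_add (E : C -> Prop) (I : quat) (phi psi : C -> quat) :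
  imag_unit I -> holomorphic_on E I phi -> holomorphic_on E I psi ->
  holomorphic_on E I (fun z => (phi z + psi z)%quat).
Proof.
  intros HI (d & H)%(holomorphic_c_derive _ _ _ HI) (d' & H')%(holomorphic_c_derive _ _ _ HI).
  apply (holomorphic_c_derive _ _ _ HI). exists (fun z => (d z + d' z)%quat).
  intros z Hz. destruct (H z Hz), (H' z Hz). split.
  - now apply c_derive_add.
  - now apply continuous_qadd.
Qed.

Lemma holomorphic_mul (E : C -> Prop) (I : quat) (phi psi : C -> quat) :
  imag_unit I -> open E ->
  (forall z, E z -> (I * phi z = phi z * I)%quat) ->
  holomorphic_on E I phi -> holomorphic_on E I psi ->
  holomorphic_on E I (fun z => (phi z * psi z)%quat).
Proof.
  intros HI HE Hc Hphi Hpsi.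
  destruct (proj1 (holomorphic_c_derive _ _ _ HI) Hphi) as (d & H).
  destruct (proj1 (holomorphic_c_derive _ _ _ HI) Hpsi) as (d' & H').
  apply (holomorphic_c_derive _ _ _ HI).
  exists (fun z => (d z * psi z + phi z * d' z)%quat).
  intros z Hz. destruct (H z Hz), (H' z Hz). split.
  - apply c_derive_mul; auto.
  - apply continuous_qadd; apply continuous_qmul; auto;
    eapply holomorphic_continuous; eassumption.
Qed.

Lemma holomorphic_mul_r (E : C -> Prop) (I c : quat) (phi : C -> quat) :
  imag_unit I -> open E -> holomorphic_on E I phi ->
  holomorphic_on E I (fun z => (phi z * c)%quat).
Proof.
  intros HI HE (d & H)%(holomorphic_c_derive _ _ _ HI).
  apply (holomorphic_c_derive _ _ _ HI). exists (fun z => (d z * c)%quat).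
  intros z Hz. destruct (H z Hz) as [[h1 h2] h3]. split; [split|].
  - eapply is_derive_eq; [apply (is_derive_qmul _ _ _ _ _ h1 (is_derive_qconst c _))|].
    non_commutative_ring.
  - eapply is_derive_eq; [apply (is_derive_qmul _ _ _ _ _ h2 (is_derive_qconst c _))|].
    non_commutative_ring.
  - apply continuous_qmul; [exact h3|apply continuous_const].
Qed.

(** * The identity theorem *)

Lemma continuous_emb {T : UniformSpace} (I : quat) (a b : T -> R) (t : T) :
  continuous a t -> continuous b t -> continuous (fun s => emb I (a s, b s)) t.
Proof.
  intros Ha Hb. unfold emb; cbn [Re Im fst snd].
  assert (K : forall f : T -> R, continuous f t -> continuous (fun s => qreal (f s)) t).
  { intros f Hf. apply continuous_quat; refine (conj _ (conj _ (conj _ _)));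
    [exact Hf|apply continuous_const..]. }
  apply continuous_qadd; [now apply K|].
  apply continuous_qmul; [now apply K|apply continuous_const].
Qed.

Lemma is_derive_qreal (f : R -> R) (t df : R) :
  is_derive f t df -> is_derive (fun s => qreal (f s)) t (qreal df).
Proof.
  intros H. apply is_derive_quat.
  exact (conj H (conj (is_derive_const 0 t) (conj (is_derive_const 0 t) (is_derive_const 0 t)))).
Qed.

Lemma is_derive_emb (I : quat) (a b : R -> R) (t da db : R) :
  is_derive a t da -> is_derive b t db ->
  is_derive (fun s => emb I (a s, b s)) t (emb I (da, db)).
Proof.
  intros Ha Hb. unfold emb; cbn [Re Im fst snd].
  apply is_derive_qadd; [now apply is_derive_qreal|].
  eapply is_derive_eq.
  - apply is_derive_qmul; [apply is_derive_qreal, Hb|apply is_derive_qconst].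
  - non_commutative_ring.
Qed.

Lemma is_derive_line (w a s : R) : is_derive (fun u => w + u * a) s a.
Proof. auto_derive; [exact Logic.I|ring]. Qed.

(* The [s]-derivative of the integrand along the homotopy [w + s gamma] is
   [gamma' * phi'], which is [1/s] times a [t]-derivative, hence integrates to
   zero over the closed curve. *)
Lemma homotopy_integral (I e : quat) (E : C -> Prop) (phi d : C -> quat)
    (a b a' b' k1 k2 : R -> R) (w1 w2 T delta : R) :
  imag_unit I -> open E ->
  (forall w, E w -> c_derive I phi w (d w) /\ continuous d w) ->
  0 < T -> 0 < delta ->
  (forall t, is_derive a t (a' t)) -> (forall t, is_derive b t (b' t)) ->
  (forall t, continuous a' t) -> (forall t, continuous b' t) ->
  (forall t, continuous k1 t) -> (forall t, continuous k2 t) ->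
  (forall t, Cmult (k1 t, k2 t) (a t, b t) = (a' t, b' t)) ->
  a 0 = a T -> b 0 = b T ->
  (forall s t, - delta < s < 1 + delta -> E (w1 + s * a t, w2 + s * b t)) ->
  RInt (fun t => qdot e (emb I (k1 t, k2 t) * phi (w1 + 0 * a t, w2 + 0 * b t)%R)%quat) 0 T
  = RInt (fun t => qdot e (emb I (k1 t, k2 t) * phi (w1 + 1 * a t, w2 + 1 * b t)%R)%quat) 0 T.
Proof.
  intros HI HE H HT Hd Ha Hb Ca' Cb' Ck1 Ck2 Hk Pa Pb Hin.
  set (F := fun s t => qdot e (emb I (k1 t, k2 t) * phi (w1 + s * a t, w2 + s * b t)%R)%quat).
  set (G := fun s t => qdot e (emb I (a' t, b' t) * d (w1 + s * a t, w2 + s * b t)%R)%quat).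
  change (RInt (F 0) 0 T = RInt (F 1) 0 T).
  assert (Ca : forall t, continuous a t).
  { intros t. apply (ex_derive_continuous a). eexists; apply Ha. }
  assert (Cb : forall t, continuous b t).
  { intros t. apply (ex_derive_continuous b). eexists; apply Hb. }
  assert (Cphi : forall w, E w -> continuous phi w).
  { intros w Hw. exact (c_derive_continuous I E phi d w HE Hw H). }
  assert (DF : forall s t, - delta < s < 1 + delta -> is_derive (fun u => F u t) s (G s t)).
  { intros s t Hs. unfold F, G. apply is_derive_qdot. rewrite <- Hk.
    rewrite emb_mult by exact HI. eapply is_derive_eq.
    - apply is_derive_qmul; [apply is_derive_qconst|].
      apply (c_derive_comp I E phi d (fun u => w1 + u * a t) (fun u => w2 + u * b t) s (a t) (b t) HE).
      + now apply Hin.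
      + exact H.
      + apply is_derive_line.
      + apply is_derive_line.
    - non_commutative_ring. }
  assert (Cline : forall (w : R) (f : R -> R) s t, continuous f t ->
     continuous (fun u : R * R => w + fst u * f (snd u)) (s, t)).
  { intros w f s t Hf. apply continuous_Rplus; [apply continuous_const|].
    apply continuous_Rmult; [apply continuous_fst|].
    apply (continuous_comp snd f); [apply continuous_snd|exact Hf]. }
  assert (CG : forall s t, - delta < s < 1 + delta ->
     continuous (fun u : R * R => G (fst u) (snd u)) (s, t)).
  { intros s t Hs. apply continuous_qdot. apply continuous_qmul.
    - apply continuous_emb.
      + apply (continuous_comp snd a'); [apply continuous_snd|apply Ca'].
      + apply (continuous_comp snd b'); [apply continuous_snd|apply Cb'].
    - apply (continuous_comp (fun u : R * R => (w1 + fst u * a (snd u), w2 + fst u * b (snd u))) d).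
      + apply continuous_pair; apply Cline; auto.
      + apply H. now apply Hin. }
  assert (Cs : forall (w : R) (f : R -> R) s t, continuous f t ->
     continuous (fun u : R => w + s * f u) t).
  { intros w f s t Hf. apply continuous_Rplus; [apply continuous_const|].
    apply continuous_Rmult; [apply continuous_const|exact Hf]. }
  assert (CF1 : forall s t, - delta < s < 1 + delta -> continuous (F s) t).
  { intros s t Hs. apply continuous_qdot. apply continuous_qmul.
    - now apply continuous_emb.
    - apply (continuous_comp (fun u : R => (w1 + s * a u, w2 + s * b u)) phi).
      + apply continuous_pair; apply Cs; auto.
      + apply Cphi. now apply Hin. }
  assert (CG1 : forall s t, - delta < s < 1 + delta -> continuous (G s) t).
  { intros s t Hs. apply continuous_qdot. apply continuous_qmul.
    - now apply continuous_emb.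
    - apply (continuous_comp (fun u : R => (w1 + s * a u, w2 + s * b u)) d).
      + apply continuous_pair; apply Cs; auto.
      + apply H. now apply Hin. }
  (* The margin [delta] makes [s = 0] and [s = 1] interior parameters, so that differentiation under
     the integral sign is available at both ends. *)
  assert (Near : forall s, - delta < s < 1 + delta -> locally s (fun u => - delta < u < 1 + delta)).
  { intros s Hs. apply (locally_interval _ s (- delta) (1 + delta)); cbn; try lra.
    intros; lra. }
  assert (DR : forall s, - delta < s < 1 + delta -> is_derive (fun u => RInt (F u) 0 T) s (RInt (G s) 0 T)).
  { intros s Hs. eapply is_derive_eq.
    - apply (is_derive_RInt_param F 0 T s).
      + apply (filter_imp _ _ (fun u Hu t _ => ex_intro _ _ (DF u t Hu)) (Near s Hs)).
      + intros t _. apply (continuity_2d_pt_ext_loc G).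
        * destruct (Near s Hs) as [eps Heps]. exists eps. intros u v Hu _.
          symmetry. apply is_derive_unique. apply DF. now apply Heps.
        * apply continuity_2d_pt_filterlim. exact (CG s t Hs).
      + apply (filter_imp (fun u => - delta < u < 1 + delta)); [|exact (Near s Hs)].
        intros u Hu. apply @ex_RInt_continuous. intros t _. now apply CF1.
    - apply RInt_ext. intros t _. apply is_derive_unique. now apply DF. }
  assert (Z : forall s, 0 <= s <= 1 -> RInt (G s) 0 T = 0).
  { intros s Hs. destruct (Req_dec s 0) as [->|hs].
    (* At [s = 0] one cannot divide by [s]; but there the derivative of [phi] is the constant [D],
       and the integrand is the derivative of the closed curve times [D]. *)
    - set (D := d (w1, w2)).
      assert (K : is_RInt (G 0) 0 T
        (minus (qdot e (emb I (a T, b T) * D)%quat) (qdot e (emb I (a 0, b 0) * D)%quat))).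
      { apply (is_RInt_derive (fun t => qdot e (emb I (a t, b t) * D)%quat)).
        - intros t _. unfold G. replace (w1 + 0 * a t) with w1 by ring.
          replace (w2 + 0 * b t) with w2 by ring. fold D.
          apply is_derive_qdot. eapply is_derive_eq.
          + apply is_derive_qmul; [|apply is_derive_qconst].
            apply (is_derive_emb I a b t _ _ (Ha t) (Hb t)).
          + non_commutative_ring.
        - intros t _. apply CG1. lra. }
      apply (is_RInt_unique (V := R_CompleteNormedModule)) in K. rewrite K, Pa, Pb. apply (minus_eq_zero (G := R_AbelianGroup)).
    - apply (Rmult_eq_reg_l s); [|exact hs]. rewrite Rmult_0_r.
      set (h := fun t => qdot e (phi (w1 + s * a t, w2 + s * b t))).
      assert (K : is_RInt (fun t => scal s (G s t)) 0 T (minus (h T) (h 0))).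
      { apply (is_RInt_derive h).
        - intros t _. unfold h.
          replace (scal s (G s t)) with
            (qdot e (emb I (s * a' t, s * b' t)%R * d (w1 + s * a t, w2 + s * b t)%R)%quat).
          + apply is_derive_qdot.
            apply (c_derive_comp I E phi d (fun u => w1 + s * a u) (fun u => w2 + s * b u) t (s * a' t) (s * b' t) HE).
            * apply Hin. lra.
            * exact H.
            * eapply is_derive_eq; [apply is_derive_Rplus; [apply @is_derive_const|apply (is_derive_scal a t s _ (Ha t))]|].
              apply Rplus_0_l.
            * eapply is_derive_eq; [apply is_derive_Rplus; [apply @is_derive_const|apply (is_derive_scal b t s _ (Hb t))]|].
              apply Rplus_0_l.
          + unfold G. generalize (d (w1 + s * a t, w2 + s * b t)). intros D.
            change (qdot e (emb I (s * a' t, s * b' t)%R * D)%quat = s * qdot e (emb I (a' t, b' t) * D)%quat).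
            destruct e as [[[? ?] ?] ?], I as [[[? ?] ?] ?], D as [[[? ?] ?] ?].
            unfold emb, qreal; cbn. ring.
        - intros t _. apply (continuous_scal_r s (G s) t). apply CG1. lra. }
      apply (is_RInt_unique (V := R_CompleteNormedModule)) in K.
      assert (K2 : RInt (fun t => scal s (G s t)) 0 T = s * RInt (G s) 0 T).
      { apply (RInt_scal (V := R_CompleteNormedModule) (G s) 0 T s).
        apply @ex_RInt_continuous. intros t _. apply CG1. lra. }
      transitivity (RInt (fun t => scal s (G s t)) 0 T); [symmetry; exact K2|].
      rewrite K. unfold h. rewrite Pa, Pb.
      apply (minus_eq_zero (G := R_AbelianGroup)). }
  apply (eq_is_derive (fun s => RInt (F s) 0 T) 0 1); [|lra].
  intros s Hs. eapply is_derive_eq; [apply DR; lra|]. now apply Z.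
Qed.

(** * Euclidean norm and inversion of quaternions *)

Lemma qdot_mul (a b : quat) : qdot (a * b)%quat (a * b)%quat = qdot a a * qdot b b.
Proof. destruct a as [[[? ?] ?] ?], b as [[[? ?] ?] ?]; cbn; ring. Qed.

Lemma qdot_nonneg (a : quat) : 0 <= qdot a a.
Proof. destruct a as [[[? ?] ?] ?]; cbn; nra. Qed.

Lemma qabs_mul (a b : quat) : qabs (a * b)%quat = qabs a * qabs b.
Proof. unfold qabs. rewrite qdot_mul. apply sqrt_mult; apply qdot_nonneg. Qed.

Lemma qabs_nonneg (a : quat) : 0 <= qabs a.
Proof. apply sqrt_pos. Qed.

Lemma qabs_sqr (a : quat) : qabs a * qabs a = qdot a a.
Proof. apply sqrt_sqrt, qdot_nonneg. Qed.

Lemma qabs_eq_0 (a : quat) : qabs a = 0 -> a = qreal 0.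
Proof.
  intros H. destruct (excluded_middle_informative (a = qreal 0)) as [h|h]; [exact h|].
  generalize (qdot_pos a h). rewrite <- qabs_sqr, H. lra.
Qed.

Lemma qdot_le (a b : quat) : Rabs (qdot a b) <= qabs a * qabs b.
Proof.
  rewrite <- (Rabs_pos_eq (qabs a * qabs b)) by (apply Rmult_le_pos; apply qabs_nonneg).
  apply Rsqr_le_abs_0. unfold Rsqr.
  replace (qabs a * qabs b * (qabs a * qabs b)) with (qdot a a * qdot b b)
    by (rewrite <- !qabs_sqr; ring).
  destruct a as [[[a0 a1] a2] a3], b as [[[b0 b1] b2] b3]; cbn.
  assert (K : 0 <= (a0 * b1 - a1 * b0) * (a0 * b1 - a1 * b0) + (a0 * b2 - a2 * b0) * (a0 * b2 - a2 * b0)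
   + (a0 * b3 - a3 * b0) * (a0 * b3 - a3 * b0) + (a1 * b2 - a2 * b1) * (a1 * b2 - a2 * b1)
   + (a1 * b3 - a3 * b1) * (a1 * b3 - a3 * b1) + (a2 * b3 - a3 * b2) * (a2 * b3 - a3 * b2)).
  { repeat apply Rplus_le_le_0_compat; apply Rle_0_sqr. }
  lra.
Qed.

Lemma qabs_emb (I : quat) (z : C) : imag_unit I -> qabs (emb I z) = Cmod z.
Proof.
  intros HI; destruct (imag_unit_coord I HI) as (b & c & d & -> & h).
  destruct z as [z1 z2]. unfold qabs, Cmod. f_equal. unfold emb, qreal, Re, Im; cbn.
  transitivity (z1 * z1 + z2 * z2 * (b * b + c * c + d * d)); [|rewrite h]; ring.
Qed.

Lemma emb_neq_0 (I : quat) (z : C) : imag_unit I -> z <> RtoC 0 -> emb I z <> qreal 0.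
Proof.
  intros HI Hz H. apply Hz. rewrite <- (emb_RtoC I) in H. exact (emb_inj I _ _ HI H).
Qed.

Lemma qopp_real (q : quat) : (- q = qreal (-1) * q)%quat.
Proof. qcrush. Qed.

Lemma qinv_conj (q : quat) : qinv q = (qreal (/ qdot q q) * qconj q)%quat.
Proof. now destruct q as [[[? ?] ?] ?]. Qed.

Lemma qinv_r (q : quat) : q <> qreal 0 -> (q * qinv q)%quat = qreal 1.
Proof.
  intros H; generalize (qdot_pos q H). destruct q as [[[a b] c] d]. cbn.
  intros h. apply quat_eq; field; lra.
Qed.

Lemma qinv_comm (I q : quat) : q <> qreal 0 -> (I * q = q * I)%quat ->
  (I * qinv q = qinv q * I)%quat.
Proof.
  intros Hq H. transitivity (qinv q * (q * I) * qinv q)%quat.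
  - rewrite !qmulA, qinv_l by exact Hq. now rewrite qmul_1_l.
  - rewrite <- H. transitivity (qinv q * I * (q * qinv q))%quat; [non_commutative_ring|].
    rewrite qinv_r by exact Hq. non_commutative_ring.
Qed.

Lemma is_derive_qconj (f : R -> quat) (t : R) (d : quat) :
  is_derive f t d -> is_derive (fun s => qconj (f s)) t (qconj d).
Proof.
  intros (f0 & f1 & f2 & f3)%is_derive_quat.
  apply (is_derive_ext (fun s => (q0 (f s), opp (q1 (f s)), opp (q2 (f s)), opp (q3 (f s))) : quat)).
  { intros s. now destruct (f s) as [[[? ?] ?] ?]. }
  replace (qconj d) with ((q0 d, opp (q1 d), opp (q2 d), opp (q3 d)) : quat)
    by now destruct d as [[[? ?] ?] ?].
  apply is_derive_quat.
  exact (conj f0 (conj (is_derive_opp _ _ _ f1) (conj (is_derive_opp _ _ _ f2) (is_derive_opp _ _ _ f3)))).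
Qed.

Lemma continuous_qconj {T : UniformSpace} (f : T -> quat) (t : T) :
  continuous f t -> continuous (fun s => qconj (f s)) t.
Proof.
  intros (f0 & f1 & f2 & f3)%continuous_quat.
  apply (continuous_ext (fun s => (q0 (f s), 0 - q1 (f s), 0 - q2 (f s), 0 - q3 (f s)) : quat)).
  { intros s. destruct (f s) as [[[? ?] ?] ?]. apply quat_eq; unfold q0, q1, q2, q3; cbn; ring. }
  apply continuous_quat; refine (conj _ (conj _ (conj _ _)));
  unfold q0 at 1, q1 at 1, q2 at 1, q3 at 1; cbn [fst snd]; cont_poly; assumption.
Qed.

Lemma continuous_qinv {T : UniformSpace} (f : T -> quat) (t : T) :
  f t <> qreal 0 -> continuous f t -> continuous (fun s => qinv (f s)) t.
Proof.
  intros Hn Hf. apply qdot_pos in Hn. destruct (proj1 (continuous_quat f t) Hf) as (f0 & f1 & f2 & f3).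
  apply (continuous_ext (fun s => (qreal (/ qdot (f s) (f s)) * qconj (f s))%quat));
    [intros; now rewrite qinv_conj|].
  apply continuous_qmul.
  - apply continuous_quat; refine (conj _ (conj _ (conj _ _))); try apply continuous_const.
    unfold q0 at 1; cbn [fst snd qreal]. apply (continuous_comp (fun s => qdot (f s) (f s)) Rinv);
      [|apply continuous_Rinv; lra].
    apply (continuous_ext (fun s => q0 (f s) * q0 (f s) + q1 (f s) * q1 (f s) + q2 (f s) * q2 (f s) + q3 (f s) * q3 (f s)));
    [intros; now rewrite qdot_q|].
    cont_poly; assumption.
  - now apply continuous_qconj.
Qed.

Lemma is_derive_qinv (f : R -> quat) (t : R) (df : quat) :
  f t <> qreal 0 -> is_derive f t df ->
  is_derive (fun s => qinv (f s)) t (- (qinv (f t) * df * qinv (f t)))%quat.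
Proof.
  intros Hn Hf. apply qdot_pos in Hn. destruct (proj1 (is_derive_quat f t df) Hf) as (f0 & f1 & f2 & f3).
  set (N := fun s => q0 (f s) * q0 (f s) + q1 (f s) * q1 (f s) + q2 (f s) * q2 (f s) + q3 (f s) * q3 (f s)).
  assert (HN : forall s, qdot (f s) (f s) = N s) by (intros; apply qdot_q).
  assert (DN : is_derive N t (2 * qdot (f t) df)).
  { rewrite qdot_q. eapply is_derive_eq.
    - unfold N. do 3 (apply is_derive_Rplus; [|apply is_derive_Rmult; eassumption]).
      apply is_derive_Rmult; eassumption.
    - cbv beta; match goal with |- @eq _ ?a ?b => change (@eq R a b) end; ring. }
  assert (Dc := is_derive_qconj f t df Hf).
  apply (is_derive_ext (fun s => (qreal (/ N s) * qconj (f s))%quat));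
    [intros; now rewrite qinv_conj, HN|].
  eapply is_derive_eq.
  - apply is_derive_qmul; [|exact Dc].
    apply is_derive_qreal. apply is_derive_inv; [exact DN|]. rewrite <- HN. lra.
  - cbv beta. rewrite <- HN. generalize Hn. generalize (f t). intros q hq.
    destruct q as [[[? ?] ?] ?], df as [[[? ?] ?] ?]. unfold qreal; cbn in *.
    apply quat_eq; field; lra.
Qed.

Lemma holomorphic_inv (E : C -> Prop) (I : quat) (phi : C -> quat) :
  imag_unit I -> open E -> (forall z, E z -> (I * phi z = phi z * I)%quat) ->
  (forall z, E z -> phi z <> qreal 0) ->
  holomorphic_on E I phi -> holomorphic_on E I (fun z => qinv (phi z)).
Proof.
  intros HI HE Hc Hn Hphi.
  destruct (proj1 (holomorphic_c_derive _ _ _ HI) Hphi) as (d & H).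
  apply (holomorphic_c_derive _ _ _ HI).
  exists (fun z => (- (qinv (phi z) * d z * qinv (phi z)))%quat).
  intros z Hz. destruct (H z Hz) as [[h1 h2] h3].
  assert (Cphi : continuous (fun z => qinv (phi z)) z).
  { apply continuous_qinv; [now apply Hn|]. eapply holomorphic_continuous; eassumption. }
  split; [split|].
  - eapply is_derive_eq; [apply (is_derive_qinv _ _ _ (Hn (Re z, Im z) ltac:(now destruct z)) h1)|].
    now destruct z.
  - eapply is_derive_eq; [apply (is_derive_qinv _ _ _ (Hn (Re z, Im z) ltac:(now destruct z)) h2)|].
    replace (Re z, Im z) with z by now destruct z.
    transitivity (- ((qinv (phi z) * I) * d z * qinv (phi z)))%quat; [non_commutative_ring|].
    rewrite <- qinv_comm; [non_commutative_ring|now apply Hn|now apply Hc].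
  - apply (continuous_ext (fun z => (qreal (-1) * (qinv (phi z) * d z * qinv (phi z)))%quat));
      [intros s; symmetry; apply qopp_real|].
    apply continuous_qmul; [apply continuous_const|].
    apply continuous_qmul; [apply continuous_qmul|]; assumption.
Qed.

Lemma holomorphic_emb_sub (E : C -> Prop) (I : quat) (c : C) : imag_unit I ->
  holomorphic_on E I (fun z => emb I (Cminus z c)).
Proof.
  intros HI. apply (holomorphic_c_derive _ _ _ HI). exists (fun _ => qreal 1).
  intros z _. split; [split|apply continuous_const].
  - unfold Cminus, Cplus, Copp; cbn [fst snd].
    replace (qreal 1) with (emb I (1, 0)) by qcrush.
    apply is_derive_emb; [|apply @is_derive_const].
    auto_derive; [exact Logic.I|ring].
  - unfold Cminus, Cplus, Copp; cbn [fst snd].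
    replace (I * qreal 1)%quat with (emb I (0, 1)) by qcrush.
    apply is_derive_emb; [apply @is_derive_const|].
    auto_derive; [exact Logic.I|ring].
Qed.

Lemma is_derive_quat_unique (f : R -> quat) (t : R) (d d' : quat) :
  is_derive f t d -> is_derive f t d' -> d = d'.
Proof.
  intros H H'. apply qdot_ext. intros e.
  rewrite <- (is_derive_unique _ _ _ (is_derive_qdot e f t d H)).
  now apply is_derive_unique, is_derive_qdot.
Qed.

(** The local derivative functions must become one function. [epsilon] selects a derivative at each
    point, and uniqueness of derivatives identifies it with every local one, from which it inherits
    continuity. *)
Lemma holomorphic_local (E : C -> Prop) (I : quat) (phi : C -> quat) :
  imag_unit I ->
  (forall z, E z -> exists V : C -> Prop, open V /\ V z /\ holomorphic_on V I phi) ->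
  holomorphic_on E I phi.
Proof.
  intros HI H. apply (holomorphic_c_derive _ _ _ HI).
  set (D := fun z => epsilon (inhabits (qreal 0)) (c_derive I phi z)).
  assert (U : forall z d, c_derive I phi z d -> D z = d).
  { intros z d Hd. assert (K : c_derive I phi z (D z)).
    { apply epsilon_spec. now exists d. }
    exact (is_derive_quat_unique _ _ _ _ (proj1 K) (proj1 Hd)). }
  exists D. intros z Hz. destruct (H z Hz) as (V & HV & Vz & (d & Hd)%(holomorphic_c_derive _ _ _ HI)).
  destruct (Hd z Vz) as [h1 h2]. rewrite (U z (d z) h1). split; [exact h1|].
  refine (continuous_ext_loc _ d z _ h2).
  apply (filter_imp V); [|exact (HV z Vz)].
  intros w Hw. symmetry. apply U. now apply Hd.
Qed.

Lemma open_C_neq (c : C) : open (fun z : C => z <> c).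
Proof.
  intros [a b] H. destruct c as [c1 c2].
  destruct (Req_dec a c1) as [->|Ha].
  - assert (Hb : b <> c2) by congruence.
    assert (0 < Rabs (c2 - b)) by (apply Rabs_pos_lt; lra).
    exists (mkposreal _ H0). intros [a' b'] [_ h] e. injection e as -> ->.
    cbn in h. unfold ball in h; cbn in h. unfold AbsRing_ball, abs, minus, plus, opp in h; cbn in h.
    unfold Rminus in h. lra.
  - assert (0 < Rabs (c1 - a)) by (apply Rabs_pos_lt; lra).
    exists (mkposreal _ H0). intros [a' b'] [h _] e. injection e as -> ->.
    cbn in h. unfold ball in h; cbn in h. unfold AbsRing_ball, abs, minus, plus, opp in h; cbn in h.
    unfold Rminus in h. lra.
Qed.

Lemma emb_sub_neq_0 (I : quat) (z c : C) : imag_unit I -> z <> c ->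
  emb I (Cminus z c) <> qreal 0.
Proof.
  intros HI Hz. apply emb_neq_0; [exact HI|]. intros H. apply Hz.
  transitivity (Cplus (Cminus z c) c); [|rewrite H]; ring.
Qed.

(** As [phi] vanishes on a whole neighbourhood of [c], the product is zero there whatever [qinv]
    returns at zero, so no singularity has to be removed. *)
Lemma holomorphic_quotient (E : C -> Prop) (I : quat) (c : C) (phi : C -> quat) :
  imag_unit I -> open E ->
  locally c (fun z => phi z = qreal 0) ->
  holomorphic_on E I phi ->
  holomorphic_on E I (fun z => (qinv (emb I (Cminus z c)) * phi z)%quat).
Proof.
  intros HI HE Hc H. apply holomorphic_local; [exact HI|]. intros z Hz.
  destruct (excluded_middle_informative (z = c)) as [->|e].
  - exists (fun w => locally w (fun z => phi z = qreal 0)).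
    assert (HV : open (fun w : C => locally w (fun z => phi z = qreal 0))).
    { intros w Hw. now apply locally_locally. }
    split; [exact HV|]. split; [exact Hc|].
    apply (holomorphic_ext _ I (fun _ => qreal 0) _ HI HV).
    + intros v Hv. rewrite (locally_singleton _ _ Hv). now rewrite qmul_0_r.
    + now apply holomorphic_const.
  - exists (fun w => E w /\ w <> c).
    assert (HO : open (fun w => E w /\ w <> c)) by (apply open_and; [exact HE|apply open_C_neq]).
    split; [exact HO|]. split; [now split|].
    apply holomorphic_mul; [exact HI|exact HO| | |].
    + intros w [_ hw]. apply qinv_comm; [now apply emb_sub_neq_0|apply emb_comm].
    + apply holomorphic_inv; [exact HI|exact HO| | |].
      * intros w _. apply emb_comm.
      * intros w [_ hw]. now apply emb_sub_neq_0.
      * now apply holomorphic_emb_sub.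
    + apply (holomorphic_subset E); [now intros w []|exact H].
Qed.

(** * Discs, and the propagation of zeros from a small disc to a large one *)

Definition c_disc (c : C) (r : R) (z : C) : Prop := Cmod (Cminus z c) < r.

Lemma continuous_Cmod_sub (c z : C) : continuous (fun w => Cmod (Cminus w c)) z.
Proof.
  apply (continuous_ext (fun w : C => sqrt ((fst w - fst c) * (fst w - fst c) + (snd w - snd c) * (snd w - snd c)))).
  { intros w. unfold Cmod. f_equal. unfold Cminus, Cplus, Copp; cbn. ring. }
  apply (continuous_comp _ sqrt); [|apply continuous_sqrt].
  destruct z as [a b]. cont_poly; first [apply continuous_fst|apply continuous_snd].
Qed.

Lemma open_c_disc (c : C) (r : R) : open (c_disc c r).
Proof.
  apply (open_comp (fun w => Cmod (Cminus w c)) (fun u => u < r)).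
  - intros z _. apply continuous_Cmod_sub.
  - apply open_lt.
Qed.

Lemma c_disc_center (c : C) (r : R) : 0 < r -> c_disc c r c.
Proof.
  intros H. unfold c_disc. replace (Cminus c c) with (RtoC 0) by ring. now rewrite Cmod_0.
Qed.

Lemma open_c_disc_in (E : C -> Prop) (c : C) : open E -> E c ->
  exists r, 0 < r /\ forall z, c_disc c r z -> E z.
Proof.
  intros HE Hc. destruct (HE c Hc) as [eps H]. exists eps. split; [apply cond_pos|].
  intros z Hz. apply H. unfold c_disc in Hz.
  assert (K := Rmax_Cmod (Cminus z c)).
  destruct z as [z1 z2], c as [c1 c2]. cbn in K.
  split; unfold ball; cbn; unfold AbsRing_ball, abs, minus, plus, opp; cbn.
  - eapply Rle_lt_trans; [|exact Hz]. eapply Rle_trans; [|exact K]. apply Rmax_l.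
  - eapply Rle_lt_trans; [|exact Hz]. eapply Rle_trans; [|exact K]. apply Rmax_r.
Qed.

Lemma le_geometric_0 (x M q : R) : 0 <= q < 1 -> 0 <= M ->
  (forall n : nat, x <= M * q ^ n) -> x <= 0.
Proof.
  intros Hq HM H. destruct (Rle_lt_dec x 0) as [h|h]; [exact h|].
  (* [M + 1] instead of [M], which may be zero. *)
  destruct (pow_lt_1_zero q) with (y := x / (M + 1)) as [N HN].
  - rewrite Rabs_pos_eq; lra.
  - apply Rdiv_lt_0_compat; lra.
  - specialize (HN N (Nat.le_refl N)). specialize (H N).
    rewrite Rabs_pos_eq in HN by (apply pow_le; lra).
    assert (q ^ N * (M + 1) < x).
    { apply (Rmult_lt_compat_r (M + 1)) in HN; [|lra].
      unfold Rdiv in HN. rewrite Rmult_assoc, Rinv_l, Rmult_1_r in HN; lra. }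
    assert (0 <= q ^ N) by (apply pow_le; lra). nra.
Qed.

(* Apply the homotopy to [phi(z) / (z - c)^k], still holomorphic as [phi]
   vanishes near [c]: on the circle of radius [rho] it is [O(rho^-k)], so
   [|phi(w)| <= M (|w - c| / rho)^k] for all [k].  The winding integral [N] of the
   circle around [w] need not be computed: the imaginary part of its integrand is
   at least [1/2]. *)
Lemma holomorphic_zero_disc (I : quat) (c : C) (r eps : R) (phi : C -> quat) :
  imag_unit I -> 0 < eps -> holomorphic_on (c_disc c r) I phi ->
  (forall z, c_disc c eps z -> phi z = qreal 0) ->
  forall z, c_disc c r z -> phi z = qreal 0.
Proof.
  intros HI Heps Hphi Hz w Hw.
  destruct (excluded_middle_informative (w = c)) as [->|ewc]; [now apply Hz, c_disc_center|].
  set (u := Cminus w c). assert (Hu : Cmod u < r) by exact Hw.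
  assert (u0 : 0 < Cmod u).
  { apply Cmod_gt_0. intros e. apply ewc. replace w with (Cplus u c) by (unfold u; ring).
    rewrite e. ring. }
  set (rho := (Cmod u + r) / 2).
  assert (hrho : Cmod u < rho < r) by (unfold rho; lra).
  set (delta := (r - rho) / (2 * rho)).
  assert (hdelta : 0 < delta) by (apply Rdiv_lt_0_compat; lra).
  assert (hdelta2 : (1 + 2 * delta) * rho = r) by (unfold delta; field; lra).
  set (u1 := fst u). set (u2 := snd u).
  assert (hu2 : u1 * u1 + u2 * u2 < rho * rho).
  { assert (e : Cmod u * Cmod u = u1 * u1 + u2 * u2).
    { unfold Cmod. rewrite sqrt_sqrt by (apply Rplus_le_le_0_compat; apply pow2_ge_0).
      unfold u1, u2; ring. }
    rewrite <- e. nra. }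
  (* The curve (a, b) is the circle of radius rho about [c], seen from [w]. It has no zero because
     [w] lies strictly inside; k1 + i k2 below is its logarithmic derivative. *)
  set (a := fun t => rho * cos t - u1). set (b := fun t => rho * sin t - u2).
  set (a' := fun t => - rho * sin t). set (b' := fun t => rho * cos t).
  set (N := fun t => a t * a t + b t * b t).
  assert (cs : forall t, cos t * cos t + sin t * sin t = 1).
  { intros t. generalize (sin2_cos2 t). unfold Rsqr. lra. }
  assert (HN : forall t, 0 < N t).
  { intros t. destruct (Rle_lt_dec (N t) 0) as [h|h]; [exfalso|exact h].
    unfold N in h.
    assert (ha : a t = 0) by nra. assert (hb : b t = 0) by nra.
    unfold a, b in *. assert (u1 = rho * cos t) by lra. assert (u2 = rho * sin t) by lra.
    rewrite H, H0 in hu2. specialize (cs t).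
    assert (rho * cos t * (rho * cos t) + rho * sin t * (rho * sin t) = rho * rho).
    { transitivity (rho * rho * (cos t * cos t + sin t * sin t)); [ring|rewrite cs; ring]. }
    lra. }
  set (k1 := fun t => (a' t * a t + b' t * b t) * / N t).
  set (k2 := fun t => (b' t * a t - a' t * b t) * / N t).
  assert (Ca : forall t, continuous a t).
  { intros t. apply continuous_Rminus; [|apply continuous_const].
    apply continuous_Rmult; [apply continuous_const|apply continuous_cos]. }
  assert (Cb : forall t, continuous b t).
  { intros t. apply continuous_Rminus; [|apply continuous_const].
    apply continuous_Rmult; [apply continuous_const|apply continuous_sin]. }
  assert (Ca' : forall t, continuous a' t).
  { intros t. apply continuous_Rmult; [apply continuous_const|apply continuous_sin]. }
  assert (Cb' : forall t, continuous b' t).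
  { intros t. apply continuous_Rmult; [apply continuous_const|apply continuous_cos]. }
  assert (CN : forall t, continuous (fun t => / N t) t).
  { intros t. apply (continuous_comp N Rinv).
    - apply continuous_Rplus; apply continuous_Rmult; auto.
    - apply continuous_Rinv. generalize (HN t); lra. }
  assert (Ck1 : forall t, continuous k1 t).
  { intros t. apply continuous_Rmult; [|apply CN].
    apply continuous_Rplus; apply continuous_Rmult; auto. }
  assert (Ck2 : forall t, continuous k2 t).
  { intros t. apply continuous_Rmult; [|apply CN].
    apply continuous_Rminus; apply continuous_Rmult; auto. }
  assert (Hab : forall s t, (fst w + s * a t, snd w + s * b t)
     = Cplus c (Cplus (Cmult (RtoC (1 - s)) u) (Cmult (RtoC s) (rho * cos t, rho * sin t)))).
  { intros s t. unfold a, b, u1, u2, u. destruct w as [w1 w2], c as [c1 c2].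
    unfold Cminus, Cplus, Copp, Cmult, RtoC; cbn. f_equal; ring. }
  assert (Hcirc : forall t, Cmod (rho * cos t, rho * sin t) = rho).
  { intros t. unfold Cmod. cbn [fst snd]. rewrite <- (sqrt_square rho) by lra. f_equal.
    rewrite sqrt_square by lra.
    transitivity (rho * rho * (cos t * cos t + sin t * sin t)); [ring|rewrite cs; ring]. }
  assert (Hone : forall t, Cminus (fst w + 1 * a t, snd w + 1 * b t) c = (rho * cos t, rho * sin t)).
  { intros t. unfold a, b, u1, u2, u. destruct w as [w1 w2], c as [c1 c2].
    unfold Cminus, Cplus, Copp; cbn. f_equal; ring. }
  assert (Hin : forall s t, - delta < s < 1 + delta -> c_disc c r (fst w + s * a t, snd w + s * b t)).
  { intros s t Hs. rewrite Hab. unfold c_disc.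
    replace (Cminus (Cplus c (Cplus (Cmult (RtoC (1 - s)) u) (Cmult (RtoC s) (rho * cos t, rho * sin t)))) c)
      with (Cplus (Cmult (RtoC (1 - s)) u) (Cmult (RtoC s) (rho * cos t, rho * sin t))) by ring.
    eapply Rle_lt_trans; [apply Cmod_triangle|].
    rewrite !Cmod_mult, !Cmod_R, Hcirc.
    assert (Rabs (1 - s) * Cmod u <= Rabs (1 - s) * rho)
      by (apply Rmult_le_compat_l; [apply Rabs_pos|lra]).
    assert (Rabs (1 - s) + Rabs s < 1 + 2 * delta).
    { unfold Rabs. destruct (Rcase_abs (1 - s)), (Rcase_abs s); lra. }
    nra. }
  set (T := 2 * PI). assert (HT : 0 < T) by (unfold T; generalize PI_RGT_0; lra).
  set (phik := fix phik (n : nat) (z : C) : quat :=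
     match n with O => phi z | S n => (qinv (emb I (Cminus z c)) * phik n z)%quat end).
  assert (Hphik : forall n, holomorphic_on (c_disc c r) I (phik n)
     /\ forall z, c_disc c eps z -> phik n z = qreal 0).
  { induction n as [|n [IH1 IH2]]; [now split|]. split.
    - apply (holomorphic_quotient (c_disc c r) I c (phik n)); [exact HI|apply open_c_disc| |exact IH1].
      apply (filter_imp (c_disc c eps)); [exact IH2|]. apply open_c_disc, c_disc_center, Heps.
    - intros z hz.
      change (phik (S n) z) with (qinv (emb I (Cminus z c)) * phik n z)%quat.
      rewrite (IH2 z hz). apply qmul_0_r. }
  assert (Hnorm : forall n z, z <> c -> qabs (phik n z) = qabs (phi z) * (/ Cmod (Cminus z c)) ^ n).
  { induction n as [|n IH]; intros z hz; [cbn; ring|].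
    change (phik (S n) z) with (qinv (emb I (Cminus z c)) * phik n z)%quat.
    assert (hz' : Cminus z c <> RtoC 0).
    { intros e; apply hz. transitivity (Cplus (Cminus z c) c); [ring|rewrite e; ring]. }
    rewrite qabs_mul, (IH z hz), (emb_inv I _ HI hz'), (qabs_emb I _ HI), (Cmod_inv _ hz').
    cbn. ring. }
  set (N1 := RInt k1 0 T). set (N2 := RInt k2 0 T).
  assert (Ik1 : ex_RInt k1 0 T) by (apply @ex_RInt_continuous; intros; apply Ck1).
  assert (Ik2 : ex_RInt k2 0 T) by (apply @ex_RInt_continuous; intros; apply Ck2).
  assert (HN2 : 0 < N2).
  { apply Rlt_le_trans with (RInt (fun _ => 1 / 2) 0 T).
    - rewrite RInt_const. change (0 < (T - 0) * (1 / 2)). lra.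
    - apply RInt_le; [lra| |exact Ik2|].
      + apply @ex_RInt_const.
      (* Twice the numerator of [k2] exceeds [N t] by rho^2 - |u|^2, which is positive. *)
      + intros t _. unfold k2. apply (Rmult_le_reg_r (N t)); [apply HN|].
        rewrite Rmult_assoc, Rinv_l, Rmult_1_r by (generalize (HN t); lra).
        unfold N, a, b, a', b'. specialize (cs t).
        assert (K : rho * cos t * (rho * cos t) + rho * sin t * (rho * sin t) = rho * rho).
        { transitivity (rho * rho * (cos t * cos t + sin t * sin t)); [ring|rewrite cs; ring]. }
        lra. }
  set (nn := emb I (N1, N2)).
  assert (Hnn : 0 < qabs nn).
  { unfold nn. rewrite qabs_emb by exact HI. apply Cmod_gt_0. intros e. injection e. lra. }
  assert (Cphi : forall n t, continuous (fun t => (emb I (k1 t, k2 t) * phik n (fst w + 1 * a t, snd w + 1 * b t)%R)%quat) t).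
  { intros n t. apply continuous_qmul; [now apply continuous_emb|].
    apply (continuous_comp (fun t => (fst w + 1 * a t, snd w + 1 * b t)) (phik n)).
    - apply continuous_pair; apply continuous_Rplus; try apply continuous_const;
      (apply continuous_Rmult; [apply continuous_const|auto]).
    - apply (holomorphic_continuous I (c_disc c r)); [exact HI|apply open_c_disc|apply Hphik|].
      apply Hin. lra. }
  set (M := RInt (fun t => qabs (emb I (k1 t, k2 t) * phi (fst w + 1 * a t, snd w + 1 * b t)%R)%quat) 0 T).
  assert (CM : forall n t, continuous (fun t => qabs (emb I (k1 t, k2 t) * phik n (fst w + 1 * a t, snd w + 1 * b t)%R)%quat) t).
  { intros n t. unfold qabs. apply (continuous_comp _ sqrt); [|apply continuous_sqrt].
    apply (continuous_ext (fun s => (fun q => q0 q * q0 q + q1 q * q1 q + q2 q * q2 q + q3 q * q3 q)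
       (emb I (k1 s, k2 s) * phik n (fst w + 1 * a s, snd w + 1 * b s)%R)%quat)).
    { intros s. now rewrite qdot_q. }
    destruct (proj1 (continuous_quat _ _) (Cphi n t)) as (f0 & f1 & f2 & f3).
    cont_poly; assumption. }
  assert (HM : 0 <= M).
  { apply RInt_ge_0; [lra| |].
    - apply @ex_RInt_continuous; intros; apply (CM O).
    - intros; apply qabs_nonneg. }
  assert (Main : forall n, qabs nn * qabs (phik n w) <= M * (/ rho) ^ n).
  (* Testing with [nn * V] itself turns the integral at [s = 0] into the square of its norm, so one
     real functional bounds the full quaternion. *)
  { intros n. set (V := phik n w). set (e := (nn * V)%quat).
    destruct (Hphik n) as [(d & Hd)%(holomorphic_c_derive _ _ _ HI) _].
    assert (K := homotopy_integral I e (c_disc c r) (phik n) d a b a' b' k1 k2 (fst w) (snd w) T delta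
      HI (open_c_disc c r) Hd HT hdelta).
    assert (L : RInt (fun t => qdot e (emb I (k1 t, k2 t) * phik n (fst w + 0 * a t, snd w + 0 * b t)%R)%quat) 0 T
      = qdot e (nn * V)%quat).
    { apply (is_RInt_unique (V := R_CompleteNormedModule)).
      set (A := qdot e V). set (B := qdot e (I * V)%quat).
      assert (lin : forall x y, qdot e (emb I (x, y) * V)%quat = plus (scal A x) (scal B y)).
      { intros x y. unfold A, B. clearbody e V.
        change (qdot e (emb I (x, y) * V)%quat = qdot e V * x + qdot e (I * V)%quat * y).
        destruct e as [[[? ?] ?] ?], I as [[[? ?] ?] ?], V as [[[? ?] ?] ?].
        unfold emb, qreal; cbn. ring. }
      unfold nn. rewrite lin.
      apply (is_RInt_ext (fun t => plus (scal A (k1 t)) (scal B (k2 t)))).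
      - intros t _. rewrite <- lin. unfold V. do 3 f_equal.
        destruct w as [w1 w2]; cbn; f_equal; ring.
      - apply @is_RInt_plus; apply @is_RInt_scal; now apply (RInt_correct (V := R_CompleteNormedModule)). }
    assert (Ub : Rabs (RInt (fun t => qdot e (emb I (k1 t, k2 t) * phik n (fst w + 1 * a t, snd w + 1 * b t)%R)%quat) 0 T)
      <= qabs e * (/ rho) ^ n * M).
    { eapply Rle_trans; [apply abs_RInt_le; [lra|]|].
      - apply @ex_RInt_continuous. intros t _. apply continuous_qdot. apply Cphi.
      - eapply Rle_trans; [apply (RInt_le _ (fun t => scal (qabs e * (/ rho) ^ n)
          (qabs (emb I (k1 t, k2 t) * phi (fst w + 1 * a t, snd w + 1 * b t)%R)%quat))); [lra| | |]|].
        + apply @ex_RInt_continuous. intros t _.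
          apply (continuous_comp _ Rabs); [|apply continuous_Rabs].
          apply continuous_qdot. apply Cphi.
        + apply @ex_RInt_scal. apply @ex_RInt_continuous. intros t _. apply (CM O).
        + intros t _. eapply Rle_trans; [apply qdot_le|].
          change (qabs e * qabs (emb I (k1 t, k2 t) * phik n (fst w + 1 * a t, snd w + 1 * b t)%R)%quat <=
            qabs e * (/ rho) ^ n * qabs (emb I (k1 t, k2 t) * phi (fst w + 1 * a t, snd w + 1 * b t)%R)%quat).
          rewrite !qabs_mul, Hnorm.
          * rewrite Hone, Hcirc. right; ring.
          * intros ec. generalize (Hcirc t). rewrite <- Hone, ec.
            replace (Cminus c c) with (RtoC 0) by ring. rewrite Cmod_0. lra.
        + right. apply (RInt_scal (V := R_CompleteNormedModule)).
          apply @ex_RInt_continuous. intros t _. apply (CM O). }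
    rewrite <- K, L in Ub.
    - change (qdot e (nn * V)%quat) with (qdot e e) in Ub. rewrite <- qabs_sqr in Ub.
      rewrite Rabs_pos_eq in Ub by (apply Rmult_le_pos; apply qabs_nonneg).
      rewrite <- qabs_mul. fold e.
      destruct (qabs_nonneg e) as [h|h].
      + apply (Rmult_le_reg_l (qabs e)); [exact h|]. lra.
      + rewrite <- h. apply Rmult_le_pos; [exact HM|]. apply pow_le. left. apply Rinv_0_lt_compat. lra.
    - intros t. unfold a, a'. auto_derive; [exact Logic.I|ring].
    - intros t. unfold b, b'. auto_derive; [exact Logic.I|ring].
    - exact Ca'.
    - exact Cb'.
    - exact Ck1.
    - exact Ck2.
    - intros t. specialize (HN t). unfold k1, k2, Cmult; cbn [fst snd].
      f_equal; apply (Rmult_eq_reg_r (N t)); try lra; unfold N in *; field; lra.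
    - unfold a, T. rewrite cos_0, cos_2PI. reflexivity.
    - unfold b, T. rewrite sin_0, sin_2PI. reflexivity.
    - exact Hin. }
  apply qabs_eq_0. apply Rle_antisym; [|apply qabs_nonneg].
  apply (le_geometric_0 _ (M / qabs nn) (Cmod u / rho)).
  - split; [apply Rlt_le, Rdiv_lt_0_compat; lra|]. apply (Rmult_lt_reg_r rho); [lra|].
    unfold Rdiv. rewrite Rmult_assoc, Rinv_l; lra.
  - apply Rmult_le_pos; [exact HM|]. left. now apply Rinv_0_lt_compat.
  - intros n. specialize (Main n). rewrite (Hnorm n w ewc) in Main. fold u in Main.
    apply (Rmult_le_reg_l (qabs nn * (/ Cmod u) ^ n)).
    { apply Rmult_lt_0_compat; [exact Hnn|]. apply pow_lt. now apply Rinv_0_lt_compat. }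
    eapply Rle_trans; [|eapply Rle_trans; [exact Main|]]; right; [ring|].
    unfold Rdiv. rewrite Rpow_mult_distr.
    replace ((/ Cmod u) ^ n) with (/ (Cmod u ^ n)) by (rewrite pow_inv; reflexivity).
    field. repeat split; try apply pow_nonzero; lra.
Qed.

(** Each difference quotient at 0 is either that of [f] or zero, and both tend to 0. *)
Lemma is_derive_half_line (f : R -> R) (s : R) :
  is_derive f 0 0 -> f 0 = 0 ->
  is_derive (fun t => if Rle_dec 0 (s * t) then f t else 0) 0 0.
Proof.
  intros H H0. apply is_derive_Reals in H. apply is_derive_Reals.
  intros eps Heps. destruct (H eps Heps) as [delta Hd]. exists delta. intros h h0 hd.
  specialize (Hd h h0 hd). rewrite Rplus_0_l in *. rewrite H0 in Hd.
  rewrite Rmult_0_r. destruct (Rle_dec 0 0) as [_|n]; [rewrite H0|lra].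
  destruct (Rle_dec 0 (s * h)) as [_|_]; [exact Hd|].
  replace ((0 - 0) / h - 0) with 0 by (field; exact h0). rewrite Rabs_R0. exact Heps.
Qed.

Lemma continuous_if_zero {T : UniformSpace} (f : T -> quat) (P : T -> bool) (t : T) :
  continuous f t -> f t = qreal 0 ->
  continuous (fun s => if P s then f s else qreal 0) t.
Proof.
  intros H H0. assert (K : (if P t then f t else qreal 0) = f t) by (rewrite H0; now destruct (P t)).
  apply filterlim_locally. intros eps. cbv beta.
  match goal with |- locally _ (fun x => ball ?c _ _) =>
    replace c with (f t) by (symmetry; exact K) end.
  generalize (proj1 (filterlim_locally f (f t)) H eps). clear H. intros H.
  revert H. apply filter_imp. intros s Hs. destruct (P s); [exact Hs|].
  rewrite H0. apply ball_center.
Qed.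

Definition same_side (s : R) (z : C) : bool :=
  if Rle_dec 0 (s * Im z) then true else false.

(* Vanishing on the real axis together with the Cauchy-Riemann equation kills
   both partial derivatives there, so cutting off one half plane stays C^1. *)
Lemma holomorphic_cut (I : quat) (E : C -> Prop) (s : R) (phi : C -> quat) :
  imag_unit I -> s <> 0 -> open E -> (forall t, E (t, 0) -> phi (t, 0) = qreal 0) ->
  holomorphic_on E I phi ->
  holomorphic_on E I (fun z => if same_side s z then phi z else qreal 0).
Proof.
  intros HI Hs HE H0 (d & H)%(holomorphic_c_derive _ _ _ HI).
  apply (holomorphic_c_derive _ _ _ HI).
  exists (fun z => if same_side s z then d z else qreal 0).
  intros [a b] Hz. destruct (H _ Hz) as [[h1 h2] h3].
  assert (Cb : continuous (fun z : C => s * Im z) (a, b)).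
  { unfold Im. cont_poly. apply continuous_snd. }
  destruct (Rtotal_order 0 (s * b)) as [e|[e|e]].
  - assert (L : locally (a, b) (fun z : C => 0 < s * Im z)).
    { apply (open_comp (fun z : C => s * Im z) (fun u => 0 < u)); [|apply open_gt|exact e].
      intros z _. unfold Im. change (continuous (fun z : C => s * snd z) z).
      cont_poly. destruct z. apply continuous_snd. }
    assert (K : locally (a, b) (fun z : C => same_side s z = true)).
    { revert L. apply filter_imp. intros z hz. unfold same_side. now destruct (Rle_dec 0 (s * Im z)); [|lra]. }
    rewrite (locally_singleton _ _ K). split.
    + apply (c_derive_ext_loc I phi); [|split; assumption].
      revert K. apply filter_imp. now intros z ->.
    + refine (continuous_ext_loc _ d _ _ h3).
      revert K. apply filter_imp. now intros z ->.
  - assert (b = 0) as ->.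
    { destruct (Rmult_integral s b (eq_sym e)); [contradiction|assumption]. }
    unfold Re, Im in h1, h2; cbn [fst snd] in h1, h2.
    assert (d0 : d (a, 0) = qreal 0).
    { apply (is_derive_quat_unique (fun t => phi (t, 0)) a); [exact h1|].
      apply (is_derive_ext_loc (fun _ => qreal 0)); [|apply is_derive_qconst].
      generalize (locally_line_x _ _ (HE _ Hz)). apply filter_imp.
      intros t ht. symmetry. now apply H0. }
    rewrite d0, qmul_0_r in h2.
    assert (p0 : phi (a, 0) = qreal 0) by now apply H0.
    replace (if same_side s (a, 0) then d (a, 0) else qreal 0) with (qreal 0)
      by (rewrite d0; now destruct (same_side s (a, 0))).
    split; [split|].
    + unfold Re, Im; cbn [fst snd].
      apply (is_derive_ext (fun t => phi (t, 0))); [|rewrite <- d0; exact h1].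
      intros t. unfold same_side; cbn [Im snd].
      destruct (Rle_dec 0 (s * 0)) as [_|n]; [reflexivity|lra].
    + unfold Re, Im; cbn [fst snd]. rewrite qmul_0_r. apply is_derive_qdot_iff. intros e'.
      replace (qdot e' (qreal 0)) with 0 by (rewrite qdot_q; unfold q0, q1, q2, q3, qreal; cbn; ring).
      apply (is_derive_ext (fun t => if Rle_dec 0 (s * t) then qdot e' (phi (a, t)) else 0)).
      { intros t. unfold same_side; cbn [Im snd]. destruct (Rle_dec 0 (s * t)); [reflexivity|].
        rewrite qdot_q; unfold q0, q1, q2, q3, qreal; cbn; ring. }
      apply is_derive_half_line.
      * apply (is_derive_qdot e') in h2.
        replace (qdot e' (qreal 0)) with 0 in h2 by (rewrite qdot_q; unfold q0, q1, q2, q3, qreal; cbn; ring).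
        exact h2.
      * change (qdot e' (phi (a, 0)) = 0). rewrite p0. rewrite qdot_q; unfold q0, q1, q2, q3, qreal; cbn; ring.
    + now apply continuous_if_zero.
  - assert (L : locally (a, b) (fun z : C => s * Im z < 0)).
    { apply (open_comp (fun z : C => s * Im z) (fun u => u < 0)); [|apply open_lt|exact e].
      intros z _. unfold Im. change (continuous (fun z : C => s * snd z) z).
      cont_poly. destruct z. apply continuous_snd. }
    assert (K : locally (a, b) (fun z : C => same_side s z = false)).
    { revert L. apply filter_imp. intros z hz. unfold same_side. now destruct (Rle_dec 0 (s * Im z)); [lra|]. }
    rewrite (locally_singleton _ _ K). split.
    + apply (c_derive_ext_loc I (fun _ => qreal 0)); [|apply c_derive_const].
      revert K. apply filter_imp. now intros z ->.
    + refine (continuous_ext_loc _ (fun _ => qreal 0) _ _ (continuous_const _ _)).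
      revert K. apply filter_imp. now intros z ->.
Qed.

Lemma c_disc_triangle (c c' z : C) (r r' : R) : Cmod (Cminus c c') + r <= r' -> c_disc c r z -> c_disc c' r' z.
Proof.
  unfold c_disc. intros H Hz. replace (Cminus z c') with (Cplus (Cminus z c) (Cminus c c')) by ring.
  eapply Rle_lt_trans; [apply Cmod_triangle|]. lra.
Qed.

Lemma Im_le_Cmod (z : C) : Rabs (Im z) <= Cmod z.
Proof. eapply Rle_trans; [apply Rmax_r|apply Rmax_Cmod]. Qed.

Lemma holomorphic_zero_real (I : quat) (t r : R) (phi : C -> quat) :
  imag_unit I -> 0 < r -> holomorphic_on (c_disc (t, 0) r) I phi ->
  (forall u, c_disc (t, 0) r (u, 0) -> phi (u, 0) = qreal 0) ->
  forall z, c_disc (t, 0) (r / 4) z -> phi z = qreal 0.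
Proof.
  intros HI Hr H H0.
  assert (K : forall s z, s = 1 \/ s = -1 -> c_disc (t, 0) (r / 4) z -> same_side s z = true -> phi z = qreal 0).
  { intros s z Hs Hz Hside.
    (* The centre lies at depth r/4 in the half plane where the cut function is zero. The disc of
       radius r/8 about it misses the axis; the disc of radius r/2 stays in the given one and covers
       the disc of radius r/4 about (t, 0). *)
    set (c := (t, - s * (r / 4)) : C).
    assert (mc : Cmod (Cminus c (t, 0)) = r / 4).
    { replace (Cminus c (t, 0)) with ((0, - s * (r / 4)) : C).
      - unfold Cmod; cbn [fst snd]. rewrite <- (sqrt_square (r / 4)) by lra. f_equal.
        rewrite sqrt_square by lra. destruct Hs as [-> | ->]; ring.
      - unfold c, Cminus, Cplus, Copp; cbn. f_equal; ring. }
    assert (mc' : Cmod (Cminus (t, 0) c) = r / 4).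
    { rewrite <- mc, <- Cmod_opp. f_equal. ring. }
    set (psi := fun z => if same_side s z then phi z else qreal 0).
    assert (Hpsi : holomorphic_on (c_disc (t, 0) r) I psi).
    { apply holomorphic_cut; [exact HI|destruct Hs; lra|apply open_c_disc|exact H0|exact H]. }
    replace (phi z) with (psi z) by (unfold psi; now rewrite Hside).
    apply (holomorphic_zero_disc I c (r / 2) (r / 8) psi HI); [lra| | |].
    - apply (holomorphic_subset (c_disc (t, 0) r)); [|exact Hpsi].
      intros w. apply c_disc_triangle. lra.
    - intros w Hw. unfold psi, same_side. destruct (Rle_dec 0 (s * Im w)) as [h|h]; [exfalso|reflexivity].
      unfold c_disc in Hw. generalize (Im_le_Cmod (Cminus w c)). intros g.
      replace (Im (Cminus w c)) with (Im w + s * (r / 4)) in g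
        by (unfold c, Im, Cminus, Cplus, Copp; cbn; ring).
      destruct Hs as [-> | ->]; revert g; unfold Rabs; destruct Rcase_abs; lra.
    - revert Hz. apply c_disc_triangle. lra. }
  intros z Hz. destruct (Rle_lt_dec 0 (Im z)) as [h|h].
  - apply (K 1 z); [now left|exact Hz|]. unfold same_side. destruct Rle_dec; [reflexivity|lra].
  - apply (K (-1) z); [now right|exact Hz|]. unfold same_side. destruct Rle_dec; [reflexivity|lra].
Qed.

Lemma Cmod_sub_sym (z w : C) : Cmod (Cminus z w) = Cmod (Cminus w z).
Proof. rewrite <- Cmod_opp. f_equal. ring. Qed.

(** The interior [Z] of the zero set is open by definition. It is also closed in [E]: a point of [Z]
    near [w] is the centre of a disc of zeros that swallows [w]. *)
Lemma identity_principle (I : quat) (E : C -> Prop) (phi : C -> quat) (t eps : R) :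
  imag_unit I -> open E -> connected_set E -> holomorphic_on E I phi ->
  E (t, 0) -> 0 < eps ->
  (forall u, Rabs (u - t) < eps -> E (u, 0) -> phi (u, 0) = qreal 0) ->
  forall z, E z -> phi z = qreal 0.
Proof.
  intros HI HE HC H Ht Heps H0 z Hz.
  set (Z := fun w => locally w (fun v => phi v = qreal 0)).
  assert (OZ : open Z) by (intros w Hw; now apply locally_locally).
  assert (tZ : Z (t, 0)).
  { destruct (open_c_disc_in E (t, 0) HE Ht) as (r & r0 & Hr).
    set (r' := Rmin r eps).
    assert (r' <= r) by apply Rmin_l. assert (r' <= eps) by apply Rmin_r.
    assert (0 < r') by now apply Rmin_glb_lt.
    unfold Z. apply (filter_imp (c_disc (t, 0) (r' / 4))).
    - apply (holomorphic_zero_real I t r' phi HI); [assumption| |].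
      + apply (holomorphic_subset E); [|exact H]. intros w Hw. apply Hr. unfold c_disc in *; lra.
      + intros u Hu. unfold c_disc in Hu. apply H0; [|apply Hr; unfold c_disc; lra].
        replace (Cminus (u, 0) (t, 0)) with (RtoC (u - t)) in Hu.
        * rewrite Cmod_R in Hu. lra.
        * unfold RtoC, Cminus, Cplus, Copp; cbn. f_equal; ring.
    - apply open_c_disc, c_disc_center. lra. }
  destruct (excluded_middle_informative (Z z)) as [h|h]; [exact (locally_singleton _ _ h)|exfalso].
  destruct (HC Z (fun w => E w /\ ~ Z w) OZ) as (w & _ & h1 & _ & h2).
  (* With |v - w| < r/3, the disc of radius 2r/3 about [v] lies in the disc of radius r about [w]
     and contains [w]. *)
  - intros w [Ew nw]. destruct (open_c_disc_in E w HE Ew) as (r & r0 & Hr).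
    apply (filter_imp (c_disc w (r / 3))); [|apply open_c_disc, c_disc_center; lra].
    intros v Hv. unfold c_disc in Hv. split; [apply Hr; unfold c_disc; lra|].
    intros Zv. apply nw.
    destruct (open_c_disc_in Z v OZ Zv) as (e & e0 & He).
    unfold Z. apply (filter_imp (c_disc v (2 * r / 3))).
    + apply (holomorphic_zero_disc I v (2 * r / 3) e phi HI e0).
      * apply (holomorphic_subset E); [|exact H]. intros x Hx. apply Hr.
        revert Hx. apply c_disc_triangle. lra.
      * intros x Hx. exact (locally_singleton _ _ (He x Hx)).
    + apply open_c_disc. unfold c_disc. rewrite Cmod_sub_sym. lra.
  - intros w Ew. destruct (excluded_middle_informative (Z w)); auto.
  - exists (t, 0). auto.
  - exists z. auto.
  - contradiction.
Qed.

(** * Connectedness of curves, punctured open sets and sets with limit points added *)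

Lemma path_connected_split {T : UniformSpace} (gamma : R -> T) (V W : T -> Prop) (l : R) :
  (forall s, continuous gamma s) -> open V -> open W ->
  (forall s, V (gamma s) \/ W (gamma s)) -> 0 < l -> V (gamma 0) -> W (gamma l) ->
  exists s, V (gamma s) /\ W (gamma s).
Proof.
  intros Hg HV HW Hc Hl H0 H1.
  destruct (excluded_middle_informative (exists s, V (gamma s) /\ W (gamma s))) as [h|h]; [exact h|exfalso].
  (* If the two sets never met along the curve, this function would be locally constant with
     different values at 0 and [l]. Its derivative would vanish, so it would be constant: the
     connectedness of an interval comes from the mean value theorem. *)
  set (chi := fun s => if excluded_middle_informative (V (gamma s)) then 0 else 1).
  assert (K : chi 0 = chi l).
  { apply (eq_is_derive chi 0 l); [|exact Hl]. intros t _.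
    destruct (Hc t) as [ht|ht].
    - apply (is_derive_ext_loc (fun _ => 0)); [|apply @is_derive_const].
      apply (filter_imp (fun s => V (gamma s))); [|exact (Hg t _ (HV _ ht))].
      intros s hs. unfold chi. now destruct excluded_middle_informative.
    - apply (is_derive_ext_loc (fun _ => 1)); [|apply @is_derive_const].
      apply (filter_imp (fun s => W (gamma s))); [|exact (Hg t _ (HW _ ht))].
      intros s hs. unfold chi. destruct excluded_middle_informative as [v|v]; [|reflexivity].
      exfalso. apply h. now exists s. }
  unfold chi in K. destruct excluded_middle_informative as [_|v]; [|contradiction].
  destruct excluded_middle_informative as [v|v]; [|lra]. apply h. now exists l.
Qed.

Lemma segment_split (V W : C -> Prop) (a b : C) :
  open V -> open W -> V a -> W b ->
  (forall s, 0 <= s <= 1 -> let z := Cplus a (Cmult (RtoC s) (Cminus b a)) in V z \/ W z) ->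
  exists s, 0 <= s <= 1 /\ let z := Cplus a (Cmult (RtoC s) (Cminus b a)) in V z /\ W z.
Proof.
  intros HV HW Ha Hb H.
  (* The square of the sine parametrizes the segment by the whole real line without leaving it, and
     runs from [a] at 0 to [b] at PI / 2. *)
  set (gamma := fun s => Cplus a (Cmult (RtoC (sin s * sin s)) (Cminus b a))).
  assert (B : forall s, 0 <= sin s * sin s <= 1).
  { intros s. generalize (sin2_cos2 s). unfold Rsqr. nra. }
  destruct (path_connected_split gamma V W (PI / 2)) as [s Hs]; try assumption.
  - intros s. apply (continuous_ext (fun s =>
      (fst a + sin s * sin s * (fst b - fst a), snd a + sin s * sin s * (snd b - snd a)))).
    { intros u. unfold gamma, Cplus, Cmult, Cminus, Copp, RtoC; cbn. f_equal; ring. }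
    apply continuous_pair; cont_poly; apply continuous_sin.
  - intros s. apply (H (sin s * sin s)), B.
  - apply PI2_RGT_0.
  - unfold gamma. rewrite sin_0, Rmult_0_l.
    replace (Cplus a (Cmult (RtoC 0) (Cminus b a))) with a by ring. exact Ha.
  - unfold gamma. rewrite sin_PI2, Rmult_1_l.
    replace (Cplus a (Cmult (RtoC 1) (Cminus b a))) with b by ring. exact Hb.
  - exists (sin s * sin s). split; [apply B|exact Hs].
Qed.

Lemma c_disc_convex (c a b : C) (r s : R) : 0 <= s <= 1 -> c_disc c r a -> c_disc c r b ->
  c_disc c r (Cplus a (Cmult (RtoC s) (Cminus b a))).
Proof.
  unfold c_disc. intros Hs Ha Hb.
  replace (Cminus (Cplus a (Cmult (RtoC s) (Cminus b a))) c)
    with (Cplus (Cmult (RtoC (1 - s)) (Cminus a c)) (Cmult (RtoC s) (Cminus b c)))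
    by (rewrite RtoC_minus; ring).
  eapply Rle_lt_trans; [apply Cmod_triangle|]. rewrite !Cmod_mult, !Cmod_R.
  rewrite !Rabs_pos_eq by lra.
  destruct (Req_dec s 0) as [->|h]; [lra|]. nra.
Qed.

(** A segment from [a] to [b] avoiding [p] settles the matter. Otherwise [b - p] is a nonzero real
    multiple [mu] of u = a - p, and one detours through c = p + i u, at the same distance from [p]
    as [a]. In the coordinates u, i u the two legs are (1 - t, t) and (t mu, 1 - t), which never
    vanish. *)
Lemma punctured_disc_split (V W : C -> Prop) (p : C) (r : R) :
  open V -> open W ->
  (forall z, c_disc p r z -> z <> p -> V z \/ W z) ->
  (exists z, c_disc p r z /\ z <> p /\ V z) -> (exists z, c_disc p r z /\ z <> p /\ W z) ->
  exists z, c_disc p r z /\ z <> p /\ V z /\ W z.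
Proof.
  intros HV HW HC (a & Ba & na & Va) (b & Bb & nb & Wb).
  assert (K : forall x y, c_disc p r x -> c_disc p r y -> V x -> W y ->
    (forall s, 0 <= s <= 1 -> Cplus x (Cmult (RtoC s) (Cminus y x)) <> p) ->
    exists z, c_disc p r z /\ z <> p /\ V z /\ W z).
  { intros x y Bx By Vx Wy Hn.
    destruct (segment_split V W x y HV HW Vx Wy) as (s & Hs & Hz).
    - intros s Hs. apply HC; [now apply c_disc_convex|now apply Hn].
    - eexists. split; [|split; [|exact Hz]]; [now apply c_disc_convex|now apply Hn]. }
  destruct (excluded_middle_informative
    (exists s, 0 <= s <= 1 /\ Cplus a (Cmult (RtoC s) (Cminus b a)) = p)) as [(s & Hs & e)|h].
  2: { apply (K a b); try assumption. intros s Hs e. apply h. now exists s. }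
  set (u := Cminus a p). assert (u0 : u <> RtoC 0).
  { intros e'. apply na. transitivity (Cplus u p); [unfold u; ring|rewrite e'; ring]. }
  set (c := Cplus p (Cmult Ci u)).
  assert (Hu : forall x y, Cmult u (x, y) = RtoC 0 -> x = 0 /\ y = 0).
  { intros x y e'. apply (f_equal Cmod) in e'. rewrite Cmod_mult, Cmod_0 in e'.
    apply Rmult_integral in e'. destruct e' as [e'|e'].
    - exfalso. apply u0. now apply Cmod_eq_0.
    - apply Cmod_eq_0 in e'. now injection e'. }
  assert (Bc : c_disc p r c).
  { unfold c_disc in *. replace (Cminus c p) with (Cmult Ci u) by (unfold c; ring).
    rewrite Cmod_mult. replace (Cmod Ci) with 1; [fold u in Ba; lra|].
    unfold Cmod, Ci; cbn. rewrite <- sqrt_1 at 1. f_equal. ring. }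
  assert (nc : c <> p).
  { intros e'. destruct (Hu 0 1) as [_ h]; [|lra]. change (0, 1) with Ci.
    transitivity (Cminus c p); [unfold c; ring|rewrite e'; ring]. }
  assert (s0 : s <> 0).
  { intros ->. apply na. rewrite <- e. ring. }
  assert (Hb : Cminus b p = Cmult (RtoC (- (1 - s) / s)) u).
  { assert (e2 : Cmult (RtoC s) (Cminus b p) = Cmult (RtoC (- (1 - s))) u).
    { unfold u. rewrite <- e at 1. rewrite RtoC_opp, RtoC_minus.
      rewrite <- e. ring. }
    unfold Rdiv. rewrite Rmult_comm, RtoC_mult, <- Cmult_assoc, <- e2.
    rewrite Cmult_assoc, <- RtoC_mult, Rinv_l by exact s0. ring. }
  set (mu := - (1 - s) / s) in *.
  assert (mu0 : mu <> 0).
  { intros e'. apply nb. rewrite e' in Hb. transitivity (Cplus (Cminus b p) p); [ring|rewrite Hb; ring]. }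
  destruct (HC c Bc nc) as [Vc|Wc].
  - apply (K c b); try assumption. intros t Ht e'.
    destruct (Hu (t * mu) (1 - t)) as [h1 h2].
    + replace ((t * mu, 1 - t) : C) with (Cplus (Cmult (RtoC t) (RtoC mu)) (Cmult (Cminus (RtoC 1) (RtoC t)) Ci)).
      * transitivity (Cplus (Cmult (Cminus (RtoC 1) (RtoC t)) (Cminus c p)) (Cmult (RtoC t) (Cminus b p))).
        { rewrite Hb. unfold c. ring. }
        transitivity (Cminus (Cplus c (Cmult (RtoC t) (Cminus b c))) p); [ring|rewrite e'; ring].
      * unfold Cplus, Cmult, Cminus, Copp, RtoC, Ci; cbn. f_equal; ring.
    + assert (t = 1) by lra. subst t. lra.
  - apply (K a c); try assumption. intros t Ht e'.
    destruct (Hu (1 - t) t) as [h1 h2]; [|lra].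
    replace ((1 - t, t) : C) with (Cplus (Cminus (RtoC 1) (RtoC t)) (Cmult (RtoC t) Ci)).
    + transitivity (Cminus (Cplus a (Cmult (RtoC t) (Cminus c a))) p); [unfold c, u; ring|rewrite e'; ring].
    + unfold Cplus, Cmult, Cminus, Copp, RtoC, Ci; cbn. f_equal; ring.
Qed.

(** If both open sets meet a small punctured disc about [p], they already meet each other inside it.
    If one of them misses that disc, the whole disc can be joined to the other, and the
    connectedness of [A] applies to this new pair. *)
Lemma connected_puncture (A : C -> Prop) (p : C) :
  open A -> connected_set A -> connected_set (fun z => A z /\ z <> p).
Proof.
  intros HA HC V W HV HW Hcov HmV HmW.
  destruct (excluded_middle_informative (A p)) as [Ap|nAp].
  2: { destruct (HC V W HV HW) as (z & Az & Hz).
       - intros z Az. apply Hcov. split; [exact Az|now intros ->].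
       - destruct HmV as (z & [h _] & h'). now exists z.
       - destruct HmW as (z & [h _] & h'). now exists z.
       - exists z. split; [|exact Hz]. split; [exact Az|now intros ->]. }
  destruct (open_c_disc_in A p HA Ap) as (r & r0 & Hr).
  destruct (excluded_middle_informative (exists z, (A z /\ z <> p) /\ V z /\ W z)) as [h|h]; [exact h|exfalso].
  assert (K : forall V W : C -> Prop, open V -> open W ->
     (forall z, A z /\ z <> p -> V z \/ W z) ->
     (exists z, (A z /\ z <> p) /\ W z) ->
     ~ (exists z, (A z /\ z <> p) /\ V z /\ W z) ->
     ~ (exists z, c_disc p r z /\ z <> p /\ W z) -> False).
  { clear - HA HC Hr r0 Ap. intros V W HV HW Hcov HmW h nW.
    destruct (HC (fun z => V z \/ c_disc p r z) (fun z => W z /\ z <> p)) as (z & Az & Hz & Wz & nz).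
    - apply open_or; [exact HV|apply open_c_disc].
    - apply open_and; [exact HW|apply open_C_neq].
    - intros z Az. destruct (excluded_middle_informative (z = p)) as [->|nz].
      + left; right; now apply c_disc_center.
      + destruct (Hcov z (conj Az nz)); auto.
    - exists p. split; [exact Ap|right; now apply c_disc_center].
    - destruct HmW as (z & [h1 h2] & h3). now exists z.
    - destruct Hz as [Vz|Bz]; [apply h|apply nW]; exists z; auto. }
  destruct (excluded_middle_informative (exists z, c_disc p r z /\ z <> p /\ W z)) as [eW|nW].
  - destruct (excluded_middle_informative (exists z, c_disc p r z /\ z <> p /\ V z)) as [eV|nV].
    + destruct (punctured_disc_split V W p r HV HW) as (z & h1 & h2 & h3); [|exact eV|exact eW|].
      * intros z Bz nz. apply Hcov. auto.
      * apply h. exists z. auto.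
    + apply (K W V); auto.
      * intros z Hz. destruct (Hcov z Hz); auto.
      * intros (z & h1 & h2 & h3). apply h. now exists z.
  - exact (K V W HV HW Hcov HmW h nW).
Qed.

(** For filling in missing points that are limits of points already present. *)
Lemma connected_closure {T : UniformSpace} (A B : T -> Prop) :
  (forall t, A t -> B t) ->
  (forall t V, B t -> open V -> V t -> exists s, A s /\ V s) ->
  connected_set A -> connected_set B.
Proof.
  intros HAB HB HA V W HV HW Hcov (t & Bt & Vt) (u & Bu & Wu).
  destruct (HA V W HV HW) as (s & As & Hs).
  - auto.
  - exact (HB t V Bt HV Vt).
  - exact (HB u W Bu HW Wu).
  - exists s. auto.
Qed.

(** * Regular functions and the [*]-product *)

(* The part of [symmetric_slice_domain] on which the identity principle
   relies: connectedness in the quaternions themselves is not needed. *)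
Definition sliced_domain (Om : quat -> Prop) : Prop :=
  symmetric Om /\ (exists t : R, Om (qreal t)) /\
  (forall I, imag_unit I -> domain (slice Om I)).

Lemma symmetric_slice_domain_sliced (Om : quat -> Prop) :
  symmetric_slice_domain Om -> sliced_domain Om.
Proof. intros [(_ & H1 & H2) H3]. now split. Qed.

Lemma slice_change (Om : quat -> Prop) (I J : quat) (z : C) :
  symmetric Om -> imag_unit I -> imag_unit J -> slice Om I z -> slice Om J z.
Proof.
  intros HS HI HJ Hz. destruct z as [x y]. apply (HS x y I HI Hz).
  now exists J.
Qed.

Lemma slice_conj (Om : quat -> Prop) (I : quat) (z : C) :
  symmetric Om -> imag_unit I -> slice Om I z -> slice Om I (Cconj z).
Proof.
  intros HS HI Hz. unfold slice. rewrite <- emb_opp_conj.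
  exact (slice_change Om I _ z HS HI (imag_unit_opp I HI) Hz).
Qed.

Lemma emb_real (I : quat) (t : R) : emb I (t, 0) = qreal t.
Proof. qcrush. Qed.

Lemma continuous_Cconj (z : C) : continuous Cconj z.
Proof.
  apply (continuous_ext (fun w : C => (fst w, 0 - snd w))).
  { intros w. unfold Cconj. f_equal. ring. }
  destruct z as [a b].
  apply continuous_pair; cont_poly; first [apply continuous_fst|apply continuous_snd].
Qed.

Lemma is_derive_reflect (f : R -> quat) (t : R) (d : quat) :
  is_derive f (- t) d -> is_derive (fun s => f (- s)) t (- d)%quat.
Proof.
  intros H. eapply is_derive_eq.
  - apply (is_derive_comp f Ropp t d (-1) H). auto_derive; [exact Logic.I|ring].
  - rewrite <- qscal_scal. symmetry. apply qopp_real.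
Qed.

(** The equation for [I], taken at z and at conj z, becomes alpha_x = beta_y and alpha_y = - beta_x.
    The unit has disappeared from these, so alpha + J beta satisfies the equation for every [J]. *)
Lemma slice_ext_regular (Om : quat -> Prop) (I : quat) (phi : C -> quat) :
  symmetric Om -> (forall J, imag_unit J -> open (slice Om J)) -> imag_unit I ->
  holomorphic_on (slice Om I) I phi -> regular Om (slice_ext I phi).
Proof.
  intros HS HO HI (d & H)%(holomorphic_c_derive _ _ _ HI) J HJ.
  apply (holomorphic_ext _ J (fun z => (stem_re phi z + J * stem_im I phi z)%quat));
    [exact HJ|now apply HO|intros z _; symmetry; now apply slice_ext_emb|].
  apply (holomorphic_c_derive _ _ _ HJ).
  exists (fun z => (half * (d z + d (Cconj z)) + J * (half * (I * (d (Cconj z) + qreal (-1) * d z))))%quat).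
  intros z Hz. apply (slice_change Om J I z HS HJ HI) in Hz.
  destruct (H z Hz) as [[h1 h2] h3].
  destruct (H _ (slice_conj Om I z HS HI Hz)) as [[k1 k2] k3].
  assert (l1 : is_derive (fun t => phi (Cconj (t, Im z))) (Re z) (d (Cconj z))) by exact k1.
  assert (l2 : is_derive (fun t => phi (Cconj (Re z, t))) (Im z) (- (I * d (Cconj z)))%quat).
  { exact (is_derive_reflect (fun t => phi (Re z, t)) (Im z) _ k2). }
  assert (m : forall (f g : R -> quat) t df dg, is_derive f t df -> is_derive g t dg ->
    is_derive (fun s => (half * (f s + g s) + J * (half * (I * (g s - f s))))%quat) t
      (half * (df + dg) + J * (half * (I * (dg - df))))%quat).
  { intros f g t df dg Hf Hg. unfold qsub. eapply is_derive_eq.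
    - apply is_derive_qadd.
      + apply is_derive_qmul; [apply is_derive_qconst|]. apply is_derive_qadd; eassumption.
      + apply is_derive_qmul; [apply is_derive_qconst|].
        apply is_derive_qmul; [apply is_derive_qconst|].
        apply is_derive_qmul; [apply is_derive_qconst|].
        apply is_derive_qadd; [eassumption|]. apply is_derive_qopp; eassumption.
    - non_commutative_ring. }
  split; [split|].
  - eapply is_derive_eq; [exact (m _ _ _ _ _ h1 l1)|].
    rewrite <- qopp_real. non_commutative_ring.
  - eapply is_derive_eq; [exact (m _ _ _ _ _ h2 l2)|].
    rewrite <- qopp_real.
    transitivity (half * (I * d z - I * d (Cconj z)) +
      J * (half * (- (I * (I * d (Cconj z))) - I * (I * d z))))%quat; [non_commutative_ring|].
    rewrite !imag_unit_mul by exact HI.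
    transitivity (J * (half * (d z + d (Cconj z))) +
      J * (J * (half * (I * (d (Cconj z) + - d z)))))%quat; [|non_commutative_ring].
    rewrite imag_unit_mul by exact HJ. non_commutative_ring.
  - assert (k : continuous (fun w => d (Cconj w)) z).
    { apply (continuous_comp Cconj d); [apply continuous_Cconj|exact k3]. }
    assert (cm : forall (c : quat) (f : C -> quat), continuous f z -> continuous (fun w => (c * f w)%quat) z).
    { intros c f Hf. apply continuous_qmul; [apply continuous_const|exact Hf]. }
    apply continuous_qadd.
    + apply cm, continuous_qadd; assumption.
    + apply cm, cm, cm, continuous_qadd; [assumption|]. now apply cm.
Qed.

(** Every slice contains the real points, so the identity principle applies to each slice with the
    same real interval. *)
Lemma regular_sub_identity (Om : quat -> Prop) (f g : quat -> quat) (t eps : R) :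
  sliced_domain Om -> regular Om f -> regular Om g -> Om (qreal t) -> 0 < eps ->
  (forall u, Rabs (u - t) < eps -> Om (qreal u) -> f (qreal u) = g (qreal u)) ->
  forall q, Om q -> f q = g q.
Proof.
  intros (HS & _ & HD) Hf Hg Ht Heps H q Hq.
  destruct (emb_polar q) as (J & z & HJ & -> & _). destruct (HD J HJ) as [HO HC].
  apply qsub_eq_0.
  apply (identity_principle J (slice Om J) (fun z => f (emb J z) - g (emb J z))%quat t eps HJ HO HC).
  - unfold qsub.
    apply holomorphic_add; [exact HJ|now apply Hf|].
    apply (holomorphic_ext _ J (fun z => (g (emb J z) * qreal (-1))%quat)); [exact HJ|exact HO| |].
    + intros w _. now rewrite qopp_real, qreal_comm.
    + apply holomorphic_mul_r; [exact HJ|exact HO|now apply Hg].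
  - unfold slice. now rewrite emb_real.
  - exact Heps.
  - intros u Hu Eu. unfold slice in Eu. rewrite emb_real in *. rewrite (H u Hu Eu).
    non_commutative_ring.
  - exact Hq.
Qed.

Lemma regular_eq_slice (Om : quat -> Prop) (I : quat) (f g : quat -> quat) :
  sliced_domain Om -> regular Om f -> regular Om g -> imag_unit I ->
  (forall z, slice Om I z -> f (emb I z) = g (emb I z)) ->
  forall q, Om q -> f q = g q.
Proof.
  intros HG Hf Hg HI H. destruct (proj1 (proj2 HG)) as [t Ht].
  apply (regular_sub_identity Om f g t 1 HG Hf Hg Ht Rlt_0_1).
  intros u _ Hu. rewrite <- (emb_real I). apply H. unfold slice. now rewrite emb_real.
Qed.

(** The right side is the value of [slice_ext] at that point: a regular function which agrees with
    [f] on the slice of [I]. *)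
Lemma representation_formula (Om : quat -> Prop) (I J : quat) (f : quat -> quat) (z : C) :
  sliced_domain Om -> regular Om f -> imag_unit I -> imag_unit J -> slice Om J z ->
  f (emb J z) = (stem_re (fun w => f (emb I w)) z + J * stem_im I (fun w => f (emb I w)) z)%quat.
Proof.
  intros HG Hf HI HJ Hz. rewrite <- (slice_ext_emb I J) by exact HJ.
  apply (regular_eq_slice Om I f _ HG Hf); [|exact HI| |exact Hz].
  - destruct HG as (HS & _ & HD). apply slice_ext_regular; [exact HS| |exact HI|now apply Hf].
    intros K HK. apply (HD K HK).
  - intros w _. now rewrite slice_ext_same.
Qed.

(** * Splittings, the star-product and the regular conjugate on one slice *)

Lemma ext_spec (Om : quat -> Prop) (I : quat) (phi : C -> quat) (h : quat -> quat) :
  regular Om h -> (forall z, slice Om I z -> h (emb I z) = phi z) ->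
  regular Om (ext Om I phi) /\ forall z, slice Om I z -> ext Om I phi (emb I z) = phi z.
Proof.
  intros H1 H2. unfold ext. apply epsilon_spec. exists h. now split.
Qed.

(** With (c, c') = (-I, I) this is the projection to the values commuting with [I]; with (I, I), to
    those anticommuting with it. *)
Lemma holomorphic_two_sided (E : C -> Prop) (I c c' : quat) (phi : C -> quat) :
  imag_unit I -> open E -> (I * c = c * I)%quat -> holomorphic_on E I phi ->
  holomorphic_on E I (fun z => (half * (phi z + c * phi z * c'))%quat).
Proof.
  intros HI HE Hc H.
  apply holomorphic_mul; [exact HI|exact HE|intros; apply half_comm|now apply holomorphic_const|].
  apply holomorphic_add; [exact HI|exact H|].
  apply holomorphic_mul_r; [exact HI|exact HE|].
  apply holomorphic_mul; [exact HI|exact HE|now intros|now apply holomorphic_const|exact H].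
Qed.

(** [P] is the part of [f] commuting with [I]. The anticommuting part, multiplied on the right by
    [- J], the inverse of [J], commutes with [I] as well and gives [N]. Both then have coordinates
    in the line of [I]. *)
Lemma splits_exists (Om : quat -> Prop) (I J : quat) (f : quat -> quat) :
  imag_unit I -> imag_unit J -> qdot I J = 0 -> open (slice Om I) -> regular Om f ->
  exists F G, splits Om I J f F G.
Proof.
  intros HI HJ Ho HO Hf.
  set (P := fun z => (half * (f (emb I z) + (- I) * f (emb I z) * I))%quat).
  set (N := fun z => (half * (f (emb I z) + I * f (emb I z) * I) * (- J))%quat).
  assert (cP : forall z, (I * P z = P z * I)%quat).
  { intros z. unfold P. generalize (f (emb I z)). intros q.
    transitivity (half * (I * q + - (I * (I * q)) * I))%quat.
    { rewrite qmulA, half_comm. non_commutative_ring. }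
    transitivity (half * (q * I + - (I * q * (I * I))))%quat; [|non_commutative_ring].
    rewrite HI, imag_unit_mul, qreal_comm by exact HI. rewrite <- qopp_real. non_commutative_ring. }
  assert (cN : forall z, (I * N z = N z * I)%quat).
  { intros z. unfold N. generalize (f (emb I z)). intros q.
    assert (e := orthogonal_anticommute I J HI HJ Ho).
    transitivity (half * (I * q + (I * (I * q)) * I) * (- J))%quat.
    { rewrite !qmulA, half_comm. non_commutative_ring. }
    transitivity (half * (q + I * q * I) * (- (J * I)))%quat; [|non_commutative_ring].
    rewrite e.
    transitivity (half * (q * I + I * q * (I * I)) * J)%quat; [|non_commutative_ring].
    rewrite HI, imag_unit_mul, qreal_comm by exact HI. rewrite <- qopp_real. non_commutative_ring. }
  exists (fun z => (qre (P z), qdot (P z) I)), (fun z => (qre (N z), qdot (N z) I)).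
  split; [|split].
  - apply (holomorphic_ext _ I P _ HI HO); [intros z _; apply commute_emb; auto|].
    apply holomorphic_two_sided; [exact HI|exact HO|non_commutative_ring|now apply Hf].
  - apply (holomorphic_ext _ I N _ HI HO); [intros z _; apply commute_emb; auto|].
    apply holomorphic_mul_r; [exact HI|exact HO|].
    apply holomorphic_two_sided; [exact HI|exact HO|reflexivity|now apply Hf].
  - intros z _. rewrite <- !commute_emb by auto. unfold P, N.
    generalize (f (emb I z)). intros q.
    transitivity (half * (q + - I * q * I) + - (half * (q + I * q * I) * (J * J)))%quat;
      [|non_commutative_ring].
    rewrite HJ, qreal_comm, <- qopp_real. rewrite <- (half_half q) at 1. non_commutative_ring.
Qed.

(** The left side multiplies stems as if the unit were central. Moving [I] past [J] reverses its
    sign, so the [G] part of f meets ga - I de, the value of g at the conjugate point. This explains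
    the conjugates in the definition of the star-product. *)
Lemma star_algebra (I J al be ga de F G H K Hc Kc : quat) :
  imag_unit I -> imag_unit J -> (J * I = - (I * J))%quat ->
  (I * F = F * I)%quat -> (I * G = G * I)%quat ->
  (al + I * be = F + G * J)%quat -> (ga + I * de = H + K * J)%quat ->
  (ga - I * de = Hc + Kc * J)%quat ->
  (al * ga - be * de + I * (al * de + be * ga)
   = F * (H + K * J) + G * J * (Hc + Kc * J))%quat.
Proof.
  intros HI HJ e cF cG e1 e2 e3. rewrite <- e2, <- e3.
  transitivity ((al + I * be) * ga + I * (al + I * be) * de)%quat.
  - transitivity ((al + I * be) * ga + I * al * de + I * (I * (be * de)))%quat; [|non_commutative_ring].
    rewrite imag_unit_mul by exact HI. non_commutative_ring.
  - rewrite e1.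
    transitivity ((F + G * J) * ga + (F * I) * de + - (G * (J * I)) * de)%quat; [|non_commutative_ring].
    rewrite e, <- cF. transitivity ((F + G * J) * ga + I * F * de + (G * I) * J * de)%quat; [|non_commutative_ring].
    rewrite <- cG. non_commutative_ring.
Qed.

(** The same stem product is the pointwise product when the left stem commutes with [I]; together
    with [star_algebra] this links the two products. *)
Lemma star_stem (I al be ga de : quat) : imag_unit I -> 
  (I * al = al * I)%quat -> (I * be = be * I)%quat ->
  ((al + I * be) * (ga + I * de) = (al * ga - be * de) + I * (al * de + be * ga))%quat.
Proof.
  intros HI ca cb.
  transitivity (al * ga + I * be * ga + (al * I) * de + I * (be * I) * de)%quat; [non_commutative_ring|].
  rewrite <- ca, <- cb.
  transitivity (al * ga + I * be * ga + I * al * de + (I * (I * (be * de))))%quat; [non_commutative_ring|].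
  rewrite imag_unit_mul by exact HI. non_commutative_ring.
Qed.

Lemma stem_commute (I : quat) (phi : C -> quat) (z : C) : imag_unit I ->
  (I * phi z = phi z * I)%quat -> (I * phi (Cconj z) = phi (Cconj z) * I)%quat ->
  (I * stem_re phi z = stem_re phi z * I)%quat /\
  (I * stem_im I phi z = stem_im I phi z * I)%quat.
Proof.
  intros HI h1 h2. unfold stem_re, stem_im. split.
  - transitivity (half * (I * phi z + I * phi (Cconj z)))%quat.
    + rewrite qmulA, half_comm. non_commutative_ring.
    + rewrite h1, h2. non_commutative_ring.
  - transitivity (half * (I * (I * phi (Cconj z) - I * phi z)))%quat.
    + rewrite qmulA, half_comm. non_commutative_ring.
    + rewrite h1, h2. non_commutative_ring.
Qed.

Lemma stem_of_pair (I a b : quat) (phi : C -> quat) (z : C) : imag_unit I ->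
  phi z = (a + I * b)%quat -> phi (Cconj z) = (a - I * b)%quat ->
  stem_re phi z = a /\ stem_im I phi z = b.
Proof.
  intros HI h1 h2. unfold stem_re, stem_im. rewrite h1, h2. split.
  - rewrite <- (half_half a) at 3. non_commutative_ring.
  - rewrite <- (half_half b).
    transitivity (half * (- (I * (I * (b + b)))))%quat; [|rewrite imag_unit_mul by exact HI].
    + rewrite half_half. non_commutative_ring.
    + non_commutative_ring.
Qed.

(** The candidate [h0] extends the pointwise product on the slice of [I]. The star-product is
    written with an unknown pair I', J', so the two are compared on the slice of I': there both have
    the stem product of f and g, since stems do not depend on the slice. *)
Lemma star_slice (Om : quat -> Prop) (I : quat) (f g : quat -> quat) :
  sliced_domain Om -> regular Om f -> regular Om g -> imag_unit I ->
  (forall z, slice Om I z -> (I * f (emb I z) = f (emb I z) * I)%quat) ->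
  regular Om (star Om f g) /\
  forall z, slice Om I z -> star Om f g (emb I z) = (f (emb I z) * g (emb I z))%quat.
Proof.
  intros HG Hf Hg HI Hc. assert (HG' := HG). destruct HG' as (HS & [t0 Ht0] & HD).
  set (chi := fun z => (f (emb I z) * g (emb I z))%quat).
  set (h0 := slice_ext I chi).
  assert (R0 : regular Om h0).
  { apply slice_ext_regular; [exact HS|intros J HJ; apply (HD J HJ)|exact HI|].
    apply holomorphic_mul; [exact HI|apply (HD I HI)|exact Hc|now apply Hf|now apply Hg]. }
  assert (S : exists (I J : quat) (F G H K : C -> C),
       imag_unit I /\ imag_unit J /\ qdot I J = 0 /\
       splits Om I J f F G /\ splits Om I J g H K /\
       star Om f g = ext Om I (fun z =>
             (emb I (Cminus (Cmult (F z) (H z))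
                            (Cmult (G z) (Cconj (K (Cconj z)))))
              + emb I (Cplus (Cmult (F z) (K z))
                             (Cmult (G z) (Cconj (H (Cconj z))))) * J)%quat)).
  { unfold star. apply epsilon_spec.
    destruct (orthogonal_exists I HI) as (J & HJ & Ho).
    destruct (splits_exists Om I J f HI HJ Ho (proj1 (HD I HI)) Hf) as (F & G & HFG).
    destruct (splits_exists Om I J g HI HJ Ho (proj1 (HD I HI)) Hg) as (H & K & HHK).
    eexists. exists I, J, F, G, H, K. auto 10. }
  destruct S as (I' & J' & F & G & H & K & HI' & HJ' & Ho & (_ & _ & Sf) & (_ & _ & Sg) & ->).
  assert (e := orthogonal_anticommute I' J' HI' HJ' Ho).
  assert (X := ext_spec Om I' (fun z =>
             (emb I' (Cminus (Cmult (F z) (H z))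
                            (Cmult (G z) (Cconj (K (Cconj z)))))
              + emb I' (Cplus (Cmult (F z) (K z))
                             (Cmult (G z) (Cconj (H (Cconj z))))) * J')%quat) h0 R0).
  (* [Y] says that [h0] realizes the chosen formula on the slice of I'. It is what lets [ext] be
     used at all, and it also identifies [ext] with [h0]. *)
  match type of X with ?P -> _ => assert (Y : P) end.
  { intros z Hz. unfold h0. rewrite slice_ext_emb by exact HI'.
    assert (Hz1 := slice_change Om I' I z HS HI' HI Hz).
    assert (Hz2 := slice_conj Om I z HS HI Hz1).
    assert (Hz3 := slice_conj Om I' z HS HI' Hz).
    set (phi := fun w => f (emb I w)). set (psi := fun w => g (emb I w)).
    destruct (stem_commute I phi z HI (Hc z Hz1) (Hc _ Hz2)) as [ca cb].
    destruct (stem_of_pair I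
      (stem_re phi z * stem_re psi z - stem_im I phi z * stem_im I psi z)%quat
      (stem_re phi z * stem_im I psi z + stem_im I phi z * stem_re psi z)%quat chi z HI) as [-> ->].
    - unfold chi. change (f (emb I z)) with (phi z). change (g (emb I z)) with (psi z).
      rewrite (stem_unit I phi z HI), (stem_unit I psi z HI). now apply star_stem.
    - unfold chi. change (f (emb I (Cconj z))) with (phi (Cconj z)).
      change (g (emb I (Cconj z))) with (psi (Cconj z)).
      rewrite (stem_unit_conj I phi z HI), (stem_unit_conj I psi z HI).
      generalize (star_stem I (stem_re phi z) (- stem_im I phi z)%quat (stem_re psi z) (- stem_im I psi z)%quat HI ca).
      intros Q. transitivity ((stem_re phi z + I * - stem_im I phi z) * (stem_re psi z + I * - stem_im I psi z))%quat;
        [non_commutative_ring|]. rewrite Q.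
      + non_commutative_ring.
      + transitivity (- (I * stem_im I phi z))%quat; [non_commutative_ring|].
        rewrite cb. non_commutative_ring.
    - rewrite (star_algebra I' J' _ _ _ _ (emb I' (F z)) (emb I' (G z)) (emb I' (H z)) (emb I' (K z))
         (emb I' (H (Cconj z))) (emb I' (K (Cconj z)))); try assumption; try apply emb_comm.
      + rewrite emb_minus, emb_plus, !emb_mult by exact HI'.
        transitivity (emb I' (F z) * emb I' (H z) + emb I' (F z) * emb I' (K z) * J' +
          emb I' (G z) * (J' * emb I' (H (Cconj z))) + emb I' (G z) * (J' * emb I' (K (Cconj z))) * J')%quat;
          [non_commutative_ring|].
        rewrite !(anticommute_emb I' J') by exact e.
        transitivity (emb I' (F z) * emb I' (H z) + emb I' (F z) * emb I' (K z) * J' +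
          emb I' (G z) * emb I' (Cconj (H (Cconj z))) * J' +
          emb I' (G z) * emb I' (Cconj (K (Cconj z))) * (J' * J'))%quat; [non_commutative_ring|].
        rewrite HJ', qreal_comm, <- qopp_real. non_commutative_ring.
      + rewrite <- (Sf z Hz). symmetry. now apply (representation_formula Om).
      + rewrite <- (Sg z Hz). symmetry. now apply (representation_formula Om).
      + rewrite <- (Sg _ Hz3). rewrite (representation_formula Om I I' g (Cconj z) HG Hg HI HI' Hz3).
        fold psi. rewrite stem_re_conj, stem_im_conj. non_commutative_ring. }
  destruct (X Y) as [X1 X2]. split; [exact X1|].
  intros z Hz. fold (chi z).
  rewrite <- (slice_ext_same I chi z HI). fold h0.
  apply (regular_eq_slice Om I' _ h0 HG X1 R0 HI'); [|exact Hz].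
  intros w Hw. rewrite (X2 w Hw). symmetry. now apply Y.
Qed.

Lemma reg_conj_algebra (I J aF aG bF bG : quat) :
  imag_unit I -> imag_unit J -> (J * I = - (I * J))%quat ->
  (I * aF = aF * I)%quat -> (I * aG = aG * I)%quat ->
  (I * bF = bF * I)%quat -> (I * bG = bG * I)%quat ->
  (half * (aF - aG * J + (bF - bG * J)) + I * (half * ((bF - bG * J) - (aF - aG * J)) * - I)
   = bF - aG * J)%quat.
Proof.
  intros HI HJ e c1 c2 c3 c4.
  transitivity (half * (aF - aG * J + (bF - bG * J)
    + ((I * aF) * I - (I * aG) * (J * I) - (I * bF) * I + (I * bG) * (J * I))))%quat.
  { transitivity (half * (aF - aG * J + (bF - bG * J))
      + (I * half) * (bF - bG * J - (aF - aG * J)) * - I)%quat; [non_commutative_ring|].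
    rewrite half_comm. non_commutative_ring. }
  rewrite e, c1, c2, c3, c4.
  transitivity (half * (aF - aG * J + (bF - bG * J)
    + (aF * (I * I) + aG * (I * I) * J - bF * (I * I) - bG * (I * I) * J)))%quat; [non_commutative_ring|].
  rewrite HI, !qreal_comm, <- !qopp_real. rewrite <- (half_half (bF - aG * J)%quat). non_commutative_ring.
Qed.

Lemma qconj_half (q : quat) : qconj (half * q)%quat = (half * qconj q)%quat.
Proof. destruct q as [[[? ?] ?] ?]. apply quat_eq; ring. Qed.

Lemma qconj_sub (a b : quat) : qconj (a - b)%quat = (qconj a - qconj b)%quat.
Proof. destruct a as [[[? ?] ?] ?], b as [[[? ?] ?] ?]. apply quat_eq; ring. Qed.

(** Regular conjugation conjugates both stem components. When these commute with [I], the resulting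
    function on the slice of [I] is the conjugate of [f] at the conjugate point. *)
Lemma reg_conj_slice (Om : quat -> Prop) (I : quat) (f : quat -> quat) :
  sliced_domain Om -> regular Om f -> imag_unit I ->
  (forall z, slice Om I z -> (I * f (emb I z) = f (emb I z) * I)%quat) ->
  holomorphic_on (slice Om I) I (fun z => qconj (f (emb I (Cconj z)))) ->
  regular Om (reg_conj Om f) /\
  forall z, slice Om I z -> reg_conj Om f (emb I z) = qconj (f (emb I (Cconj z))).
Proof.
  intros HG Hf HI Hc Hh. assert (HG' := HG). destruct HG' as (HS & [t0 Ht0] & HD).
  set (chi := fun z => qconj (f (emb I (Cconj z)))) in *.
  set (h0 := slice_ext I chi).
  assert (R0 : regular Om h0).
  { apply slice_ext_regular; [exact HS|intros J HJ; apply (HD J HJ)|exact HI|exact Hh]. }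
  assert (S : exists (I J : quat) (F G : C -> C),
       imag_unit I /\ imag_unit J /\ qdot I J = 0 /\
       splits Om I J f F G /\
       reg_conj Om f = ext Om I (fun z =>
             (emb I (Cconj (F (Cconj z))) - emb I (G z) * J)%quat)).
  { unfold reg_conj. apply epsilon_spec.
    destruct (orthogonal_exists I HI) as (J & HJ & Ho).
    destruct (splits_exists Om I J f HI HJ Ho (proj1 (HD I HI)) Hf) as (F & G & HFG).
    eexists. exists I, J, F, G. auto 10. }
  destruct S as (I' & J' & F & G & HI' & HJ' & Ho & (_ & _ & Sf) & ->).
  assert (e := orthogonal_anticommute I' J' HI' HJ' Ho).
  assert (X := ext_spec Om I' (fun z => (emb I' (Cconj (F (Cconj z))) - emb I' (G z) * J')%quat) h0 R0).
  match type of X with ?P -> _ => assert (Y : P) end.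
  { intros z Hz. unfold h0. rewrite slice_ext_emb by exact HI'.
    assert (Hz1 := slice_change Om I' I z HS HI' HI Hz).
    assert (Hz2 := slice_conj Om I z HS HI Hz1).
    assert (Hz3 := slice_conj Om I' z HS HI' Hz).
    set (phi := fun w => f (emb I w)).
    destruct (stem_commute I phi z HI (Hc z Hz1) (Hc _ Hz2)) as [ca cb].
    assert (cb' : (I * qconj (stem_im I phi z) = qconj (stem_im I phi z) * I)%quat).
    { apply (f_equal qconj) in cb. rewrite !qconj_mul, (qconj_unit I HI) in cb.
      transitivity (- (- I * qconj (stem_im I phi z)))%quat; [non_commutative_ring|].
      rewrite <- cb. non_commutative_ring. }
    destruct (stem_of_pair I (qconj (stem_re phi z)) (qconj (stem_im I phi z)) chi z HI) as [-> ->].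
    - unfold chi. change (f (emb I (Cconj z))) with (phi (Cconj z)).
      rewrite (stem_unit_conj I phi z HI), qconj_sub, qconj_mul, (qconj_unit I HI).
      rewrite cb'. non_commutative_ring.
    - unfold chi. rewrite Cconj_conj. change (f (emb I z)) with (phi z).
      rewrite (stem_unit I phi z HI), qconj_add, qconj_mul, (qconj_unit I HI).
      rewrite cb'. non_commutative_ring.
    - set (A := f (emb I' z)). set (B := f (emb I' (Cconj z))).
      (* The splitting is known only on the slice of I', so alpha and beta are now recovered from
         the two values [A] and [B] on that slice. *)
      assert (EA : A = (stem_re phi z + I' * stem_im I phi z)%quat)
        by now apply (representation_formula Om).
      assert (EB : B = (stem_re phi z - I' * stem_im I phi z)%quat).
      { unfold B. rewrite (representation_formula Om I I' f (Cconj z) HG Hf HI HI' Hz3).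
        fold phi. rewrite stem_re_conj, stem_im_conj. non_commutative_ring. }
      assert (Ea : stem_re phi z = (half * (A + B))%quat).
      { rewrite EA, EB. rewrite <- (half_half (stem_re phi z)) at 1. non_commutative_ring. }
      assert (Eb : stem_im I phi z = (I' * (half * (B - A)))%quat).
      { rewrite EA, EB.
        transitivity (- (I' * (I' * stem_im I phi z)))%quat.
        - rewrite imag_unit_mul by exact HI'. non_commutative_ring.
        - rewrite <- (half_half (stem_im I phi z)) at 1.
          generalize (stem_im I phi z), (stem_re phi z). intros b' a'.
          transitivity (- (I' * (I' * half) * (b' + b')))%quat; [non_commutative_ring|].
          rewrite half_comm. non_commutative_ring. }
      rewrite Ea, Eb, (qconj_mul I'), !qconj_half, qconj_sub, qconj_add, (qconj_unit I' HI').
      assert (CA : qconj A = (emb I' (Cconj (F z)) - emb I' (G z) * J')%quat).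
      { unfold A. rewrite (Sf z Hz), qconj_add, qconj_mul, !qconj_emb, (qconj_unit J' HJ') by exact HI'.
        transitivity (emb I' (Cconj (F z)) - J' * emb I' (Cconj (G z)))%quat; [non_commutative_ring|].
        now rewrite (anticommute_emb I' J' _ e), Cconj_conj. }
      assert (CB : qconj B = (emb I' (Cconj (F (Cconj z))) - emb I' (G (Cconj z)) * J')%quat).
      { unfold B. rewrite (Sf _ Hz3), qconj_add, qconj_mul, !qconj_emb, (qconj_unit J' HJ') by exact HI'.
        transitivity (emb I' (Cconj (F (Cconj z))) - J' * emb I' (Cconj (G (Cconj z))))%quat; [non_commutative_ring|].
        now rewrite (anticommute_emb I' J' _ e), Cconj_conj. }
      rewrite CA, CB. apply reg_conj_algebra; try assumption; apply emb_comm. }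
  destruct (X Y) as [X1 X2]. split; [exact X1|].
  intros z Hz. fold (chi z).
  rewrite <- (slice_ext_same I chi z HI). fold h0.
  apply (regular_eq_slice Om I' _ h0 HG X1 R0 HI'); [|exact Hz].
  intros w Hw. rewrite (X2 w Hw). symmetry. now apply Y.
Qed.

(** * Power series across the centre *)

Lemma qabs_add (a b : quat) : qabs (a + b)%quat <= qabs a + qabs b.
Proof.
  apply Rsqr_incr_0; [|apply qabs_nonneg|generalize (qabs_nonneg a), (qabs_nonneg b); lra].
  unfold Rsqr. rewrite qabs_sqr.
  replace (qdot (a + b)%quat (a + b)%quat) with (qdot a a + 2 * qdot a b + qdot b b)
    by (destruct a as [[[? ?] ?] ?], b as [[[? ?] ?] ?]; cbn; ring).
  rewrite <- !qabs_sqr. generalize (qdot_le a b). unfold Rabs; destruct Rcase_abs; lra.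
Qed.

Lemma qabs_real (t : R) : qabs (qreal t) = Rabs t.
Proof.
  rewrite <- sqrt_Rsqr_abs. unfold qabs. f_equal. unfold qreal, Rsqr; cbn. ring.
Qed.

Lemma qdot_sub_r (e a b : quat) : qdot e (a - b)%quat = qdot e a - qdot e b.
Proof. destruct e as [[[? ?] ?] ?], a as [[[? ?] ?] ?], b as [[[? ?] ?] ?]; cbn; ring. Qed.

Lemma qdot_real_mul (e a : quat) (t : R) : qdot e (qreal t * a)%quat = t * qdot e a.
Proof. destruct e as [[[? ?] ?] ?], a as [[[? ?] ?] ?]; cbn; ring. Qed.

Lemma is_derive_quadratic (k : R -> quat) (t M delta : R) (d : quat) :
  0 < delta ->
  (forall h, Rabs h < delta -> qabs (k (t + h)%R - k t - qreal h * d)%quat <= M * (h * h)) ->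
  is_derive k t d.
Proof.
  intros Hd H. apply is_derive_qdot_iff. intros e. apply is_derive_Reals. intros eps Heps.
  assert (M0 : 0 <= M).
  { assert (h2 : Rabs (delta / 2) < delta) by (rewrite Rabs_pos_eq; lra).
    specialize (H (delta / 2) h2).
    apply (Rmult_le_reg_r (delta / 2 * (delta / 2))); [nra|].
    rewrite Rmult_0_l. eapply Rle_trans; [|exact H]. apply qabs_nonneg. }
  set (L := qabs e * M + 1). assert (L0 : 0 < L).
  { unfold L. generalize (Rmult_le_pos _ _ (qabs_nonneg e) M0). lra. }
  assert (D0 : 0 < Rmin delta (eps / L)).
  { apply Rmin_glb_lt; [exact Hd|]. now apply Rdiv_lt_0_compat. }
  exists (mkposreal _ D0). cbn. intros h h0 hh.
  assert (hd : Rabs h < delta) by (eapply Rlt_le_trans; [exact hh|apply Rmin_l]).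
  assert (he : Rabs h < eps / L) by (eapply Rlt_le_trans; [exact hh|apply Rmin_r]).
  specialize (H h hd). assert (A0 := Rabs_pos_lt h h0).
  assert (B : Rabs (qdot e (k (t + h)%R - k t - qreal h * d)%quat) <= qabs e * M * (h * h)).
  { eapply Rle_trans; [apply qdot_le|]. rewrite Rmult_assoc.
    apply Rmult_le_compat_l; [apply qabs_nonneg|exact H]. }
  rewrite !qdot_sub_r, qdot_real_mul in B.
  replace ((qdot e (k (t + h)) - qdot e (k t)) / h - qdot e d)
    with ((qdot e (k (t + h)) - qdot e (k t) - h * qdot e d) / h) by (field; exact h0).
  unfold Rdiv. rewrite Rabs_mult, Rabs_inv.
  replace (h * h) with (Rabs h * Rabs h) in B by (rewrite <- Rabs_mult; apply Rabs_pos_eq; nra).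
  apply (Rmult_lt_reg_r (Rabs h)); [exact A0|]. rewrite Rmult_assoc, Rinv_l, Rmult_1_r by lra.
  eapply Rle_lt_trans; [exact B|]. rewrite <- Rmult_assoc. apply Rmult_lt_compat_r; [exact A0|].
  apply Rle_lt_trans with (L * Rabs h); [unfold L; nra|].
  apply (Rmult_lt_compat_l L) in he; [|exact L0].
  replace (L * (eps / L)) with eps in he by (field; lra). exact he.
Qed.

(** Test with [d] itself: the difference quotients tend to |d|^2 and are bounded by |d| L. *)
Lemma is_derive_lipschitz (k : R -> quat) (t L : R) (d : quat) :
  0 <= L -> is_derive k t d ->
  locally t (fun s => qabs (k s - k t)%quat <= L * Rabs (s - t)) -> qabs d <= L.
Proof.
  intros HL H [delta Hloc].
  destruct (Rle_lt_dec (qabs d) L) as [h|h]; [exact h|exfalso].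
  assert (K := is_derive_qdot d k t d H). apply is_derive_Reals in K.
  assert (d0 : 0 < qabs d) by lra.
  destruct (K (qabs d * (qabs d - L))) as [eps Heps]; [apply Rmult_lt_0_compat; lra|].
  set (s := Rmin eps delta / 2).
  assert (hs : 0 < Rmin eps delta) by (apply Rmin_glb_lt; apply cond_pos).
  assert (s0 : 0 < s) by (unfold s; lra).
  assert (s1 : s < eps) by (generalize (Rmin_l eps delta); unfold s; lra).
  assert (s2 : s < delta) by (generalize (Rmin_r eps delta); unfold s; lra).
  specialize (Heps s). rewrite (Rabs_pos_eq s) in Heps by lra.
  specialize (Heps ltac:(lra) s1).
  specialize (Hloc (t + s)). replace (t + s - t) with s in Hloc by ring.
  rewrite (Rabs_pos_eq s) in Hloc by lra.
  assert (B : ball t delta (t + s)).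
  { unfold ball; cbn; unfold AbsRing_ball, abs, minus, plus, opp; cbn.
    replace (t + s + - t) with s by ring. rewrite Rabs_pos_eq; lra. }
  specialize (Hloc B).
  assert (Q := qdot_le d (k (t + s)%R - k t)%quat). rewrite qdot_sub_r in Q.
  assert (Q2 : Rabs (qdot d (k (t + s)) - qdot d (k t)) <= qabs d * L * s).
  { eapply Rle_trans; [exact Q|]. rewrite Rmult_assoc. apply Rmult_le_compat_l; lra. }
  set (X := qdot d (k (t + s)) - qdot d (k t)) in *.
  rewrite <- qabs_sqr in Heps.
  assert (X / s <= qabs d * L).
  { apply (Rmult_le_reg_r s); [exact s0|]. unfold Rdiv. rewrite Rmult_assoc, Rinv_l by lra.
    generalize (Rle_abs X). lra. }
  revert Heps. unfold Rabs. destruct Rcase_abs; nra.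
Qed.

Lemma Cpow_sub_le (x y : C) (rho : R) (k : nat) :
  Cmod x <= rho -> Cmod y <= rho ->
  Cmod (Cminus (Cpow x (S k)) (Cpow y (S k))) <= INR (S k) * rho ^ k * Cmod (Cminus x y).
Proof.
  intros Hx Hy. assert (r0 : 0 <= rho) by (eapply Rle_trans; [apply Cmod_ge_0|exact Hx]).
  induction k as [|k IH].
  - cbn. rewrite !Cmult_1_r. lra.
  - replace (Cminus (Cpow x (S (S k))) (Cpow y (S (S k)))) with
      (Cplus (Cmult x (Cminus (Cpow x (S k)) (Cpow y (S k)))) (Cmult (Cminus x y) (Cpow y (S k))))
      by (cbn [Cpow]; ring).
    eapply Rle_trans; [apply Cmod_triangle|]. rewrite !Cmod_mult, Cmod_pow.
    assert (A : Cmod x * Cmod (Cminus (Cpow x (S k)) (Cpow y (S k))) <=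
      rho * (INR (S k) * rho ^ k * Cmod (Cminus x y))).
    { apply Rmult_le_compat; [apply Cmod_ge_0|apply Cmod_ge_0|exact Hx|exact IH]. }
    assert (B : Cmod (Cminus x y) * Cmod y ^ S k <= Cmod (Cminus x y) * rho ^ S k).
    { apply Rmult_le_compat_l; [apply Cmod_ge_0|]. apply pow_incr. split; [apply Cmod_ge_0|exact Hy]. }
    rewrite (S_INR (S k)). cbn [pow] in *. lra.
Qed.

Lemma continuous_qabs_sub (c q : quat) : continuous (fun p => qabs (p - c)%quat) q.
Proof.
  unfold qabs. apply (continuous_comp (fun p => qdot (p - c)%quat (p - c)%quat) sqrt); [|apply continuous_sqrt].
  assert (H : continuous (fun p => (p - c)%quat) q).
  { apply continuous_qadd; [apply continuous_id|apply continuous_const]. }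
  apply (continuous_ext (fun p => q0 (p - c)%quat * q0 (p - c)%quat + q1 (p - c)%quat * q1 (p - c)%quat
    + q2 (p - c)%quat * q2 (p - c)%quat + q3 (p - c)%quat * q3 (p - c)%quat)).
  { intros p. now rewrite qdot_q. }
  destruct (proj1 (continuous_quat (fun p => (p - c)%quat) q) H) as (h0 & h1 & h2 & h3).
  cont_poly; assumption.
Qed.

Lemma qsub_minus (a b : quat) : (a - b)%quat = minus a b.
Proof. unfold qsub, minus. now rewrite qadd_plus, qopp_opp. Qed.

(** Only partial sums through index 1 or later are asked for: in the application [c] is the linear
    term, which must already be present for the estimate to hold. *)
Lemma is_series_bound (u : nat -> quat) (l c : quat) (B : R) :
  is_series u l -> (forall N, qabs (sum_n u (S N) - c)%quat <= B) -> qabs (l - c)%quat <= B.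
Proof.
  intros H HB.
  assert (K : is_lim_seq (fun N => qabs (sum_n u N - c)%quat) (qabs (l - c)%quat)).
  { apply (filterlim_comp _ _ _ (sum_n u) (fun p => qabs (p - c)%quat) eventually (locally l)).
    - exact H.
    - apply continuous_qabs_sub. }
  apply is_lim_seq_incr_1 in K.
  assert (K2 := is_lim_seq_le _ (fun _ => B) _ _ HB K (is_lim_seq_const B)). exact K2.
Qed.

Lemma is_series_terms_bounded (u : nat -> quat) (l : quat) :
  is_series u l -> exists M, 0 < M /\ forall k, qabs (u k) <= M.
Proof.
  intros H.
  assert (K : is_lim_seq (fun N => qabs (sum_n u N - l)%quat) 0).
  { replace 0 with (qabs (l - l)%quat).
    - apply (filterlim_comp _ _ _ (sum_n u) (fun p => qabs (p - l)%quat) eventually (locally l)).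
      + exact H.
      + apply continuous_qabs_sub.
    - replace (l - l)%quat with (qreal 0) by non_commutative_ring. rewrite qabs_real. apply Rabs_R0. }
  apply is_lim_seq_Reals in K. destruct (K 1 Rlt_0_1) as [N HN].
  (* Beyond [N] a term is the difference of two partial sums within 1 of the limit, hence at most 2;
     the summand 2 covers this case. *)
  set (b := fix b (n : nat) : R := match n with O => qabs (u O) + 2 | S n => b n + qabs (u (S n)) end).
  assert (b2 : forall n, 2 <= b n /\ forall k, (k <= n)%nat -> qabs (u k) <= b n).
  { induction n as [|n [IH1 IH2]].
    - split; [cbn; generalize (qabs_nonneg (u O)); lra|]. intros k hk.
      replace k with O by lia. cbn. lra.
    - split; [cbn; generalize (qabs_nonneg (u (S n))); lra|].
      intros k hk. cbn. destruct (Nat.eq_dec k (S n)) as [->|h].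
      + lra.
      + specialize (IH2 k ltac:(lia)). generalize (qabs_nonneg (u (S n))). lra. }
  exists (b N). split; [generalize (proj1 (b2 N)); lra|].
  intros k. destruct (Nat.le_gt_cases k N) as [h|h]; [now apply b2|].
  destruct k as [|k]; [lia|].
  assert (h1 := HN k ltac:(lia)). assert (h2 := HN (S k) ltac:(lia)).
  unfold R_dist in *. rewrite Rminus_0_r, Rabs_pos_eq in h1, h2 by apply qabs_nonneg.
  replace (u (S k)) with ((sum_n u (S k) - l) + qreal (-1) * (sum_n u k - l))%quat.
  - eapply Rle_trans; [apply qabs_add|]. rewrite qabs_mul, qabs_real.
    replace (Rabs (-1)) with 1 by (rewrite Rabs_left; lra). generalize (proj1 (b2 N)). lra.
  - rewrite sum_Sn, <- qadd_plus, <- qopp_real. non_commutative_ring.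
Qed.

Lemma INR_le_pow2 (k : nat) : INR k <= 2 ^ k.
Proof.
  induction k as [|k IH]; [cbn; lra|]. rewrite S_INR. cbn.
  assert (1 <= 2 ^ k) by (apply pow_R1_Rle; lra). lra.
Qed.

(* The tail of order two is Lipschitz with constant [O(rho)] on the disc of
   radius [rho]; this yields the derivative at the centre and the continuity of
   the derivative there, without differentiating the series term by term. *)
Lemma power_series_tail_lipschitz (I : quat) (w : C) (r : R) (a : nat -> quat) (g : C -> quat) :
  imag_unit I -> 0 < r ->
  (forall z, c_disc w r z -> is_series (fun k => (emb I (Cpow (Cminus z w) k) * a k)%quat) (g z)) ->
  exists M, 0 <= M /\ forall rho u v, rho <= r / 8 ->
    Cmod (Cminus u w) <= rho -> Cmod (Cminus v w) <= rho ->
    qabs (g u - g v - emb I (Cminus u v) * a 1%nat)%quat <= M * rho * Cmod (Cminus u v).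
Proof.
  (* One interior point suffices: the terms of the convergent series at w + r/2 are bounded, which
     bounds |a_k| by M / (r/2)^k. *)
  intros HI Hr H. set (Rr := r / 2).
  assert (Hz1 : c_disc w r (Cplus w (RtoC Rr))).
  { unfold c_disc. replace (Cminus (Cplus w (RtoC Rr)) w) with (RtoC Rr) by ring.
    rewrite Cmod_R, Rabs_pos_eq; unfold Rr; lra. }
  destruct (is_series_terms_bounded _ _ (H _ Hz1)) as (M & M0 & HM).
  assert (R0 : 0 < Rr) by (unfold Rr; lra).
  assert (Ha : forall k, qabs (a k) * Rr ^ k <= M).
  { intros k. specialize (HM k). rewrite qabs_mul, qabs_emb in HM by exact HI.
    replace (Cminus (Cplus w (RtoC Rr)) w) with (RtoC Rr) in HM by ring.
    rewrite Cmod_pow, Cmod_R, Rabs_pos_eq in HM by lra. lra. }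
  (* As rho is at most Rr/4, the factor k <= 2^k of the difference of powers still leaves a
     geometric series of ratio 1/2. The constant 16 is what remains after normalizing the term of
     index k + 2 to (1/2)^(k+2). *)
  set (K := M * 16 / (Rr * Rr)).
  assert (K0 : 0 <= K) by (apply Rmult_le_pos; [lra|]; left; apply Rinv_0_lt_compat; nra).
  exists K. split; [exact K0|].
  intros rho u v Hrho Hu Hv.
  assert (rho0 : 0 <= rho) by (eapply Rle_trans; [apply Cmod_ge_0|exact Hu]).
  assert (Du : c_disc w r u) by (unfold c_disc; lra).
  assert (Dv : c_disc w r v) by (unfold c_disc; lra).
  set (x := Cminus u w) in *. set (y := Cminus v w) in *.
  replace (Cminus u v) with (Cminus x y) by (unfold x, y; ring).
  set (e := Cmod (Cminus x y)). assert (e0 : 0 <= e) by apply Cmod_ge_0.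
  set (t := fun k => minus (emb I (Cpow x k) * a k)%quat (emb I (Cpow y k) * a k)%quat).
  assert (St : is_series t (g u - g v)%quat).
  { rewrite qsub_minus. apply @is_series_minus; [exact (H u Du)|exact (H v Dv)]. }
  assert (Et : forall k, t k = (emb I (Cminus (Cpow x k) (Cpow y k)) * a k)%quat).
  { intros k. unfold t. rewrite <- qsub_minus, emb_minus. non_commutative_ring. }
  assert (Bt : forall k, qabs (t (S (S k))) <= K * rho * e * (/ 2) ^ (S (S k))).
  { intros k. rewrite Et, qabs_mul, qabs_emb by exact HI.
    assert (B1 := Cpow_sub_le x y rho (S k) Hu Hv). fold e in B1.
    assert (B2 : Cmod (Cminus (Cpow x (S (S k))) (Cpow y (S (S k)))) * qabs (a (S (S k)))
      <= (2 ^ (S (S k)) * rho ^ (S k) * e) * (M * / Rr ^ (S (S k)))).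
    { apply Rmult_le_compat; [apply Cmod_ge_0|apply qabs_nonneg| |].
      - eapply Rle_trans; [exact B1|]. apply Rmult_le_compat_r; [exact e0|].
        apply Rmult_le_compat_r; [now apply pow_le|]. apply INR_le_pow2.
      - assert (0 < Rr ^ S (S k)) by now apply pow_lt.
        apply (Rmult_le_reg_r (Rr ^ S (S k))); [assumption|].
        rewrite Rmult_assoc, Rinv_l by lra. rewrite Rmult_1_r. apply Ha. }
    eapply Rle_trans; [exact B2|].
    assert (B3 : rho ^ k <= (Rr / 4) ^ k) by (apply pow_incr; unfold Rr; lra).
    replace (2 ^ S (S k) * rho ^ S k * e * (M * / Rr ^ S (S k)))
      with ((2 ^ S (S k) * rho * e * M / Rr ^ S (S k)) * rho ^ k)
      by (cbn [pow]; field; split; [apply pow_nonzero|]; lra).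
    eapply Rle_trans; [apply Rmult_le_compat_l; [|exact B3]|].
    - apply Rmult_le_pos; [|left; apply Rinv_0_lt_compat; now apply pow_lt].
      repeat apply Rmult_le_pos; try lra. apply pow_le; lra.
    - right. unfold K.
      replace ((Rr / 4) ^ k) with (Rr ^ k * (/ 2) ^ k * (/ 2) ^ k)
        by (rewrite <- !Rpow_mult_distr; f_equal; field).
      rewrite !pow_inv. cbn [pow]. field. split; [|split]; try apply pow_nonzero; lra. }
  clearbody K e.
  assert (HS : forall N, qabs (sum_n t (S N) - emb I (Cminus x y) * a 1%nat)%quat
     <= K * rho * e * (1 - (/ 2) ^ S N)).
  { assert (P0 : 0 <= K * rho * e) by (repeat apply Rmult_le_pos; lra).
    induction N as [|N IH].
    - rewrite sum_Sn, sum_O, <- qadd_plus, !Et. cbn [Cpow].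
      replace (emb I (Cminus (RtoC 1) (RtoC 1))) with (qreal 0) by qcrush.
      rewrite !Cmult_1_r.
      replace (qreal 0 * a 0%nat + emb I (Cminus x y) * a 1%nat - emb I (Cminus x y) * a 1%nat)%quat
        with (qreal 0) by non_commutative_ring.
      rewrite qabs_real, Rabs_R0. cbn. apply Rmult_le_pos; [exact P0|lra].
    - rewrite sum_Sn, <- qadd_plus.
      replace (sum_n t (S N) + t (S (S N)) - emb I (Cminus x y) * a 1%nat)%quat
        with ((sum_n t (S N) - emb I (Cminus x y) * a 1%nat) + t (S (S N)))%quat by non_commutative_ring.
      eapply Rle_trans; [apply qabs_add|]. specialize (Bt N).
      cbn [pow] in *. lra. }
  apply (is_series_bound t _ _ _ St). intros N. eapply Rle_trans; [apply HS|].
  assert (0 <= (/ 2) ^ S N) by (apply pow_le; lra).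
  assert (0 <= K * rho * e) by (repeat apply Rmult_le_pos; lra). nra.
Qed.

Lemma Cmod_x (a b c : R) : Cmod (Cminus (a, c) (b, c)) = Rabs (a - b).
Proof. rewrite <- Cmod_R. f_equal. unfold RtoC, Cminus, Cplus, Copp; cbn; f_equal; ring. Qed.

Lemma Cmod_y (a b c : R) : Cmod (Cminus (c, a) (c, b)) = Rabs (a - b).
Proof.
  replace (Cminus (c, a) (c, b)) with (Cmult Ci (RtoC (a - b))).
  - rewrite Cmod_mult, Cmod_R. replace (Cmod Ci) with 1; [ring|].
    unfold Cmod, Ci; cbn. rewrite <- sqrt_1 at 1. f_equal. ring.
  - unfold Ci, RtoC, Cmult, Cminus, Cplus, Copp; cbn; f_equal; ring.
Qed.

Lemma power_series_holomorphic (I : quat) (w : C) (r : R) (a : nat -> quat) (g : C -> quat) :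
  imag_unit I -> 0 < r ->
  (forall z, c_disc w r z -> is_series (fun k => (emb I (Cpow (Cminus z w) k) * a k)%quat) (g z)) ->
  holomorphic_on (fun z => c_disc w r z /\ z <> w) I g ->
  holomorphic_on (c_disc w (r / 16)) I g.
Proof.
  intros HI Hr Hs (d0 & H)%(holomorphic_c_derive _ _ _ HI).
  destruct (power_series_tail_lipschitz I w r a g HI Hr Hs) as (M & M0 & HM).
  apply (holomorphic_c_derive _ _ _ HI).
  exists (fun z => if excluded_middle_informative (z = w) then a 1%nat else d0 z).
  intros z Hz. destruct (excluded_middle_informative (z = w)) as [->|nz].
  - assert (B : forall h u, Rabs h < r / 16 -> Cmod (Cminus u w) = Rabs h ->
      qabs (g u - g w - emb I (Cminus u w) * a 1%nat)%quat <= M * (h * h)).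
    { intros h u hh hu. replace (h * h) with (Rabs h * Rabs h)
        by (rewrite <- Rabs_mult; apply Rabs_pos_eq; nra).
      rewrite <- Rmult_assoc. rewrite <- hu at 2. apply HM; [lra|lra|].
      replace (Cminus w w) with (RtoC 0) by ring. rewrite Cmod_0. apply Rabs_pos. }
    split; [split|].
    + apply (is_derive_quadratic _ _ M (r / 16)); [lra|]. intros h hh.
      specialize (B h (Re w + h, Im w) hh).
      destruct w as [w1 w2]; cbn [Re Im fst snd] in *. rewrite Cmod_x in B.
      replace (emb I (Cminus (w1 + h, w2) (w1, w2))) with (qreal h) in B by qcrush.
      apply B. f_equal. ring.
    + apply (is_derive_quadratic _ _ M (r / 16)); [lra|]. intros h hh.
      specialize (B h (Re w, Im w + h) hh).
      destruct w as [w1 w2]; cbn [Re Im fst snd] in *. rewrite Cmod_y in B.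
      replace (emb I (Cminus (w1, w2 + h) (w1, w2))) with (qreal h * I)%quat in B by qcrush.
      rewrite qmulA. apply B. f_equal. ring.
    + apply continuous_qdot_iff. intros e. apply filterlim_locally. intros eps.
      set (delta := Rmin (r / 16) (eps / (2 * (qabs e * M + 1)))).
      assert (P : 0 < qabs e * M + 1) by (generalize (Rmult_le_pos _ _ (qabs_nonneg e) M0); lra).
      assert (d1 : 0 < delta).
      { apply Rmin_glb_lt; [lra|]. apply Rdiv_lt_0_compat; [apply cond_pos|lra]. }
      apply (filter_imp (c_disc w delta)); [|apply open_c_disc; now apply c_disc_center].
      intros z hz. unfold c_disc in hz.
      destruct (excluded_middle_informative (w = w)) as [_|n]; [|contradiction].
      destruct (excluded_middle_informative (z = w)) as [_|nz]; [apply ball_center|].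
      assert (z1 : Cmod (Cminus z w) < r / 16) by (eapply Rlt_le_trans; [exact hz|apply Rmin_l]).
      assert (z2 : Cmod (Cminus z w) < eps / (2 * (qabs e * M + 1)))
        by (eapply Rlt_le_trans; [exact hz|apply Rmin_r]).
      assert (z0 : 0 < Cmod (Cminus z w)).
      { apply Cmod_gt_0. intros e'. apply nz. transitivity (Cplus (Cminus z w) w); [ring|rewrite e'; ring]. }
      (* Doubling the distance leaves a neighbourhood of [z] in the disc of radius rho, on which g
         minus its linear part has Lipschitz constant M rho; that bounds the derivative of this
         difference at [z]. The lemma on tails wants rho <= r/8, whence r/16, and the same factor 2
         appears in [delta]. *)
      set (rho := 2 * Cmod (Cminus z w)).
      assert (L : qabs (d0 z - a 1%nat)%quat <= M * rho).
      { assert (Dz : c_disc w r z) by (unfold c_disc; lra).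
        destruct (H z (conj Dz nz)) as [[h1 _] _].
        apply (is_derive_lipschitz (fun t => g (t, Im z) - emb I (Cminus (t, Im z) w) * a 1%nat)%quat (Re z)).
        - apply Rmult_le_pos; [exact M0|unfold rho; lra].
        - unfold qsub. apply is_derive_qadd; [exact h1|]. apply is_derive_qopp.
          eapply is_derive_eq.
          + apply is_derive_qmul; [|apply is_derive_qconst].
            unfold Cminus, Cplus, Copp; cbn [fst snd].
            apply (is_derive_emb I (fun t => t + - fst w) (fun t => Im z + - snd w) _ 1 0).
            * auto_derive; [exact Logic.I|ring].
            * apply @is_derive_const.
          + replace (emb I (1, 0)) with (qreal 1) by qcrush. non_commutative_ring.
        - assert (LB : locally z (fun u => Cmod (Cminus u w) < rho)).
          { apply (open_c_disc w rho). unfold c_disc, rho. lra. }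
          generalize (locally_line_x _ z LB). apply filter_imp. intros s hs.
          rewrite <- (Cmod_x s (Re z) (Im z)).
          match goal with |- qabs ?X <= _ => replace X
            with (g (s, Im z) - g (Re z, Im z) - emb I (Cminus (s, Im z) (Re z, Im z)) * a 1%nat)%quat end.
          + apply HM; [unfold rho; lra|left; exact hs|].
            replace ((Re z, Im z) : C) with z by now destruct z. unfold rho. lra.
          + rewrite !emb_minus. non_commutative_ring. }
      unfold ball; cbn; unfold AbsRing_ball, abs, minus, plus, opp; cbn.
      change (Rabs (qdot e (d0 z) - qdot e (a 1%nat)) < eps). rewrite <- qdot_sub_r.
      eapply Rle_lt_trans; [apply qdot_le|].
      apply Rle_lt_trans with (qabs e * (M * rho)); [apply Rmult_le_compat_l; [apply qabs_nonneg|exact L]|].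
      unfold rho. apply (Rmult_lt_compat_l (2 * (qabs e * M + 1))) in z2; [|lra].
      replace (2 * (qabs e * M + 1) * (eps / (2 * (qabs e * M + 1)))) with (eps : R) in z2 by (field; lra).
      lra.
  - assert (Dz : c_disc w r z) by (unfold c_disc in *; lra).
    destruct (H z (conj Dz nz)) as [h1 h2]. split; [exact h1|].
    refine (continuous_ext_loc _ d0 z _ h2).
    apply (filter_imp (fun u => u <> w)); [|now apply open_C_neq].
    intros u hu. destruct (excluded_middle_informative (u = w)); [contradiction|reflexivity].
Qed.

(** * Powers of [q - p], regular reciprocals and Laurent expansions *)

Lemma slice_whole (I : quat) : domain (slice whole I).
Proof.
  split; [intros z _; exists (mkposreal 1 Rlt_0_1); intros; exact Logic.I|].
  intros V W HV HW Hcov (a & _ & Va) (b & _ & Wb).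
  destruct (segment_split V W a b HV HW Va Wb) as (s & _ & Hs).
  - intros s _. apply Hcov. exact Logic.I.
  - eexists. split; [exact Logic.I|exact Hs].
Qed.

Lemma sliced_domain_whole : sliced_domain whole.
Proof.
  split; [|split].
  - intros x y I _ _ q _. exact Logic.I.
  - exists 0. exact Logic.I.
  - intros I _. apply slice_whole.
Qed.

Lemma regular_sub_const (p : quat) : regular whole (fun q => (q - p)%quat).
Proof.
  intros I HI. apply holomorphic_add; [exact HI| |now apply holomorphic_const].
  apply (holomorphic_ext _ I (fun z => emb I (Cminus z (RtoC 0)))); [exact HI|apply slice_whole| |].
  - intros z _. f_equal. ring.
  - now apply holomorphic_emb_sub.
Qed.

Lemma lin_pow_slice (I : quat) (w : C) (n : nat) : imag_unit I ->
  regular whole (lin_pow (emb I w) n) /\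
  forall z, lin_pow (emb I w) n (emb I z) = emb I (Cpow (Cminus z w) n).
Proof.
  intros HI. induction n as [|n [IH1 IH2]].
  - split; [intros J HJ; exact (holomorphic_const _ J (qreal 1) HJ)|].
    intros z. cbn. qcrush.
  - destruct (star_slice whole I (fun q => (q - emb I w)%quat) (lin_pow (emb I w) n)
      sliced_domain_whole (regular_sub_const _) IH1 HI) as [H1 H2].
    + intros z _. rewrite <- emb_minus. apply emb_comm.
    + split; [exact H1|]. intros z. cbn [Cpow]. rewrite emb_mult, emb_minus, <- IH2 by exact HI.
      apply (H2 z). exact Logic.I.
Qed.

Lemma c_derive_commute (I : quat) (E : C -> Prop) (phi : C -> quat) (z : C) (d : quat) :
  open E -> E z -> (forall w, E w -> (I * phi w = phi w * I)%quat) ->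
  c_derive I phi z d -> (I * d = d * I)%quat.
Proof.
  intros HE Hz Hc [h _].
  apply (is_derive_quat_unique (fun t => (I * phi (t, Im z))%quat) (Re z)).
  - eapply is_derive_eq; [apply (is_derive_qmul _ _ _ _ _ (is_derive_qconst I _) h)|].
    non_commutative_ring.
  - apply (is_derive_ext_loc (fun t => (phi (t, Im z) * I)%quat)).
    + generalize (locally_line_x _ z (HE z Hz)). apply filter_imp. intros t ht.
      symmetry. now apply Hc.
    + eapply is_derive_eq; [apply (is_derive_qmul _ _ _ _ _ h (is_derive_qconst I _))|].
      non_commutative_ring.
Qed.

(** Conjugation reverses products, so the unit would end up on the right of the derivative. For a
    function with values in the line of [I] the derivative commutes with [I], and the unit can
    return to the left. *)
Lemma holomorphic_reflect (E : C -> Prop) (I : quat) (phi : C -> quat) :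
  imag_unit I -> open E -> (forall z, E z -> E (Cconj z)) ->
  (forall w, E w -> (I * phi w = phi w * I)%quat) ->
  holomorphic_on E I phi -> holomorphic_on E I (fun z => qconj (phi (Cconj z))).
Proof.
  intros HI HE HS Hc (d & H)%(holomorphic_c_derive _ _ _ HI).
  apply (holomorphic_c_derive _ _ _ HI). exists (fun z => qconj (d (Cconj z))).
  intros z Hz. destruct (H _ (HS z Hz)) as [h1 h3].
  assert (cd := c_derive_commute I E phi _ _ HE (HS z Hz) Hc h1). destruct h1 as [h1 h2].
  split; [split|].
  - apply (is_derive_qconj (fun t => phi (Cconj (t, Im z)))). exact h1.
  - eapply is_derive_eq.
    + apply (is_derive_qconj (fun t => phi (Cconj (Re z, t)))).
      exact (is_derive_reflect (fun t => phi (Re z, t)) (Im z) _ h2).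
    + rewrite cd. transitivity (qconj (d (Cconj z) * - I)%quat); [f_equal; non_commutative_ring|].
      rewrite qconj_mul. f_equal. rewrite (qconj_unit (- I)%quat) by now apply imag_unit_opp.
      non_commutative_ring.
  - apply continuous_qconj.
    apply (continuous_comp Cconj d); [apply continuous_Cconj|exact h3].
Qed.

Definition c_norm (F : C -> C) (z : C) : C := Cmult (F z) (Cconj (F (Cconj z))).

Lemma reg_conj_whole (I : quat) (h : quat -> quat) (F : C -> C) :
  imag_unit I -> regular whole h -> (forall z, h (emb I z) = emb I (F z)) ->
  regular whole (reg_conj whole h) /\
  forall z, reg_conj whole h (emb I z) = emb I (Cconj (F (Cconj z))).
Proof.
  intros HI Hh HF.
  destruct (reg_conj_slice whole I h sliced_domain_whole Hh HI) as [H1 H2].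
  - intros z _. rewrite HF. apply emb_comm.
  - apply (holomorphic_reflect (slice whole I) I (fun z => h (emb I z))); auto.
    + apply slice_whole.
    + intros z _. rewrite HF. apply emb_comm.
  - split; [exact H1|]. intros z. rewrite (H2 z Logic.I), HF. now apply qconj_emb.
Qed.

(* On the slice of [I] the symmetrization is [F(z) * conj (F(conj z))]; this
   function commutes with conjugation, so the same formula holds on every slice. *)
Lemma symmetrization_slices (I J : quat) (h : quat -> quat) (F : C -> C) :
  imag_unit I -> imag_unit J -> regular whole h -> (forall z, h (emb I z) = emb I (F z)) ->
  regular whole (symmetrization whole h) /\
  forall z, symmetrization whole h (emb J z) = emb J (c_norm F z).
Proof.
  intros HI HJ Hh HF. destruct (reg_conj_whole I h F HI Hh HF) as [C1 C2].
  destruct (star_slice whole I h (reg_conj whole h) sliced_domain_whole Hh C1 HI) as [S1 S2].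
  { intros z _. rewrite HF. apply emb_comm. }
  split; [exact S1|]. intros z.
  assert (S3 : forall z, symmetrization whole h (emb I z) = emb I (c_norm F z)).
  { intros w. unfold symmetrization. rewrite (S2 w Logic.I), HF, C2. symmetry. now apply emb_mult. }
  rewrite (representation_formula whole I J (symmetrization whole h) z sliced_domain_whole S1 HI HJ Logic.I).
  destruct (stem_of_pair I (qreal (Re (c_norm F z))) (qreal (Im (c_norm F z)))
     (fun w => symmetrization whole h (emb I w)) z HI) as [-> ->].
  - rewrite S3. unfold emb. now rewrite qreal_comm.
  - rewrite S3. replace (c_norm F (Cconj z)) with (Cconj (c_norm F z)).
    + generalize (c_norm F z). intros u. qcrush.
    + unfold c_norm. rewrite Cmult_conj, !Cconj_conj. ring.
  - unfold emb. now rewrite qreal_comm.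
Qed.

(** The symmetrization maps every slice into its own line, so its inverse is an admissible left
    factor on each of them. Its zeros come from those of [F] at z and at conj z, hence the double
    condition. *)
Lemma reg_recip_regular (I : quat) (h : quat -> quat) (F : C -> C) (D : quat -> Prop) :
  imag_unit I -> regular whole h -> (forall z, h (emb I z) = emb I (F z)) ->
  sliced_domain D ->
  (forall J z, imag_unit J -> slice D J z -> F z <> RtoC 0 /\ F (Cconj z) <> RtoC 0) ->
  regular D (reg_recip whole h).
Proof.
  intros HI Hh HF (_ & _ & HD) Hn J HJ.
  destruct (symmetrization_slices I J h F HI HJ Hh HF) as [S1 S2].
  destruct (reg_conj_whole I h F HI Hh HF) as [C1 _].
  assert (HO := proj1 (HD J HJ)). unfold reg_recip.
  assert (cs : forall z, (J * symmetrization whole h (emb J z) = symmetrization whole h (emb J z) * J)%quat).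
  { intros z. rewrite S2. apply emb_comm. }
  assert (ns : forall z, slice D J z -> symmetrization whole h (emb J z) <> qreal 0).
  { intros z Hz. rewrite S2. apply emb_neq_0; [exact HJ|]. destruct (Hn J z HJ Hz) as [h1 h2].
    unfold c_norm. apply Cmult_neq_0; [exact h1|]. intros e. apply h2.
    rewrite <- (Cconj_conj (F (Cconj z))), e. unfold Cconj, RtoC; cbn. f_equal. ring. }
  apply holomorphic_mul; [exact HJ|exact HO| | |].
  - intros z Hz. apply qinv_comm; auto.
  - apply holomorphic_inv; auto. apply (holomorphic_subset (slice whole J)); [intros; exact Logic.I|now apply S1].
  - apply (holomorphic_subset (slice whole J)); [intros; exact Logic.I|now apply C1].
Qed.

(** The factor conj F(conj z) occurs both in the symmetrization and in the regular conjugate, and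
    cancels. *)
Lemma reg_recip_slice (I : quat) (h : quat -> quat) (F : C -> C) (z : C) :
  imag_unit I -> regular whole h -> (forall z, h (emb I z) = emb I (F z)) ->
  F z <> RtoC 0 -> F (Cconj z) <> RtoC 0 ->
  reg_recip whole h (emb I z) = emb I (Cinv (F z)).
Proof.
  intros HI Hh HF n1 n2.
  destruct (symmetrization_slices I I h F HI HI Hh HF) as [_ S2].
  destruct (reg_conj_whole I h F HI Hh HF) as [_ C2].
  assert (n3 : Cconj (F (Cconj z)) <> RtoC 0).
  { intros e. apply n2. rewrite <- (Cconj_conj (F (Cconj z))), e. unfold Cconj, RtoC; cbn. f_equal. ring. }
  unfold reg_recip. rewrite S2, C2, emb_inv, <- emb_mult; [|exact HI|exact HI|].
  - f_equal. unfold c_norm. field. now split.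
  - now apply Cmult_neq_0.
Qed.

Lemma Cminus_neq_0 (z w : C) : z <> w -> Cminus z w <> RtoC 0.
Proof.
  intros H e. apply H. transitivity (Cplus (Cminus z w) w); [|rewrite e]; ring.
Qed.

Lemma lin_powZ_nonneg (I : quat) (w z : C) (k : nat) : imag_unit I ->
  lin_powZ (emb I w) (Z.of_nat k) (emb I z) = emb I (Cpow (Cminus z w) k).
Proof.
  intros HI. unfold lin_powZ. replace (0 <=? Z.of_nat k)%Z with true by (symmetry; apply Z.leb_le; lia).
  rewrite Nat2Z.id. now apply lin_pow_slice.
Qed.

(** The conjugate of [w] is excluded too: the symmetrization of the power vanishes on the whole
    sphere through [w]. *)
Lemma lin_powZ_neg (I : quat) (w z : C) (k : nat) : imag_unit I ->
  z <> w -> Cconj z <> w ->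
  lin_powZ (emb I w) (- Z.of_nat (S k)) (emb I z) = emb I (Cinv (Cpow (Cminus z w) (S k))).
Proof.
  intros HI n1 n2. unfold lin_powZ.
  replace (0 <=? - Z.of_nat (S k))%Z with false by (symmetry; apply Z.leb_gt; lia).
  replace (Z.to_nat (- - Z.of_nat (S k))) with (S k) by lia.
  destruct (lin_pow_slice I w (S k) HI) as [L1 L2].
  apply (reg_recip_slice I _ (fun z => Cpow (Cminus z w) (S k)) z HI L1 L2);
  now apply Cpow_nz, Cminus_neq_0.
Qed.

Lemma Sigma_set_slice (I : quat) (w z : C) (r : R) : imag_unit I ->
  z <> w -> c_disc w r z -> Sigma_set (emb I w) r (emb I z).
Proof.
  intros HI n Hz. unfold Sigma_set, tau_dist, sigma_dist.
  assert (L : same_line (emb I z) (emb I w)) by (exists I, z, w; auto).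
  destruct excluded_middle_informative as [_|h]; [|contradiction].
  rewrite <- emb_minus, qabs_emb by exact HI. split; [|exact Hz].
  apply Cmod_gt_0. now apply Cminus_neq_0.
Qed.

(* [(z - w)^m] times the principal part of order [m]: a polynomial, hence
   meaningful at [w] as well. *)
Fixpoint laurent_poly (I : quat) (w : C) (a : Z -> quat) (m : nat) (z : C) : quat :=
  match m with
  | O => qreal 0
  | S m => (emb I (Cminus z w) * laurent_poly I w a m z + a (- Z.of_nat (S m))%Z)%quat
  end.

Definition principal_part (I : quat) (w : C) (a : Z -> quat) (m : nat) (z : C) : quat :=
  (emb I (Cinv (Cpow (Cminus z w) m)) * laurent_poly I w a m z)%quat.

Lemma emb_1 (I : quat) : emb I (RtoC 1) = qreal 1.
Proof. apply emb_RtoC. Qed.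

Lemma principal_part_S (I : quat) (w : C) (a : Z -> quat) (m : nat) (z : C) :
  imag_unit I -> z <> w ->
  principal_part I w a (S m) z = (principal_part I w a m z
    + emb I (Cinv (Cpow (Cminus z w) (S m))) * a (- Z.of_nat (S m))%Z)%quat.
Proof.
  intros HI n. assert (n' := Cminus_neq_0 z w n). unfold principal_part. cbn [laurent_poly].
  assert (e : emb I (Cinv (Cpow (Cminus z w) m)) =
    (emb I (Cinv (Cpow (Cminus z w) (S m))) * emb I (Cminus z w))%quat).
  { rewrite <- emb_mult by exact HI. f_equal. cbn [Cpow]. field.
    split; [now apply Cpow_nz|exact n']. }
  rewrite e. non_commutative_ring.
Qed.

Lemma principal_part_series (I : quat) (w : C) (a : Z -> quat) (m : nat) (z : C) :
  imag_unit I -> z <> w -> Cconj z <> w ->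
  (forall k, (m < k)%nat -> a (- Z.of_nat k)%Z = qreal 0) ->
  is_series (fun k : nat => (lin_powZ (emb I w) (- Z.of_nat (S k)) (emb I z)
     * a (- Z.of_nat (S k))%Z)%quat) (principal_part I w a m z).
Proof.
  intros HI n1 n2 Ha.
  assert (P : forall k, principal_part I w a (S k) z = sum_n (fun k : nat =>
    (lin_powZ (emb I w) (- Z.of_nat (S k)) (emb I z) * a (- Z.of_nat (S k))%Z)%quat) k).
  { induction k as [|k IH].
    - rewrite sum_O, principal_part_S, lin_powZ_neg by assumption.
      unfold principal_part; cbn [laurent_poly]. non_commutative_ring.
    - rewrite sum_Sn, <- qadd_plus, <- IH, (lin_powZ_neg I w z (S k)) by assumption.
      now apply principal_part_S. }
  assert (Q : forall j, principal_part I w a (m + j) z = principal_part I w a m z).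
  { induction j as [|j IH]; [f_equal; lia|].
    rewrite Nat.add_succ_r, principal_part_S, Ha, IH by (assumption || lia). non_commutative_ring. }
  apply (filterlim_ext_loc (fun _ => principal_part I w a m z)); [|apply filterlim_const].
  exists m. intros k hk. rewrite <- P. rewrite <- (Q (S k - m)%nat). f_equal. lia.
Qed.

Lemma laurent_poly_holomorphic (E : C -> Prop) (I : quat) (w : C) (a : Z -> quat) (m : nat) :
  imag_unit I -> open E -> holomorphic_on E I (laurent_poly I w a m).
Proof.
  intros HI HE. induction m as [|m IH]; [now apply holomorphic_const|]. cbn [laurent_poly].
  apply holomorphic_add; [exact HI| |now apply holomorphic_const].
  apply holomorphic_mul; [exact HI|exact HE|intros; apply emb_comm|now apply holomorphic_emb_sub|exact IH].
Qed.

Lemma holomorphic_emb_pow (E : C -> Prop) (I : quat) (w : C) (m : nat) :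
  imag_unit I -> open E -> holomorphic_on E I (fun z => emb I (Cpow (Cminus z w) m)).
Proof.
  intros HI HE. induction m as [|m IH].
  - cbn. now apply holomorphic_const.
  - apply (holomorphic_ext _ I (fun z => (emb I (Cminus z w) * emb I (Cpow (Cminus z w) m))%quat)); auto.
    + intros z _. cbn [Cpow]. symmetry. now apply emb_mult.
    + apply holomorphic_mul; [exact HI|exact HE|intros; apply emb_comm|now apply holomorphic_emb_sub|exact IH].
Qed.

Lemma pole_bound_extension (Om : quat -> Prop) (f : quat -> quat) (I : quat) (w : C) (m : nat) :
  imag_unit I -> regular Om f -> pole_bound Om f (emb I w) m ->
  exists (r : R) (phi : C -> quat),
    0 < r /\ holomorphic_on (c_disc w r) I phi /\
    (forall z, c_disc w r z -> z <> w ->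
       slice Om I z /\ phi z = (emb I (Cpow (Cminus z w) m) * f (emb I z))%quat) /\
    ((0 < m)%nat -> phi w = qreal 0 -> pole_bound Om f (emb I w) (pred m)).
Proof.
  intros HI Hf (r & a & Hr & HSig & HL & Ha).
  (* Negative powers are computed only where conj z differs from [w]. For non-real [w] the conjugate
     of [w] is at distance 2 |Im w|, outside the disc of radius [r1]; for real [w] nothing beyond z
     <> w is excluded. *)
  set (r1 := if Req_EM_T (Im w) 0 then r else Rmin r (Rabs (Im w))).
  assert (Hr1 : 0 < r1 <= r).
  { unfold r1. destruct Req_EM_T as [_|n]; [lra|]. split; [|apply Rmin_l].
    apply Rmin_glb_lt; [exact Hr|now apply Rabs_pos_lt]. }
  assert (Hconj : forall z, c_disc w r1 z -> z <> w -> Cconj z <> w).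
  { intros z Hz n e. unfold r1 in Hz. destruct Req_EM_T as [e0|n0].
    - apply n. rewrite <- (Cconj_conj z), e. destruct w as [w1 w2]. cbn in e0. subst w2.
      unfold Cconj; cbn. f_equal. ring.
    - unfold c_disc in Hz. generalize (Im_le_Cmod (Cminus z w)) (Rmin_r r (Rabs (Im w))).
      replace (Im (Cminus z w)) with (- (2 * Im w)).
      + rewrite Rabs_Ropp, Rabs_mult, (Rabs_pos_eq 2) by lra. generalize (Rabs_pos_lt _ n0). lra.
      + rewrite <- e. destruct z; unfold Im, Cconj, Cminus, Cplus, Copp; cbn. ring. }
  assert (Hin : forall z, c_disc w r1 z -> z <> w -> slice Om I z).
  { intros z Hz n. apply HSig. apply Sigma_set_slice; auto. unfold c_disc in *. lra. }
  (* The part of the expansion with nonnegative powers. Its value at [w] is set to the constant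
     coefficient, so that the power series represents it there as well. *)
  set (g := fun z => if excluded_middle_informative (z = w) then a 0%Z
     else (f (emb I z) - principal_part I w a m z)%quat).
  assert (Hser : forall z, c_disc w r1 z ->
    is_series (fun k => (emb I (Cpow (Cminus z w) k) * a (Z.of_nat k))%quat) (g z)).
  { intros z Hz. unfold g. destruct (excluded_middle_informative (z = w)) as [->|n].
    - apply (filterlim_ext (fun _ => a 0%Z)); [|apply filterlim_const].
      intros k. replace (Cminus w w) with (RtoC 0) by ring. induction k as [|k IH].
      + rewrite sum_O. cbn [Cpow]. rewrite emb_1. change (Z.of_nat 0) with 0%Z. non_commutative_ring.
      + rewrite sum_Sn, <- IH, <- qadd_plus. cbn [Cpow]. rewrite Cmult_0_l, emb_RtoC. non_commutative_ring.
    - destruct (HL (emb I z)) as (s1 & s2 & K1 & K2 & K3).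
      { apply Sigma_set_slice; auto. unfold c_disc in *. lra. }
      assert (e2 : s2 = principal_part I w a m z).
      { apply (filterlim_locally_unique _ _ _ K2).
        apply principal_part_series; auto. }
      rewrite K3, e2. replace (s1 + principal_part I w a m z - principal_part I w a m z)%quat
        with s1 by non_commutative_ring.
      apply (is_series_ext (fun k : nat => (lin_powZ (emb I w) (Z.of_nat k) (emb I z) * a (Z.of_nat k))%quat));
        [|exact K1].
      intros k. now rewrite lin_powZ_nonneg. }
  assert (HO : open (fun z => c_disc w r1 z /\ z <> w))
    by (apply open_and; [apply open_c_disc|apply open_C_neq]).
  assert (Hg : holomorphic_on (c_disc w (r1 / 16)) I g).
  { apply (power_series_holomorphic I w r1 (fun k => a (Z.of_nat k))); [exact HI|lra|exact Hser|].
    apply (holomorphic_ext _ I (fun z => (f (emb I z)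
      + (qinv (emb I (Cpow (Cminus z w) m)) * laurent_poly I w a m z) * qreal (-1))%quat) _ HI HO).
    - intros z [Hz n]. unfold g. destruct (excluded_middle_informative (z = w)) as [e|_]; [contradiction|].
      unfold principal_part. rewrite emb_inv by (auto; now apply Cpow_nz, Cminus_neq_0).
      rewrite qreal_comm, <- qopp_real. reflexivity.
    - apply holomorphic_add; [exact HI| |].
      + apply (holomorphic_subset (slice Om I)); [intros z [Hz n]; auto|now apply Hf].
      + apply holomorphic_mul_r; [exact HI|exact HO|].
        assert (nz : forall z, c_disc w r1 z /\ z <> w -> emb I (Cpow (Cminus z w) m) <> qreal 0).
        { intros z [_ n]. apply emb_neq_0; [exact HI|]. now apply Cpow_nz, Cminus_neq_0. }
        apply holomorphic_mul; [exact HI|exact HO| | |now apply laurent_poly_holomorphic].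
        * intros z Hz. apply qinv_comm; [now apply nz|apply emb_comm].
        * apply holomorphic_inv; [exact HI|exact HO|intros; apply emb_comm|exact nz|].
          now apply holomorphic_emb_pow. }
  exists (r1 / 16), (fun z => (emb I (Cpow (Cminus z w) m) * g z + laurent_poly I w a m z)%quat).
  split; [lra|split; [|split]].
  - apply holomorphic_add; [exact HI| |apply laurent_poly_holomorphic; [exact HI|apply open_c_disc]].
    apply holomorphic_mul; [exact HI|apply open_c_disc|intros; apply emb_comm| |exact Hg].
    apply holomorphic_emb_pow; [exact HI|apply open_c_disc].
  - intros z Hz n. assert (Hz1 : c_disc w r1 z) by (unfold c_disc in *; lra).
    split; [now apply Hin|]. unfold g.
    destruct (excluded_middle_informative (z = w)) as [e|_]; [contradiction|].
    assert (e : (emb I (Cpow (Cminus z w) m) * principal_part I w a m z = laurent_poly I w a m z)%quat).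
    { unfold principal_part. rewrite qmulA, <- emb_mult by exact HI. rewrite Cinv_r by now apply Cpow_nz, Cminus_neq_0.
      rewrite emb_1. apply qmul_1_l. }
    transitivity (emb I (Cpow (Cminus z w) m) * f (emb I z)
       - emb I (Cpow (Cminus z w) m) * principal_part I w a m z + laurent_poly I w a m z)%quat;
      [non_commutative_ring|]. rewrite e. non_commutative_ring.
  (* At [w] every term of the extension carries a factor z - w except the last coefficient of the
     polynomial, so its vanishing is that of a_(-m), and the same expansion has bound m - 1. *)
  - intros Hm H0. destruct m as [|m]; [lia|]. cbn [laurent_poly Cpow pred] in *.
    replace (Cminus w w) with (RtoC 0) in H0 by ring.
    rewrite Cmult_0_l, emb_RtoC in H0.
    assert (a0 : a (- Z.of_nat (S m))%Z = qreal 0).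
    { rewrite <- H0. non_commutative_ring. }
    exists r, a. split; [exact Hr|]. split; [exact HSig|]. split; [exact HL|].
    intros k hk. destruct (Nat.eq_dec k (S m)) as [->|h]; [exact a0|]. apply Ha. lia.
Qed.

(** * Filling in one sphere *)

Lemma sphere_emb (x y : R) (J : quat) (z : C) : imag_unit J ->
  sphere x y (emb J z) <-> z = (x, y) \/ z = Cconj (x, y).
Proof.
  intros HJ. split.
  - intros (K & HK & e).
    assert (e1 := f_equal qre e). assert (e2 := f_equal (fun q => qabs (qim q)) e). cbv beta in e2.
    rewrite !emb_qre in e1 by assumption. rewrite !emb_qabs_qim in e2 by assumption.
    destruct z as [a b]; cbn in *. subst a. unfold Cconj; cbn.
    revert e2. unfold Rabs; destruct (Rcase_abs b), (Rcase_abs y); intros e2;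
    [left|right|right|left]; f_equal; lra.
  - intros [-> | ->].
    + now exists J.
    + exists (- J)%quat. split; [now apply imag_unit_opp|]. symmetry. apply emb_opp_conj.
Qed.

Definition fill_sphere (Om : quat -> Prop) (x y : R) : quat -> Prop :=
  fun q => Om q \/ sphere x y q.

Lemma fill_sphere_symmetric (Om : quat -> Prop) (x y : R) :
  symmetric Om -> symmetric (fill_sphere Om x y).
Proof.
  intros HS a b J HJ [H|H] q Hq.
  - left. exact (HS a b J HJ H q Hq).
  - right. destruct Hq as (K & HK & ->). apply sphere_emb; [exact HK|].
    now apply (sphere_emb x y J).
Qed.

Lemma symmetric_off_sphere (U : quat -> Prop) (x y : R) :
  symmetric U -> symmetric (off_sphere U x y).
Proof.
  intros HS a b J HJ [H1 H2] q Hq. split; [exact (HS a b J HJ H1 q Hq)|].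
  intros H3. apply H2. destruct Hq as (K & HK & ->).
  apply sphere_emb; [exact HJ|]. now apply (sphere_emb x y K).
Qed.

Lemma continuous_polar (q : quat) : continuous (fun p => (qre p, qabs (qim p)) : C) q.
Proof.
  destruct (proj1 (continuous_quat (fun p : quat => p) q) (continuous_id q)) as (h0 & h1 & h2 & h3).
  apply continuous_pair.
  - apply (continuous_ext q0); [now intros [[[? ?] ?] ?]|exact h0].
  - unfold qabs. apply (continuous_comp (fun p => qdot (qim p) (qim p)) sqrt); [|apply continuous_sqrt].
    apply (continuous_ext (fun p => q1 p * q1 p + q2 p * q2 p + q3 p * q3 p)).
    + intros [[[? ?] ?] ?]. unfold q1, q2, q3; cbn. ring.
    + cont_poly; assumption.
Qed.

(** A symmetric set is the preimage of one slice under (Re q, |Im q|). These coordinates are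
    continuous everywhere, whereas the direction of Im q is not on the real axis. *)
Lemma symmetric_open (Om : quat -> Prop) (I : quat) :
  imag_unit I -> symmetric Om -> open (slice Om I) -> open Om.
Proof.
  intros HI HS HO q Hq. destruct (emb_polar q) as (J & z & HJ & -> & e).
  assert (Hz : slice Om I z) by exact (slice_change Om J I z HS HJ HI Hq).
  rewrite e in Hz. assert (K := continuous_polar (emb J z) _ (HO _ Hz)).
  unfold filtermap in K. revert K. apply filter_imp. intros p Hp.
  destruct (emb_polar p) as (J' & z' & HJ' & -> & e').
  rewrite <- e' in Hp. exact (slice_change Om I J' z' HS HI HJ' Hp).
Qed.

Lemma continuous_emb_id (J : quat) (z : C) : continuous (emb J) z.
Proof.
  apply (continuous_ext (fun w : C => emb J (fst w, snd w))); [now intros []|].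
  destruct z as [a b]. apply continuous_emb; [apply continuous_fst|apply continuous_snd].
Qed.

Lemma connected_set_ext {T : UniformSpace} (A B : T -> Prop) :
  (forall t, A t <-> B t) -> connected_set A -> connected_set B.
Proof.
  intros H HA. apply (connected_closure A); [apply H| |exact HA].
  intros t V Bt _ Vt. exists t. split; [now apply H|exact Vt].
Qed.

(** Covers at once a point already in the open set [E] and an isolated missing point. *)
Definition punctured_in (E : C -> Prop) (w : C) : Prop :=
  exists r, 0 < r /\ forall z, c_disc w r z -> z <> w -> E z.

Lemma punctured_in_dense (E V : C -> Prop) (w : C) :
  punctured_in E w -> open V -> V w -> exists z, E z /\ V z.
Proof.
  intros (r & r0 & H) HV Vw. destruct (open_c_disc_in V w HV Vw) as (s & s0 & Hs).
  set (d := Rmin r s / 2).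
  assert (K : 0 < Rmin r s) by now apply Rmin_glb_lt.
  assert (K1 := Rmin_l r s). assert (K2 := Rmin_r r s).
  assert (D : Cmod (Cminus (Cplus w (RtoC d)) w) = d).
  { replace (Cminus (Cplus w (RtoC d)) w) with (RtoC d) by ring.
    rewrite Cmod_R. apply Rabs_pos_eq. unfold d; lra. }
  exists (Cplus w (RtoC d)). split.
  - apply H; [unfold c_disc; rewrite D; unfold d; lra|]. intros e. rewrite e in D.
    replace (Cminus w w) with (RtoC 0) in D by ring. rewrite Cmod_0 in D. unfold d in D. lra.
  - apply Hs. unfold c_disc. rewrite D. unfold d; lra.
Qed.

Lemma open_fill (E F : C -> Prop) (P : list C) :
  open E -> (forall z, F z <-> E z \/ List.In z P) -> (forall w, List.In w P -> punctured_in E w) ->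
  open F.
Proof.
  intros HE HF HP z Hz. destruct (excluded_middle_informative (List.In z P)) as [i|n].
  - destruct (HP z i) as (r & r0 & Hr).
    apply (filter_imp (c_disc z r)); [|apply open_c_disc; now apply c_disc_center].
    intros u Hu. apply HF. destruct (excluded_middle_informative (u = z)) as [->|n]; auto.
  - apply HF in Hz. destruct Hz as [Ez|i]; [|contradiction].
    apply (filter_imp E); [|exact (HE z Ez)]. intros u Hu. apply HF. now left.
Qed.

Lemma fill_sphere_slice (Om : quat -> Prop) (x y : R) (I J : quat) (z : C) :
  symmetric Om -> imag_unit I -> imag_unit J ->
  slice (fill_sphere Om x y) J z <-> slice Om I z \/ List.In z (cons (x, y) (cons (Cconj (x, y)) nil)).
Proof.
  intros HS HI HJ. unfold slice at 1, fill_sphere. rewrite sphere_emb by exact HJ.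
  cbn [List.In]. split.
  - intros [h|[h|h]]; auto. left. exact (slice_change Om J I z HS HJ HI h).
  - intros [h|[h|[h|[]]]]; auto. left. exact (slice_change Om I J z HS HI HJ h).
Qed.

Lemma fill_sphere_symmetric_slice_domain (Om : quat -> Prop) (x y : R) (I : quat) :
  symmetric_slice_domain Om -> imag_unit I ->
  punctured_in (slice Om I) (x, y) -> punctured_in (slice Om I) (Cconj (x, y)) ->
  symmetric_slice_domain (fill_sphere Om x y).
Proof.
  intros HOm HI Hw Hw'. set (U := fill_sphere Om x y).
  assert (fill_punctured : forall w, List.In w (cons (x, y) (cons (Cconj (x, y)) nil)) ->
    punctured_in (slice Om I) w) by (intros w [<-|[<-|[]]]; assumption).
  assert (HU : symmetric U) by apply fill_sphere_symmetric, HOm.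
  destruct HOm as [[[_ HC] [[t Ht] HD]] HS].
  assert (HO : forall J, imag_unit J -> open (slice U J)).
  { intros J HJ. apply (open_fill (slice Om I) _ (cons (x, y) (cons (Cconj (x, y)) nil))).
    - apply (HD I HI).
    - intros z. now apply fill_sphere_slice.
    - exact fill_punctured. }
  split; [|exact HU]. split; [split|split].
  - exact (symmetric_open U I HI HU (HO I HI)).
  - apply (connected_closure Om); [now left| |exact HC].
    (* A point of the added sphere is approached within its own slice, using the punctured disc
       carried over from the slice of [I] by symmetry. *)
    intros q V Uq HV Vq. destruct Uq as [Oq|(J & HJ & ->)]; [now exists q|].
    destruct (punctured_in_dense (slice Om I) (fun z => V (emb J z)) (x, y) Hw) as (z & Oz & Vz).
    + apply (open_comp (emb J) V); [intros z _; apply continuous_emb_id|exact HV].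
    + exact Vq.
    + exists (emb J z). split; [|exact Vz]. exact (slice_change Om I J z HS HI HJ Oz).
  - exists t. now left.
  - intros J HJ. split; [now apply HO|].
    apply (connected_closure (slice Om I)); [| |apply (HD I HI)].
    + intros z Hz. now apply (fill_sphere_slice Om x y I J z HS HI HJ); left.
    + intros z V Hz HV Vz. apply (fill_sphere_slice Om x y I J z HS HI HJ) in Hz. destruct Hz as [Oz|i]; [now exists z|].
      exact (punctured_in_dense _ V z (fill_punctured z i) HV Vz).
Qed.

Lemma off_sphere_slice (Om : quat -> Prop) (x y : R) (I J : quat) (z : C) :
  symmetric Om -> imag_unit I -> imag_unit J ->
  slice (off_sphere (fill_sphere Om x y) x y) J z <-> (slice Om I z /\ z <> (x, y)) /\ z <> Cconj (x, y).
Proof.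
  intros HS HI HJ. unfold slice at 1, off_sphere.
  change (fill_sphere Om x y (emb J z)) with (slice (fill_sphere Om x y) J z).
  rewrite (fill_sphere_slice Om x y I J z HS HI HJ), sphere_emb by exact HJ. cbn [List.In].
  split; [intros [[h|[h|[h|[]]]] n]|intros [[h n1] n2]]; try (exfalso; apply n; now auto).
  - split; [split|]; [exact h|intros e; apply n; now left|intros e; apply n; now right].
  - split; [now left|]. intros [e|e]; contradiction.
Qed.

Lemma off_sphere_sliced_domain (Om : quat -> Prop) (x y : R) (I : quat) :
  symmetric_slice_domain Om -> imag_unit I ->
  sliced_domain (off_sphere (fill_sphere Om x y) x y).
Proof.
  intros HOm HI.
  destruct HOm as [[_ [[t Ht] HD]] HS]. destruct (HD I HI) as [HO HC].
  split; [|split].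
  - apply symmetric_off_sphere, fill_sphere_symmetric, HS.
  (* If y = 0 the removed sphere is the real point [x], so the real point of the domain may have to
     be moved slightly. *)
  - assert (K : exists u, slice Om I (u, 0) /\ u <> x).
    { assert (Ot : slice Om I (t, 0)) by (unfold slice; now rewrite emb_real).
      destruct (Req_dec t x) as [->|n]; [|now exists t].
      destruct (open_c_disc_in _ _ HO Ot) as (r & r0 & Hr).
      exists (x + r / 2). split; [|lra]. apply Hr. unfold c_disc. rewrite Cmod_x.
      replace (x + r / 2 - x) with (r / 2) by ring. rewrite Rabs_pos_eq; lra. }
    destruct K as (u & Ou & n). exists u. rewrite <- (emb_real I). apply (off_sphere_slice Om x y I I); [exact HS|exact HI|exact HI|].
    split; [split|]; [exact Ou|intros e; injection e; auto..].
  - intros J HJ. split.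
    + intros z Hz. apply (off_sphere_slice Om x y I J z HS HI HJ) in Hz.
      apply (filter_imp (fun z => (slice Om I z /\ z <> (x, y)) /\ z <> Cconj (x, y))).
      * intros v hv. now apply (off_sphere_slice Om x y I J v HS HI HJ).
      * revert z Hz. apply open_and; [apply open_and; [exact HO|]|]; apply open_C_neq.
    + apply (connected_set_ext (fun z => (slice Om I z /\ z <> (x, y)) /\ z <> Cconj (x, y))).
      * intros z. symmetry. exact (off_sphere_slice Om x y I J z HS HI HJ).
      * apply connected_puncture; [apply open_and; [exact HO|apply open_C_neq]|].
        now apply connected_puncture.
Qed.

(** * The real quadratic polynomial vanishing on the sphere *)

Lemma qpow_emb (J : quat) (u : C) (n : nat) : imag_unit J ->
  qpow (emb J u) n = emb J (Cpow u n).
Proof.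
  intros HJ. induction n as [|n IH]; cbn [qpow Cpow].
  - symmetry. apply emb_1.
  - now rewrite IH, emb_mult.
Qed.

(** The factors z - (x, y) and z - (x, -y) have a product with real coefficients; hence the same
    factorization holds on every slice, whatever the unit. *)
Lemma qpow_quadratic (J : quat) (x y : R) (z : C) (n : nat) : imag_unit J ->
  (((emb J z - qreal x) ^ 2 + qreal (y ^ 2)%R) ^ n)%quat =
  (emb J (Cpow (Cminus z (x, y)) n) * emb J (Cpow (Cminus z (Cconj (x, y))) n))%quat.
Proof.
  intros HJ. rewrite <- emb_mult, <- Cpow_mult_l, <- qpow_emb by exact HJ. f_equal.
  rewrite emb_mult by exact HJ.
  replace (Cminus z (x, y)) with (Cminus (Cminus z (RtoC x)) (Cmult (RtoC y) Ci))
    by (destruct z; unfold Cminus, Cplus, Copp, Cmult, RtoC, Ci; cbn; f_equal; ring).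
  replace (Cminus z (Cconj (x, y))) with (Cplus (Cminus z (RtoC x)) (Cmult (RtoC y) Ci))
    by (destruct z; unfold Cconj, Cminus, Cplus, Copp, Cmult, RtoC, Ci; cbn; f_equal; ring).
  rewrite <- emb_mult by exact HJ. rewrite <- (emb_RtoC J x), <- emb_minus.
  change 2%nat with (S (S O)). cbn [qpow].
  replace (emb J (Cminus z (RtoC x)) * qreal 1)%quat with (emb J (Cminus z (RtoC x))) by non_commutative_ring.
  rewrite <- emb_mult, <- (emb_RtoC J (y ^ 2)), <- emb_plus by exact HJ. f_equal.
  generalize (Cminus z (RtoC x)). intros [a b].
  unfold Cminus, Cplus, Copp, Cmult, RtoC, Ci; cbn. f_equal; ring.
Qed.

Lemma quadratic_recip_slice (J : quat) (x y : R) (z : C) (n : nat) : imag_unit J ->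
  z <> (x, y) -> z <> Cconj (x, y) ->
  qinv (((emb J z - qreal x) ^ 2 + qreal (y ^ 2)%R) ^ n)%quat =
  emb J (Cinv (Cmult (Cpow (Cminus z (x, y)) n) (Cpow (Cminus z (Cconj (x, y))) n))).
Proof.
  intros HJ n1 n2. rewrite qpow_quadratic, <- emb_mult by exact HJ. apply emb_inv; [exact HJ|].
  apply Cmult_neq_0; now apply Cpow_nz, Cminus_neq_0.
Qed.

Lemma quadratic_recip_regular (Om : quat -> Prop) (x y : R) (n : nat) (h : quat -> quat) :
  sliced_domain Om -> regular Om h ->
  (forall J z, imag_unit J -> slice Om J z -> z <> (x, y) /\ z <> Cconj (x, y)) ->
  regular Om (fun s => (qinv (((s - qreal x) ^ 2 + qreal (y ^ 2)%R) ^ n) * h s)%quat).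
Proof.
  intros (_ & _ & HD) Hh Hn J HJ. assert (HO := proj1 (HD J HJ)).
  assert (cm : forall z, (J * (((emb J z - qreal x) ^ 2 + qreal (y ^ 2)%R) ^ n) =
    (((emb J z - qreal x) ^ 2 + qreal (y ^ 2)%R) ^ n) * J)%quat).
  { intros z. rewrite qpow_quadratic, <- emb_mult by exact HJ. apply emb_comm. }
  assert (nz : forall z, slice Om J z ->
    (((emb J z - qreal x) ^ 2 + qreal (y ^ 2)%R) ^ n)%quat <> qreal 0).
  { intros z Hz. destruct (Hn J z HJ Hz) as [n1 n2].
    rewrite qpow_quadratic, <- emb_mult by exact HJ. apply emb_neq_0; [exact HJ|].
    apply Cmult_neq_0; now apply Cpow_nz, Cminus_neq_0. }
  apply holomorphic_mul; [exact HJ|exact HO| | |now apply Hh].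
  - intros z Hz. apply qinv_comm; auto.
  - apply holomorphic_inv; auto.
    apply (holomorphic_ext _ J (fun z => (emb J (Cpow (Cminus z (x, y)) n)
      * emb J (Cpow (Cminus z (Cconj (x, y))) n))%quat)); auto.
    + intros z _. symmetry. now apply qpow_quadratic.
    + apply holomorphic_mul; auto; try (intros; apply emb_comm); now apply holomorphic_emb_pow.
Qed.

(** Near each of the two points one factor is absorbed into the local extension and the other
    remains as a polynomial. The points may coincide, which is the case of a real p; then the first
    formula prevails. *)
Lemma holomorphic_patch (E : C -> Prop) (I : quat) (w w' : C) (m n : nat)
    (f phi phi' : C -> quat) (r r' : R) :
  imag_unit I -> open E -> holomorphic_on E I f -> 0 < r -> 0 < r' ->
  holomorphic_on (c_disc w r) I phi -> holomorphic_on (c_disc w' r') I phi' ->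
  (forall z, c_disc w r z -> z <> w -> phi z = (emb I (Cpow (Cminus z w) m) * f z)%quat) ->
  (forall z, c_disc w' r' z -> z <> w' -> phi' z = (emb I (Cpow (Cminus z w') n) * f z)%quat) ->
  exists G : C -> quat,
    holomorphic_on (fun z => E z \/ z = w \/ z = w') I G /\
    (forall z, z <> w -> z <> w' ->
      G z = (emb I (Cmult (Cpow (Cminus z w) m) (Cpow (Cminus z w') n)) * f z)%quat) /\
    G w = (emb I (Cpow (Cminus w w') n) * phi w)%quat /\
    (w <> w' -> G w' = (emb I (Cpow (Cminus w' w) m) * phi' w')%quat).
Proof.
  intros HI HE Hf Hr Hr' Hphi Hphi' Ephi Ephi'.
  set (G := fun z =>
    if excluded_middle_informative (z = w) then (emb I (Cpow (Cminus w w') n) * phi w)%quat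
    else if excluded_middle_informative (z = w') then (emb I (Cpow (Cminus w' w) m) * phi' w')%quat
    else (emb I (Cmult (Cpow (Cminus z w) m) (Cpow (Cminus z w') n)) * f z)%quat).
  assert (G0 : forall z, z <> w -> z <> w' ->
      G z = (emb I (Cmult (Cpow (Cminus z w) m) (Cpow (Cminus z w') n)) * f z)%quat).
  { intros z n1 n2. unfold G. destruct excluded_middle_informative; [contradiction|].
    now destruct excluded_middle_informative. }
  assert (Gw : G w = (emb I (Cpow (Cminus w w') n) * phi w)%quat).
  { unfold G. now destruct excluded_middle_informative. }
  assert (Gw' : w <> w' -> G w' = (emb I (Cpow (Cminus w' w) m) * phi' w')%quat).
  { intros nw. unfold G. destruct excluded_middle_informative as [e|_]; [now symmetry in e|].
    now destruct excluded_middle_informative. }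
  exists G. split; [|auto].
  apply holomorphic_local; [exact HI|]. intros z Hz.
  destruct (excluded_middle_informative (z = w)) as [->|n1].
  (* When w = w' the neighbourhood must not exclude w', being centred there. *)
  - exists (fun u => c_disc w r u /\ (w = w' \/ u <> w')).
    assert (HV : open (fun u => c_disc w r u /\ (w = w' \/ u <> w'))).
    { apply open_and; [apply open_c_disc|].
      destruct (excluded_middle_informative (w = w')) as [e|n1].
      - intros u _. exists (mkposreal 1 Rlt_0_1). intros; now left.
      - intros u [e|n2]; [contradiction|]. apply (filter_imp (fun u => u <> w')); [now right|].
        now apply open_C_neq. }
    split; [exact HV|]. split.
    + split; [now apply c_disc_center|]. destruct (excluded_middle_informative (w = w')); auto.
    + apply (holomorphic_ext _ I (fun u => (emb I (Cpow (Cminus u w') n) * phi u)%quat) _ HI HV).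
      * intros u [Hu hu]. destruct (excluded_middle_informative (u = w)) as [->|n2]; [now rewrite Gw|].
        rewrite G0; [|exact n2|destruct hu as [<-|hu]; assumption].
        rewrite (Ephi u Hu n2), qmulA, <- emb_mult by exact HI. do 2 f_equal. ring.
      * apply holomorphic_mul; [exact HI|exact HV|intros; apply emb_comm|now apply holomorphic_emb_pow|].
        apply (holomorphic_subset (c_disc w r)); [now intros u []|exact Hphi].
  - destruct (excluded_middle_informative (z = w')) as [->|n2].
    + exists (fun u => c_disc w' r' u /\ u <> w).
      assert (HV : open (fun u => c_disc w' r' u /\ u <> w))
        by (apply open_and; [apply open_c_disc|apply open_C_neq]).
      split; [exact HV|]. split; [split; [now apply c_disc_center|exact n1]|].
      apply (holomorphic_ext _ I (fun u => (emb I (Cpow (Cminus u w) m) * phi' u)%quat) _ HI HV).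
      * intros u [Hu hu]. destruct (excluded_middle_informative (u = w')) as [->|n2].
        -- rewrite Gw'; [reflexivity|]. intros e. apply n1. now symmetry.
        -- rewrite G0 by assumption. now rewrite (Ephi' u Hu n2), qmulA, <- emb_mult by exact HI.
      * apply holomorphic_mul; [exact HI|exact HV|intros; apply emb_comm|now apply holomorphic_emb_pow|].
        apply (holomorphic_subset (c_disc w' r')); [now intros u []|exact Hphi'].
    + exists (fun u => (E u /\ u <> w) /\ u <> w').
      assert (HV : open (fun u => (E u /\ u <> w) /\ u <> w'))
        by (apply open_and; [apply open_and; [exact HE|]|]; apply open_C_neq).
      split; [exact HV|]. split.
      { destruct Hz as [Ez|[e|e]]; [now repeat split|contradiction..]. }
      apply (holomorphic_ext _ I (fun u => (emb I (Cpow (Cminus u w) m) *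
        (emb I (Cpow (Cminus u w') n) * f u))%quat) _ HI HV).
      * intros u [[_ h1] h2]. rewrite G0 by assumption. now rewrite emb_mult, qmulA by exact HI.
      * apply holomorphic_mul; [exact HI|exact HV|intros; apply emb_comm|now apply holomorphic_emb_pow|].
        apply holomorphic_mul; [exact HI|exact HV|intros; apply emb_comm|now apply holomorphic_emb_pow|].
        apply (holomorphic_subset E); [now intros u [[]]|exact Hf].
Qed.

Lemma order_extension (Om : quat -> Prop) (f : quat -> quat) (I : quat) (w : C) (m : nat) :
  imag_unit I -> regular Om f -> is_order Om f (emb I w) m ->
  exists (r : R) (phi : C -> quat),
    0 < r /\ holomorphic_on (c_disc w r) I phi /\
    (forall z, c_disc w r z -> z <> w -> slice Om I z) /\
    (forall z, c_disc w r z -> z <> w ->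
       phi z = (emb I (Cpow (Cminus z w) m) * f (emb I z))%quat) /\
    ((0 < m)%nat -> phi w <> qreal 0).
Proof.
  intros HI Hf [Hb Hmin].
  destruct (pole_bound_extension Om f I w m HI Hf Hb) as (r & phi & Hr & Hphi & Hz & H0).
  exists r, phi. split; [exact Hr|]. split; [exact Hphi|]. split; [|split].
  - intros z h1 h2. apply (Hz z h1 h2).
  - intros z h1 h2. apply (Hz z h1 h2).
  - intros Hm e. specialize (Hmin _ (H0 Hm e)). lia.
Qed.

(** * Assembly of the factorization *)

Theorem theorem1p14 :
  forall (Om Om' : quat -> Prop) (f : quat -> quat) (x y : R) (I : quat)
         (m n : nat),
    symmetric_slice_domain Om ->
    semiregular Om Om' f ->
    imag_unit I ->
    Om (emb I (x, y)) ->
    is_order Om' f (emb I (x, y)) m ->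
    is_order Om' f (emb I (x, - y)) n ->
    (m <= n)%nat ->
    exists U : quat -> Prop,
      symmetric_slice_domain U /\
      U (emb I (x, y)) /\
      (forall q, U q -> Om q) /\
      (forall q, off_sphere U x y q -> Om' q) /\
      exists g : quat -> quat,
        regular U g /\
        factorization U f x y I m n g /\
        (forall g' : quat -> quat,
           regular U g' -> factorization U f x y I m n g' ->
           forall q, U q -> g' q = g q) /\
        ((0 < n)%nat -> y <> 0 ->
           g (emb I (x, - y)) <> qreal 0 /\
           ((0 < m)%nat -> g (emb I (x, y)) <> qreal 0)).
Proof.
  intros Om Om' f x y I m n HOm (HOm' & Hsub & Hf & _) HI Hp Hm Hn Hmn.
  set (w := (x, y) : C). set (w' := Cconj w).
  change (x, - y) with w' in Hn |- *. change (x, y) with w in Hp, Hm |- *.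
  destruct (order_extension Om' f I w m HI Hf Hm) as (r & phi & Hr & Hphi & Hin & Ephi & Nphi).
  destruct (order_extension Om' f I w' n HI Hf Hn) as (r' & phi' & Hr' & Hphi' & Hin' & Ephi' & Nphi').
  set (U := fill_sphere Om' x y). set (D := off_sphere U x y).
  assert (HS := proj2 HOm').
  assert (HU : symmetric_slice_domain U).
  { apply (fill_sphere_symmetric_slice_domain Om' x y I HOm' HI); [now exists r|now exists r']. }
  assert (GU := symmetric_slice_domain_sliced U HU).
  assert (GD : sliced_domain D) by exact (off_sphere_sliced_domain Om' x y I HOm' HI).
  assert (SU : forall J z, imag_unit J -> slice U J z -> slice Om' I z \/ z = w \/ z = w').
  { intros J z HJ Hz. apply (fill_sphere_slice Om' x y I J z HS HI HJ) in Hz.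
    destruct Hz as [h|[h|[h|[]]]]; auto. }
  assert (SD : forall J z, imag_unit J -> slice D J z -> (slice Om' I z /\ z <> w) /\ z <> w').
  { intros J z HJ Hz. now apply (off_sphere_slice Om' x y I J z HS HI HJ) in Hz. }
  assert (DU : forall q, D q -> U q) by (intros q [h _]; exact h).
  assert (DOm' : forall q, D q -> Om' q).
  { intros q [[h|h] k]; [exact h|contradiction]. }
  assert (regular_sub : forall (A B : quat -> Prop) h, (forall q, B q -> A q) -> regular A h -> regular B h).
  { intros A B h HAB Hh J HJ. apply (holomorphic_subset (slice A J)); [|now apply Hh].
    intros z Hz. now apply HAB. }
  assert (conj_ne : forall z, z <> w -> z <> w' -> Cconj z <> w /\ Cconj z <> w').
  { intros z n1 n2. split; intros e; [apply n2|apply n1]; rewrite <- (Cconj_conj z), e;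
      [reflexivity|apply Cconj_conj]. }
  set (F := fun z => Cmult (Cpow (Cminus z w) m) (Cpow (Cminus z w') n)).
  assert (F0 : forall z, z <> w -> z <> w' -> F z <> RtoC 0).
  { intros z n1 n2. apply Cmult_neq_0; now apply Cpow_nz, Cminus_neq_0. }
  destruct (lin_pow_slice I w m HI) as [Lm1 Lm2]. destruct (lin_pow_slice I w' n HI) as [Ln1 Ln2].
  destruct (star_slice whole I _ _ sliced_domain_whole Lm1 Ln1 HI) as [HF1 HF2].
  { intros z _. rewrite Lm2. apply emb_comm. }
  assert (HF3 : forall z, star whole (lin_pow (emb I w) m) (lin_pow (emb I w') n) (emb I z) = emb I (F z)).
  { intros z. rewrite (HF2 z Logic.I), Lm2, Ln2. symmetry. now apply emb_mult. }
  set (R1 := reg_recip whole (star whole (lin_pow (emb I w) m) (lin_pow (emb I w') n))).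
  set (R2 := fun s => (qinv (((s - qreal x) ^ 2 + qreal (y ^ 2)%R) ^ n) * lin_pow (emb I w) (n - m) s)%quat).
  assert (R1r : regular D R1).
  { apply (reg_recip_regular I _ F D HI HF1 HF3 GD). intros J z HJ Hz.
    destruct (SD J z HJ Hz) as [[_ n1] n2]. destruct (conj_ne z n1 n2). split; now apply F0. }
  assert (R1s : forall z, slice D I z -> R1 (emb I z) = emb I (Cinv (F z))).
  { intros z Hz. destruct (SD I z HI Hz) as [[_ n1] n2]. destruct (conj_ne z n1 n2).
    apply (reg_recip_slice I _ F z HI HF1 HF3); now apply F0. }
  assert (R2r : regular D R2).
  { apply quadratic_recip_regular; [exact GD| |].
    - apply (regular_sub whole); [intros; exact Logic.I|]. now apply lin_pow_slice.
    - intros J z HJ Hz. now destruct (SD J z HJ Hz) as [[_ n1] n2]. }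
  (* Here m <= n enters: (z - w)^n splits off (z - w)^(n - m), which cancels against the numerator
     and leaves 1 / F, as for [R1]. *)
  assert (R2s : forall z, slice D I z -> R2 (emb I z) = emb I (Cinv (F z))).
  { intros z Hz. destruct (SD I z HI Hz) as [[_ n1] n2]. unfold R2.
    rewrite quadratic_recip_slice by assumption.
    rewrite (proj2 (lin_pow_slice I w (n - m) HI)), <- emb_mult by exact HI. f_equal.
    fold w. fold w'. unfold F.
    assert (e : Cpow (Cminus z w) n = Cmult (Cpow (Cminus z w) m) (Cpow (Cminus z w) (n - m))).
    { rewrite <- Cpow_add_r. f_equal. lia. }
    rewrite e. field. repeat split; now apply Cpow_nz, Cminus_neq_0. }
  (* Both left factors are regular on [D] and restrict to 1 / F on the slice of [I], so the two
     formulas are treated as one. *)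
  assert (Star : forall R h, regular D R -> regular D h ->
    (forall z, slice D I z -> R (emb I z) = emb I (Cinv (F z))) ->
    regular D (star D R h) /\
    forall z, slice D I z -> star D R h (emb I z) = (emb I (Cinv (F z)) * h (emb I z))%quat).
  { intros R h Rr Hh Rs. destruct (star_slice D I R h GD Rr Hh HI) as [S1 S2].
    - intros z Hz. rewrite Rs by exact Hz. apply emb_comm.
    - split; [exact S1|]. intros z Hz. now rewrite (S2 z Hz), Rs. }
  destruct (holomorphic_patch (slice Om' I) I w w' m n (fun z => f (emb I z)) phi phi' r r' HI
    (proj1 (proj2 (proj2 (proj1 HOm')) I HI)) (Hf I HI) Hr Hr' Hphi Hphi' Ephi Ephi')
    as (G & HG & G0 & Gw & Gw').
  set (g := slice_ext I G).
  assert (Hg : regular U g).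
  { apply slice_ext_regular; [apply GU| |exact HI|].
    - intros J HJ. apply GU, HJ.
    - apply (holomorphic_subset (fun z => slice Om' I z \/ z = w \/ z = w')); [|exact HG].
      intros z Hz. exact (SU I z HI Hz). }
  assert (gs : forall z, g (emb I z) = G z) by (intros z; now apply slice_ext_same).
  assert (Hfac : forall R, regular D R ->
    (forall z, slice D I z -> R (emb I z) = emb I (Cinv (F z))) ->
    forall q, D q -> f q = star D R g q).
  { intros R Rr Rs. destruct (Star R g Rr (regular_sub U D g DU Hg) Rs) as [S1 S2].
    apply (regular_eq_slice D I f _ GD (regular_sub Om' D f DOm' Hf) S1 HI).
    intros z Hz. destruct (SD I z HI Hz) as [[_ n1] n2].
    rewrite (S2 z Hz), gs, (G0 z n1 n2). fold (F z).
    rewrite qmulA, <- emb_mult, Cinv_l, emb_1, qmul_1_l; auto. }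
  exists U. split; [exact HU|]. split.
  { right. apply (sphere_emb x y I w HI). now left. }
  split.
  { intros q [Hq|(K & HK & ->)]; [now apply Hsub|].
    exact (slice_change Om I K w (proj2 HOm) HI HK Hp). }
  split; [exact DOm'|].
  exists g. split; [exact Hg|]. split; [|split].
  - intros q Hq. split; [now apply (Hfac R1)|now apply (Hfac R2)].
  (* On a real interval in [D] the factor 1 / F can be cancelled, so g and g' agree there; the
     identity principle on [U] then also reaches the sphere. *)
  - intros g' Hg' Hfac'. destruct (proj1 (proj2 GD)) as [t Ht].
    assert (HD := proj2 (proj2 GD)).
    assert (Dt : slice D I (t, 0)) by (unfold slice; now rewrite emb_real).
    destruct (open_c_disc_in _ _ (proj1 (HD I HI)) Dt) as (s & s0 & Hs).
    apply (regular_sub_identity U g' g t s GU Hg' Hg (DU _ Ht) s0).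
    intros u Hu _.
    assert (Du : slice D I (u, 0)) by (apply Hs; unfold c_disc; now rewrite Cmod_x).
    destruct (SD I _ HI Du) as [[_ n1] n2].
    destruct (Star R1 g' R1r (regular_sub U D g' DU Hg') R1s) as [_ S2].
    destruct (Star R1 g R1r (regular_sub U D g DU Hg) R1s) as [_ S3].
    destruct (Hfac' _ Du) as [e1 _]. assert (e2 := Hfac R1 R1r R1s _ Du).
    change (f (emb I (u, 0)) = star D R1 g' (emb I (u, 0))) in e1.
    rewrite (S2 _ Du) in e1. rewrite (S3 _ Du) in e2.
    rewrite <- (emb_real I). rewrite <- (qmul_1_l (g' _)), <- (qmul_1_l (g _)), <- (emb_1 I).
    rewrite <- (Cinv_r (F (u, 0)) (F0 _ n1 n2)), emb_mult, <- !qmulA by exact HI.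
    now rewrite <- e1, <- e2.
  - intros Hn0 Hy.
    (* For non-real p the powers of w - w' are invertible and the leading coefficients decide. For
       real p the factor (w - w')^n would make G vanish at w. At a point of order 0 there is no
       leading coefficient of a pole, and the value there may be zero; hence the condition on
       [m]. *)
    assert (ww' : w <> w').
    { unfold w', w, Cconj; cbn. intros e. injection e. lra. }
    assert (nz : forall a b k q, a <> b -> q <> qreal 0 ->
      (emb I (Cpow (Cminus a b) k) * q)%quat <> qreal 0).
    { intros a b k q nab nq e. apply nq. apply (qmul_integral (emb I (Cpow (Cminus a b) k))); [|exact e].
      apply emb_neq_0; [exact HI|]. now apply Cpow_nz, Cminus_neq_0. }
    split; [|intros Hm0]; rewrite gs.
    + rewrite (Gw' ww'). apply nz; [now apply not_eq_sym|auto].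
    + rewrite Gw. apply nz; auto.
Qed.
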